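(* There exist absolute constants $c,C>0$ such that the following holds. For all $n$, all $t=m/\binom n2$ (with $m$ an integer) satisfying $Cn^{-1/2}(\log n)^{1/2}\le t\le 1/2$, and all $a$ with $Ct^{3/2}n^{3/2}\sqrt{\log n}\le a\le ct^{3/2}n^2$, we have $$\exp\left(\frac{-Ca^2}{t^3n^3}\right)\;\le\;\mathbb P\big(D_\triangle(G_m)<-a\big)\;\le\;\exp\left(\frac{-ca^2}{t^3n^3}\right).$$
   Context: Notation: $\log$ is the natural logarithm, $N=\binom n2$, $m$ is an integer, $t=m/N$, and $G_m\sim G(n,m)$ is a uniformly random graph with $n$ (labelled) vertices and $m$ edges. $N_\triangle(G)$ is the number of isomorphic copies of the triangle in $G$ counted with multiplicity, i.e. the number of injective maps $V(K_3)\to V(G)$ preserving edges (so $N_\triangle(K_4)=24$). $D_\triangle(G_m)=N_\triangle(G_m)-\mathbb E[N_\triangle(G_m)]$. *)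

(* Defs.v *)
From mathcomp Require Import all_boot all_order all_algebra.
From mathcomp Require Import all_reals all_analysis.

Set Implicit Arguments.
Unset Strict Implicit.
Unset Printing Implicit Defensive.

Import Order.TTheory GRing.Theory Num.Theory.

Local Open Scope ring_scope.

(** A graph on the vertex set 'I_n is identified with its edge set, a set of
    2-element subsets of 'I_n. *)
Definition graphs_nm (n m : nat) : {set {set {set 'I_n}}} :=
  [set E : {set {set 'I_n}} |
    (E \subset [set e : {set 'I_n} | #|e| == 2%N]) && (#|E| == m)].

Definition adj (n : nat) (E : {set {set 'I_n}}) (u v : 'I_n) : bool :=
  [set u; v] \in E.

(** All pairs of distinct elements of 'I_3 are edges of K_3. Copies are counted
    as labelled embeddings: each triangle of the graph contributes 6. *)
Definition triangle_count (n : nat) (E : {set {set 'I_n}}) : nat :=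
  #|[set f : {ffun 'I_3 -> 'I_n} |
      injectiveb f && [forall i, forall j, (i != j) ==> adj E (f i) (f j)]]|.

Definition unif_prob (R : realType) (T : finType) (S : {set T}) (A : pred T) : R :=
  #|[set x in S | A x]|%:R / #|S|%:R.

Definition unif_expect (R : realType) (T : finType) (S : {set T}) (X : T -> R) : R :=
  (\sum_(x in S) X x) / #|S|%:R.

Definition triangle_deviation (R : realType) (n m : nat) (E : {set {set 'I_n}}) : R :=
  (triangle_count E)%:R
  - unif_expect (graphs_nm n m) (fun E' => (triangle_count E')%:R).

(* Main.v *)
Require Import Defs.
From mathcomp Require Import all_boot all_order all_algebra.
From mathcomp Require Import perm.
From mathcomp Require Import all_reals all_analysis.
From mathcomp Require Import ring lra zify.

Set Implicit Arguments.
Unset Strict Implicit.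
Unset Printing Implicit Defensive.

Import Order.TTheory GRing.Theory Num.Theory.

Local Open Scope ring_scope.

(** Write [N = n], [t = m / C(n, 2)], [A] for the adjacency matrix of the random
    graph, [D] for the deviation of its triangle count and [U = a^2/(t^3 N^3)].

    Upper bound. The uniform graph with [m] edges is the product measure with
    edge probability [t] conditioned on an event of probability at least
    [1/(C(n,2)+1)] ([unif_prob_le_expect]), so the product measure may be used.
    Revealing the vertices one after the other and, for each vertex, its edges
    to the earlier ones, the triangle count becomes a martingale plus a multiple
    of the edge count, which is constant ([triangles_devsum]). The increment
    of the martingale at an edge [uv] is [A_uv - t] times a slope, which is
    essentially a codegree and therefore never lies below [- 2 t^2 N]. This
    one-sided bound is all that a lower tail requires: [expect_devsum] gives an
    exponential supermartingale compensated by the sum of the squared slopes.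
    Outside an event of probability [(N+2) exp(-N)] that sum is at most a
    constant times [t^2 N^3]: its main part consists of quadratic forms in the
    rows of [A], whose exponential moments are controlled by the Gram matrix of
    the earlier rows, and the Gram matrix is in turn controlled by the same sum
    over earlier rows ([tame_all], [slope2_le]). Optimizing the exponential
    parameter gives [lower_tail_upper], a Gaussian bound with variance of order
    [t^3 N^3].

    Lower bound. Split off disjoint vertex sets [X] and [Y], each with about
    [N/4] and [N/2] elements, and group [Y] into pairs. For [x] in [X] and a pair
    [{y, y'}], exchanging the roles of [xy] and [xy'] is an involution of the set
    of graphs with [m] edges, under which [z = A_xy - A_xy'] changes sign. In
    these signs the triangle count is a polynomial of degree two,
    [F0 + sum z_i a_i + sum c_ij z_i z_j], with coefficients invariant under all
    the involutions ([slot_decomposition]). Multiplying the uniform measure by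
    [prod (1 - dl sg(a_i) z_i)] lowers the linear part by [dl sum z_i^2 |a_i|],
    typically of order [dl t^2 N^(5/2)], while the errors are controlled by
    second moments, since the recentred signs are orthogonal under the tilted
    measure ([tilted_lower_tail]). The size of the drift comes from second and
    fourth moments of the coefficients [a_i] ([slotcoef_abs_ge]) and the
    Paley-Zygmund inequality ([drift_large]). The invariant part [F0] might be
    large and spoil the argument; but [F0] is the average of the triangle
    count over the orbits of the involutions, so its mean excess is at most the
    mean of [D^-], which the upper bound limits to the order
    [t^(3/2) N^(3/2) sqrt(ln n)]. With [dl] of order [a / (t^2 N^(5/2))] the tilted probability of [D < -a] is bounded below
    by a constant, and the density has second moment [exp(dl^2 m)], that is
    [exp(O(U))]; the Cauchy-Schwarz inequality concludes ([lower_tail_lower]). *)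

(** * Exponential moments of centred bits *)

Section ElementaryInequalities.
Variable R : realType.
Implicit Types (x y z p q s : R).

Lemma expR_le_quadratic z : z <= 1 / 2 -> expR z <= 1 + z + 2 * z ^+ 2.
Proof.
move=> hz.
have h1 : 0 < 1 - z by lra.
have h2 : expR z <= (1 - z)^-1.
  rewrite -[z in expR z]opprK expRN lef_pV2 ?posrE ?expR_gt0 //.
  by have := expR_ge1Dx (- z); lra.
apply: (le_trans h2).
rewrite -[leLHS]mul1r ler_pdivrMr //.
have -> : (1 + z + 2 * z ^+ 2) * (1 - z) = 1 + z ^+ 2 * (1 - 2 * z) by ring.
by rewrite lerDl mulr_ge0 ?sqr_ge0 //; lra.
Qed.

(** If the exponents are at most [1/2] they are expanded to second order and
    the linear term averages out; otherwise [|y| > 1/8] and [32 y^2] dominates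
    both exponents. *)
Lemma bernoulli_quadratic_mgf p q y : 0 <= p <= 1 -> 0 <= q <= 1 / 4 ->
  p * expR (q * (1 - p) ^+ 2 + 2 * (1 - p) * y)
  + (1 - p) * expR (q * (- p) ^+ 2 + 2 * (- p) * y)
  <= expR (2 * p * q + 32 * y ^+ 2).
Proof.
move=> /andP[p0 p1] /andP[q0 q1].
have p1' : 0 <= 1 - p by lra.
have sq1 : (1 - p) ^+ 2 <= 1 - p by rewrite expr2 ler_piMr //; lra.
have sq2 : p ^+ 2 <= p by rewrite expr2 ler_piMr //.
have nsq : (- p) ^+ 2 = p ^+ 2 by ring.
have [hs|hl] := lerP (q + 2 * `|y|) (1 / 2).
  have z1 : q * (1 - p) ^+ 2 + 2 * (1 - p) * y <= 1 / 2.
    have : (1 - p) * y <= `|y|.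
      apply: (le_trans (ler_norm _)); rewrite normrM ger0_norm // ler_piMl //; lra.
    have : q * (1 - p) ^+ 2 <= q by rewrite ler_piMr //; lra.
    by lra.
  have z2 : q * (- p) ^+ 2 + 2 * (- p) * y <= 1 / 2.
    have : - p * y <= `|y|.
      by apply: (le_trans (ler_norm _)); rewrite normrM normrN (ger0_norm p0) ler_piMl //; lra.
    have : q * (- p) ^+ 2 <= q by rewrite nsq ler_piMr //; lra.
    by lra.
  have e1 := expR_le_quadratic z1; have e2 := expR_le_quadratic z2.
  apply: le_trans (expR_ge1Dx _).
  apply: (le_trans (lerD (ler_wpM2l p0 e1) (ler_wpM2l p1' e2))).
  rename q into a, y into b.
  have -> : p * (1 + (a * (1 - p) ^+ 2 + 2 * (1 - p) * b) + 2 * (a * (1 - p) ^+ 2 + 2 * (1 - p) * b) ^+ 2) +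
     (1 - p) * (1 + (a * (- p) ^+ 2 + 2 * (- p) * b) + 2 * (a * (- p) ^+ 2 + 2 * (- p) * b) ^+ 2)
     = 1 + a * (p * (1 - p)) + 2 * (p * (1 - p)) * (a ^+ 2 * ((1 - p) ^+ 3 + p ^+ 3)
         + 4 * a * b * ((1 - p) ^+ 2 - p ^+ 2) + 4 * b ^+ 2).
    by ring.
  set v := p * (1 - p).
  have v0 : 0 <= v by rewrite mulr_ge0.
  have vp : v <= p by rewrite ler_piMr //; lra.
  have v1 : v <= 1 by lra.
  have c3 : (1 - p) ^+ 3 + p ^+ 3 <= 1.
    have -> : (1 - p) ^+ 3 + p ^+ 3 = 1 - 3 * v by rewrite /v; ring.
    by lra.
  have cr : 4 * a * b * ((1 - p) ^+ 2 - p ^+ 2) <= a ^+ 2 + 4 * b ^+ 2.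
    set d := (1 - p) ^+ 2 - p ^+ 2.
    have d1 : d ^+ 2 <= 1.
      have -> : d = 1 - 2 * p by rewrite /d; ring.
      have -> : (1 - 2 * p) ^+ 2 = 1 - 4 * v by rewrite /v; ring.
      by lra.
    have : 0 <= (a - 2 * b * d) ^+ 2 by apply: sqr_ge0.
    have : b ^+ 2 * d ^+ 2 <= b ^+ 2 by rewrite ler_piMr ?sqr_ge0.
    have -> : (a - 2 * b * d) ^+ 2 = a ^+ 2 - 4 * a * b * d + 4 * (b ^+ 2 * d ^+ 2) by ring.
    by lra.
  have a2 : a ^+ 2 <= a / 4 by rewrite expr2 ler_wpM2l //; lra.
  have t1 : a ^+ 2 * ((1 - p) ^+ 3 + p ^+ 3) <= a ^+ 2 by rewrite ler_piMr ?sqr_ge0.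
  have sum : a ^+ 2 * ((1 - p) ^+ 3 + p ^+ 3)
         + 4 * a * b * ((1 - p) ^+ 2 - p ^+ 2) + 4 * b ^+ 2 <= a / 2 + 8 * b ^+ 2 by lra.
  have := ler_wpM2l v0 sum.
  have : v * a <= p * a by rewrite ler_wpM2r.
  have : v * b ^+ 2 <= b ^+ 2 by rewrite ler_piMl ?sqr_ge0.
  have b2 : 0 <= b ^+ 2 by apply: sqr_ge0.
  rewrite [a * v]mulrC -[2 * v * _]mulrA.
  set S := v * (_ + _ + _).
  rewrite mulrDr [v * (a / 2)]mulrA [v * (8 * _)]mulrCA.
  by lra.
have y8 : 1 / 8 < `|y| by lra.
have big : q + 2 * `|y| <= 32 * y ^+ 2.
  have -> : y ^+ 2 = `|y| * `|y| by rewrite -expr2 real_normK ?num_real.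
  have : `|y| * (1 / 8) <= `|y| * `|y| by rewrite ler_wpM2l // ltW.
  by lra.
have z1 : q * (1 - p) ^+ 2 + 2 * (1 - p) * y <= 2 * p * q + 32 * y ^+ 2.
  have : (1 - p) * y <= `|y|.
    apply: (le_trans (ler_norm _)); rewrite normrM ger0_norm // ler_piMl //; lra.
  have : q * (1 - p) ^+ 2 <= q by rewrite ler_piMr //; lra.
  have : 0 <= p * q by rewrite mulr_ge0.
  by lra.
have z2 : q * (- p) ^+ 2 + 2 * (- p) * y <= 2 * p * q + 32 * y ^+ 2.
  have : - p * y <= `|y|.
    by apply: (le_trans (ler_norm _)); rewrite normrM normrN (ger0_norm p0) ler_piMl //; lra.
  have : q * (- p) ^+ 2 <= q by rewrite nsq ler_piMr //; lra.
  have : 0 <= p * q by rewrite mulr_ge0.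
  by lra.
rewrite -ler_expR in z1; rewrite -ler_expR in z2.
have := lerD (ler_wpM2l p0 z1) (ler_wpM2l p1' z2).
by rewrite -mulrDl (_ : p + (1 - p) = 1) ?mul1r //; ring.
Qed.

(** The restriction on [s] is one-sided, which is what makes the lower tail of
    triangle counts so regular. *)
Lemma bernoulli_lower_mgf p s : 0 <= p <= 1 -> - (1 / 2) <= s ->
  p * expR (- (s * (1 - p))) + (1 - p) * expR (s * p) <= expR (2 * p * s ^+ 2).
Proof.
move=> /andP[p0 p1] hs.
have -> : p * expR (- (s * (1 - p))) + (1 - p) * expR (s * p)
        = expR (s * p) * (1 + p * (expR (- s) - 1)).
  have -> : - (s * (1 - p)) = s * p + - s by ring.
  by rewrite expRD; ring.
have e1 : 1 + p * (expR (- s) - 1) <= expR (p * (expR (- s) - 1)) by exact: expR_ge1Dx.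
apply: (le_trans (ler_wpM2l (expR_ge0 _) e1)).
rewrite -expRD ler_expR.
have : expR (- s) <= 1 - s + 2 * s ^+ 2.
  by have := @expR_le_quadratic (- s); rewrite sqrrN; apply; lra.
move=> e2; have : p * (expR (- s) - 1) <= p * (- s + 2 * s ^+ 2) by apply: ler_wpM2l => //; lra.
by move=> h; apply: (le_trans (lerD (lexx _) h)); rewrite le_eqVlt; apply/orP; left; apply/eqP; ring.
Qed.

Lemma sum_cauchy_schwarz (I : finType) (P : pred I) (f g : I -> R) :
  (\sum_(i | P i) f i * g i) ^+ 2 <= (\sum_(i | P i) f i ^+ 2) * (\sum_(i | P i) g i ^+ 2).
Proof.
set F := \sum_(i | P i) f i ^+ 2; set G := \sum_(i | P i) g i ^+ 2.
set H := \sum_(i | P i) f i * g i.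
have F0 : 0 <= F by apply: sumr_ge0 => i _; apply: sqr_ge0.
have key u v : 0 <= u ^+ 2 * F - 2 * u * v * H + v ^+ 2 * G.
  have -> : u ^+ 2 * F - 2 * u * v * H + v ^+ 2 * G = \sum_(i | P i) (u * f i - v * g i) ^+ 2.
    rewrite /F /G /H !mulr_sumr -sumrN -!big_split /=.
    by apply: eq_bigr => i _; ring.
  by apply: sumr_ge0 => i _; apply: sqr_ge0.
have [F00|Fn0] := eqVneq F 0.
  have G0 : 0 <= G by apply: sumr_ge0 => i _; apply: sqr_ge0.
  have := key (H * (1 + G)) (H ^+ 2); rewrite F00 !mul0r mulr0.
  have -> : 0 - 2 * (H * (1 + G)) * H ^+ 2 * H + H ^+ 2 ^+ 2 * G = - (H ^+ 2) ^+ 2 * (2 + G) by ring.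
  rewrite mulNr oppr_ge0 pmulr_lle0; last lra.
  move=> h; have : (H ^+ 2) ^+ 2 = 0 by apply: le_anti; rewrite h sqr_ge0.
  by move/eqP; rewrite sqrf_eq0 => /eqP ->.
have Fp : 0 < F by rewrite lt_neqAle eq_sym Fn0.
have := key H F.
have -> : H ^+ 2 * F - 2 * H * F * H + F ^+ 2 * G = F * (F * G - H ^+ 2) by ring.
by rewrite pmulr_rge0 // subr_ge0.
Qed.

End ElementaryInequalities.

(** * Product measures revealed bit by bit *)

Section ProductMeasure.
Variables (R : realType) (T : finType) (p : R).
Hypothesis p01 : 0 <= p <= 1.
Implicit Types (l : seq T) (E : {set T}) (F G : {set T} -> R).

(** The head of the list is the bit revealed last: it is integrated out first,
    with all the other bits known. *)
Fixpoint expect l F : R :=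
  if l is e :: l' then expect l' (fun E => p * F (e |: E) + (1 - p) * F E)
  else F set0.

Definition bit E e : R := (e \in E)%:R.

Let p0 : 0 <= p. Proof. by case/andP: p01. Qed.
Let q0 : 0 <= 1 - p. Proof. by case/andP: p01 => _; rewrite subr_ge0. Qed.

Lemma expect_le l F G :
  (forall E, E \subset l -> F E <= G E) -> expect l F <= expect l G.
Proof.
elim: l F G => [|e l IH] F G h /=; first by apply: h; apply/subsetP => x; rewrite inE.
apply: IH => E sE; apply: lerD; apply: ler_wpM2l => //; apply: h; apply/subsetP => x.
  by rewrite !inE => /orP[->//|/(subsetP sE) ->]; rewrite orbT.
by rewrite inE => /(subsetP sE) ->; rewrite orbT.
Qed.

Lemma eq_expect l F G :
  (forall E, E \subset l -> F E = G E) -> expect l F = expect l G.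
Proof. by move=> h; apply: le_anti; rewrite !expect_le // => E sE; rewrite h. Qed.

Lemma expect_scale l a F : expect l (fun E => a * F E) = a * expect l F.
Proof.
elim: l F => [|e l IH] F //=; rewrite -IH; apply: eq_expect => E _.
by ring.
Qed.

Lemma expectD l F G : expect l (fun E => F E + G E) = expect l F + expect l G.
Proof.
elim: l F G => [|e l IH] F G //=; rewrite -IH; apply: eq_expect => E _.
by ring.
Qed.

Lemma expect_cst l a : expect l (fun=> a) = a.
Proof.
elim: l => [|e l IH] //=; rewrite -[RHS]IH; apply: eq_expect => E _.
by ring.
Qed.

Lemma expect_sum l (I : Type) (r : seq I) (P : pred I) (F : I -> {set T} -> R) :
  expect l (fun E => \sum_(i <- r | P i) F i E) = \sum_(i <- r | P i) expect l (F i).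
Proof.
elim: r => [|i r IH].
  rewrite big_nil -[RHS](expect_cst l); apply: eq_expect => E _; by rewrite big_nil.
rewrite big_cons -IH; case: ifP => Pi; last first.
  by apply: eq_expect => E _; rewrite big_cons Pi.
by rewrite -expectD; apply: eq_expect => E _; rewrite big_cons Pi.
Qed.

Lemma expect_cat l1 l2 F :
  expect (l1 ++ l2) F = expect l2 (fun E2 => expect l1 (fun E1 => F (E1 :|: E2))).
Proof.
elim: l1 F => [|e l1 IH] F /=; first by apply: eq_expect => E _; rewrite finset.set0U.
rewrite IH; apply: eq_expect => E2 _; apply: eq_expect => E1 _.
by rewrite finset.setUA.
Qed.

Lemma sum_subsetU1 (L : {set T}) e (G : {set T} -> R) : e \notin L ->
  \sum_(E : {set T} | E \subset e |: L) G E = \sum_(E : {set T} | E \subset L) (G (e |: E) + G E).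
Proof.
move=> eL; rewrite (bigID (fun E : {set T} => e \in E)) /= big_split /=; congr (_ + _).
  rewrite (reindex_onto (fun E => e |: E) (fun E => E :\ e)) /=; last first.
    by move=> E /andP[_ eE]; rewrite setD1K.
  apply: eq_bigl => E; rewrite setU11 andbT.
  apply/andP/idP => [[s1 /eqP s2]|sE].
    rewrite -s2; apply/subsetP => x; rewrite !inE => /andP[xe /orP[/eqP h|xE]].
      by rewrite h eqxx in xe.
    have := subsetP s1 x; rewrite !inE xE orbT => /(_ isT).
    by rewrite (negbTE xe).
  split; first by rewrite finset.setUS.
  by rewrite setU1K //; apply: contra eL => /(subsetP sE).
apply: eq_bigl => E; apply/andP/idP => [[s1 eE]|sE].
  apply/subsetP => x xE; have := subsetP s1 x xE; rewrite !inE => /orP[/eqP h|//].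
  by rewrite -h xE in eE.
split; last by apply: contra eL => /(subsetP sE).
by apply: (subset_trans sE); apply: finset.subsetUr.
Qed.

(** The weights depend on the size of the set only; this is what links the
    product measure to uniform sets of fixed size. *)
Lemma expectE l F : uniq l ->
  expect l F = \sum_(E : {set T} | E \subset l) p ^+ #|E| * (1 - p) ^+ (size l - #|E|) * F E.
Proof.
elim: l F => [|e l IH] F /=.
  move=> _; rewrite (big_pred1 set0) => [|E]; last first.
    apply/idP/eqP => [/subsetP h|->]; last by apply/subsetP => x; rewrite inE.
    by apply/setP => x; rewrite inE; apply/negbTE/negP => /h.
  by rewrite cards0 !expr0 !mul1r.
move=> /andP[el ul]; rewrite IH //.
have -> : \sum_(E : {set T} | E \subset e :: l) p ^+ #|E| * (1 - p) ^+ ((size l).+1 - #|E|) * F E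
  = \sum_(E : {set T} | E \subset e |: [set x in l]) p ^+ #|E| * (1 - p) ^+ ((size l).+1 - #|E|) * F E.
  by apply: eq_bigl => E; apply/subsetP/subsetP => h x /h; rewrite !inE.
rewrite sum_subsetU1 ?inE //.
have sl (E : {set T}) : (E \subset [set x in l]) = (E \subset l).
  by apply/subsetP/subsetP => h x /h; rewrite !inE.
apply: eq_big => [E|E sE]; first by rewrite sl.
have eE : e \notin E by apply: contra el => /(subsetP sE).
have cE : (#|E| <= size l)%N.
  by rewrite -(card_uniqP ul); apply: subset_leq_card.
rewrite cardsU1 eE add1n subSS subSn // !exprS.
by ring.
Qed.

End ProductMeasure.
Arguments expect {R T} p l F.
Arguments bit {R T} E e.

Section Rows.
Variables (R : realType) (T : finType) (p : R).
Hypothesis p01 : 0 <= p <= 1.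

Fixpoint row_bits (e : nat -> T) k : seq T :=
  if k is k'.+1 then e k' :: row_bits e k' else [::].

Lemma mem_row_bits e k x : reflect (exists2 i, (i < k)%N & x = e i) (x \in row_bits e k).
Proof.
elim: k => [|k IH] /=; first by apply: (iffP idP) => [|[]].
rewrite inE; apply: (iffP orP) => [[/eqP ->|/IH[i ik ->]]|[i ik xE]].
- by exists k.
- by exists i => //; apply: ltnW.
move: ik; rewrite ltnS leq_eqVlt => /orP[/eqP ik|ik]; first by left; rewrite xE ik.
by right; apply/IH; exists i.
Qed.

Lemma bit_setU1 (E : {set T}) e x : bit (e |: E) x = (if x == e then 1 else bit E x) :> R.
Proof. by rewrite /bit !inE; case: eqP. Qed.

Lemma bit01 (E : {set T}) x : 0 <= (bit E x : R) <= 1.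
Proof. by rewrite /bit ler0n lern1 leq_b1. Qed.

(** Hanson-Wright in its crudest form. Integrating out the last variable leaves
    a quadratic form with matrix [Q + 32 q q^T], where [q] is the last row; when
    the Hilbert-Schmidt norm is at most 1/64 the norm decreases by at least
    the amount [32 |q|^2] by which the trace grows, so that [trace + norm] never
    increases. *)
Lemma expect_row_quadratic (e : nat -> T) k (Q : nat -> nat -> R) h :
  (forall i j, (i < k)%N -> (j < k)%N -> e i = e j -> i = j) ->
  (forall i j, Q i j = Q j i) -> (forall i, 0 <= Q i i) ->
  0 <= h <= 1 / 64 ->
  \sum_(i < k) \sum_(j < k) Q i j ^+ 2 <= h ^+ 2 ->
  expect p (row_bits e k) (fun E => expR (\sum_(i < k) \sum_(j < k)
     Q i j * (bit E (e i) - p) * (bit E (e j) - p)))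
  <= expR (2 * p * (\sum_(i < k) Q i i + h)).
Proof.
elim: k Q h => [|k IH] Q h einj Qsym Qpos /andP[h0 h1] HS.
  rewrite /= !big_ord0 add0r ler_expR mulr_ge0 // mulr_ge0 //.
  by case/andP: p01.
have [p0 p1] := andP p01.
pose q i := Q k i.
pose b := \sum_(i < k) q i ^+ 2.
pose M := \sum_(i < k) \sum_(j < k) Q i j ^+ 2.
have b0 : 0 <= b by apply: sumr_ge0 => i _; apply: sqr_ge0.
have M0 : 0 <= M by apply: sumr_ge0 => i _; apply: sumr_ge0 => j _; apply: sqr_ge0.
have HSE : M + 2 * b + Q k k ^+ 2 <= h ^+ 2.
  move: HS; rewrite big_ord_recr /= big_ord_recr /=.
  under eq_bigr do rewrite big_ord_recr /=.
  rewrite big_split /= -/M.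
  rewrite (eq_bigr (fun i : 'I_k => q i ^+ 2)); last by move=> i _; rewrite Qsym.
  rewrite -/b => H; apply: le_trans H.
  by rewrite mulrDl mul1r !addrA.
have hh : h ^+ 2 <= h / 64 by rewrite expr2 ler_wpM2l //; lra.
have kk : Q k k <= 1 / 4.
  have : Q k k ^+ 2 <= (1 / 4) ^+ 2.
    apply: le_trans (_ : h ^+ 2 <= _); first lra.
    by rewrite ler_pXn2r ?nnegrE //; lra.
  by rewrite ler_pXn2r ?nnegrE //; lra.
pose Q' i j := Q i j + 32 * (q i * q j).
pose h' := h - 32 * b.
have Qk2 := sqr_ge0 (Q k k).
have hb : 64 * b <= h by lra.
have HS' : \sum_(i < k) \sum_(j < k) Q' i j ^+ 2 <= h' ^+ 2.
  pose W := \sum_(i < k) \sum_(j < k) Q i j * (q i * q j).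
  have -> : \sum_(i < k) \sum_(j < k) Q' i j ^+ 2 = M + 64 * W + 1024 * b ^+ 2.
    rewrite /M /W expr2 {2}/b big_distrl /= !mulr_sumr -!big_split /=; apply: eq_bigr => i _.
    rewrite /b !mulr_sumr -!big_split /=; apply: eq_bigr => j _.
    by rewrite /Q'; ring.
  have W2 : W ^+ 2 <= M * b ^+ 2.
    have := sum_cauchy_schwarz xpredT (fun ij : 'I_k * 'I_k => Q ij.1 ij.2) (fun ij => q ij.1 * q ij.2).
    rewrite -(pair_bigA _ (fun i j : 'I_k => Q i j * (q i * q j))) /= -/W.
    rewrite -(pair_bigA _ (fun i j : 'I_k => Q i j ^+ 2)) /= -/M.
    rewrite -(pair_bigA _ (fun i j : 'I_k => (q i * q j) ^+ 2)) /=.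
    suff -> : \sum_(i < k) \sum_(j < k) (q i * q j) ^+ 2 = b ^+ 2 by [].
    rewrite expr2 {1}/b big_distrl /=; apply: eq_bigr => i _.
    by rewrite /b mulr_sumr; apply: eq_bigr => j _; rewrite exprMn.
  pose N := Num.sqrt M.
  have N0 : 0 <= N by apply: sqrtr_ge0.
  have N2 : N ^+ 2 = M by rewrite sqr_sqrtr.
  have WN : W <= N * b.
    have [W0|W0] := lerP W 0; first by apply: (le_trans W0); rewrite mulr_ge0.
    rewrite -(@ler_pXn2r _ 2) ?nnegrE ?mulr_ge0 ?(ltW W0) //.
    by rewrite exprMn N2.
  have Nh : N <= h - 64 * b.
    rewrite -(@ler_pXn2r _ 2) ?nnegrE ?subr_ge0 // N2.
    have : h * b <= b / 64 by rewrite mulrC ler_wpM2l //; lra.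
    have := sqr_ge0 b.
    have -> : (h - 64 * b) ^+ 2 = h ^+ 2 - 128 * (h * b) + 4096 * b ^+ 2 by ring.
    by lra.
  apply: (@le_trans _ _ ((N + 32 * b) ^+ 2)).
    have -> : (N + 32 * b) ^+ 2 = M + 64 * (N * b) + 1024 * b ^+ 2 by rewrite -N2; ring.
    by lra.
  by rewrite ler_pXn2r ?nnegrE /h' //; lra.
have IH' := IH Q' h'.
have tr : 2 * p * Q k k + 2 * p * (\sum_(i < k) Q' i i + h')
          = 2 * p * (\sum_(i < k.+1) Q i i + h).
  rewrite big_ord_recr /= /Q' big_split /= /h' /b mulr_sumr.
  rewrite [X in h - X](eq_bigr (fun i : 'I_k => 32 * (q i * q i))); last first.
    by move=> i _; rewrite expr2.
  by ring.
rewrite -tr expRD.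
apply: (@le_trans _ _ (expR (2 * p * Q k k) * expect p (row_bits e k)
   (fun E => expR (\sum_(i < k) \sum_(j < k) Q' i j * (bit E (e i) - p) * (bit E (e j) - p))))); last first.
  rewrite ler_wpM2l ?expR_ge0 //; apply: IH' => //.
  - by move=> i j ik jk; apply: einj; apply: ltnW.
  - by move=> i j; rewrite /Q' Qsym [q i * _]mulrC.
  - by move=> i; rewrite /Q' addr_ge0 // mulr_ge0 // -expr2 sqr_ge0.
  - by rewrite /h'; lra.
rewrite -expect_scale //=; apply: expect_le => // E sE.
have ekE : e k \notin E.
  apply/negP => /(subsetP sE) /mem_row_bits[i ik] /esym /einj.
  by rewrite ltnS (ltnW ik) ltnSn => /(_ isT isT) ki; rewrite ki ltnn in ik.
pose x i := bit E (e i) - p.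
pose y := \sum_(i < k) q i * x i.
pose S := \sum_(i < k) \sum_(j < k) Q i j * x i * x j.
have step (E' : {set T}) xi : (forall i, (i < k)%N -> bit E' (e i) - p = x i) ->
    bit E' (e k) - p = xi ->
    \sum_(i < k.+1) \sum_(j < k.+1) Q i j * (bit E' (e i) - p) * (bit E' (e j) - p)
    = S + (Q k k * xi ^+ 2 + 2 * xi * y).
  move=> hx hk; rewrite big_ord_recr /= big_ord_recr /= hk.
  under eq_bigr => i _.
    rewrite big_ord_recr /= hk (hx i) // Qsym -/(q i).
    under eq_bigr => j _ do rewrite (hx j) //.
    over.
  rewrite big_split /= -/S.
  under [X in _ + (X + _) = _]eq_bigr => j _ do rewrite (hx j) // -/(q j).
  have -> : \sum_(i < k) q i * x i * xi = xi * y.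
    by rewrite /y mulr_sumr; apply: eq_bigr => i _; ring.
  have -> : \sum_(i < k) q i * xi * x i = xi * y.
    by rewrite /y mulr_sumr; apply: eq_bigr => i _; ring.
  by ring.
rewrite (step _ (1 - p)); first last.
- by rewrite bit_setU1 eqxx.
- move=> i ik; rewrite bit_setU1; case: eqP => // /einj.
  by rewrite ltnS (ltnW ik) ltnSn => /(_ isT isT) ki; rewrite ki ltnn in ik.
rewrite (step E (- p)) //; last by rewrite /bit (negbTE ekE) sub0r.
rewrite !expRD.
set e1 := expR (Q k k * _) * _; set e2 := expR (Q k k * _) * _.
have -> : p * (expR S * e1) + (1 - p) * (expR S * e2) = expR S * (p * e1 + (1 - p) * e2) by ring.
have -> : \sum_(i < k) \sum_(j < k) Q' i j * (bit E (e i) - p) * (bit E (e j) - p) = S + 32 * y ^+ 2.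
  rewrite expr2 {1}/y big_distrl /= mulr_sumr /S -big_split /=; apply: eq_bigr => i _.
  rewrite /y !mulr_sumr -big_split /=; apply: eq_bigr => j _.
  by rewrite /Q' -/(x i) -/(x j); ring.
rewrite [X in _ <= _ * X]expRD [leRHS]mulrCA ler_wpM2l ?expR_ge0 // -expRD /e1 /e2 -!expRD.
by apply: bernoulli_quadratic_mgf; rewrite ?Qpos.
Qed.

(** Bits of one row are independent, so one-bit bounds multiply. *)
Lemma expect_row_indep (e : nat -> T) k (f : nat -> R -> R) (c : nat -> R) :
  (forall i j, (i < k)%N -> (j < k)%N -> e i = e j -> i = j) ->
  (forall i, (i < k)%N -> p * expR (f i 1) + (1 - p) * expR (f i 0) <= expR (c i)) ->
  expect p (row_bits e k) (fun E => expR (\sum_(i < k) f i (bit E (e i)))) <= expR (\sum_(i < k) c i).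
Proof.
elim: k => [|k IH] einj hf; first by rewrite /= !big_ord0.
rewrite big_ord_recr /= addrC expRD.
apply: (@le_trans _ _ (expR (c k) * expect p (row_bits e k)
   (fun E => expR (\sum_(i < k) f i (bit E (e i)))))); last first.
  rewrite ler_wpM2l ?expR_ge0 //; apply: IH.
    by move=> i j ik jk; apply: einj; apply: ltnW.
  by move=> i ik; apply: hf; apply: ltnW.
rewrite -expect_scale //=; apply: expect_le => // E sE.
have ekE : e k \notin E.
  apply/negP => /(subsetP sE) /mem_row_bits[i ik] /esym /einj.
  by rewrite ltnS (ltnW ik) ltnSn => /(_ isT isT) ki; rewrite ki ltnn in ik.
have bk : bit E (e k) = 0 :> R by rewrite /bit (negbTE ekE).
rewrite !big_ord_recr /= bit_setU1 eqxx bk.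
under eq_bigr => i _.
  rewrite bit_setU1 (_ : e i == e k = false); last first.
    apply/eqP => /einj; rewrite ltnS (ltnW (ltn_ord i)) ltnSn => /(_ isT isT) ki.
    by have := ltn_ord i; rewrite ki ltnn.
  over.
rewrite !expRD; set s := expR (\sum_(i < k) _).
have -> : p * (s * expR (f k 1)) + (1 - p) * (s * expR (f k 0))
   = (p * expR (f k 1) + (1 - p) * expR (f k 0)) * s by ring.
by rewrite ler_wpM2r ?expR_ge0 // hf.
Qed.

End Rows.

(** * Triangular arrays of bits *)

Section TriangularArray.
Variables (R : realType) (T : finType) (p : R) (ed : nat -> nat -> T) (n : nat).
Hypothesis p01 : 0 <= p <= 1.
Hypothesis ed_inj : forall v u v' u', (u < v)%N -> (v < n)%N -> (u' < v')%N -> (v' < n)%N ->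
  ed v u = ed v' u' -> v = v' /\ u = u'.

Fixpoint all_bits v : seq T :=
  if v is v'.+1 then row_bits (ed v') v' ++ all_bits v' else [::].

(** Strictly lower triangular: the entries above the diagonal are set to zero,
    so that sums over earlier vertices may range over any larger interval. *)
Definition lower_bit (E : {set T}) (v u : nat) : R :=
  if (u < v)%N then bit E (ed v u) else 0.

Lemma mem_all_bits v x :
  reflect (exists v' u, [/\ (u < v')%N, (v' < v)%N & x = ed v' u]) (x \in all_bits v).
Proof.
elim: v => [|v IH] /=; first by apply: (iffP idP) => [|[? [? []]]].
rewrite mem_cat; apply: (iffP orP).
  case=> [/mem_row_bits[u uv ->]|/IH[v' [u [h1 h2 ->]]]].
    by exists v, u; rewrite uv ltnSn.
  by exists v', u; rewrite h1 ltnW.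
move=> [v' [u [h1 h2 xE]]]; move: h2; rewrite ltnS leq_eqVlt => /orP[/eqP v'E|h2].
  by left; apply/mem_row_bits; exists u; rewrite -?v'E.
by right; apply/IH; exists v', u.
Qed.

Lemma uniq_all_bits v : (v <= n)%N -> uniq (all_bits v).
Proof.
elim: v => [//|v IH] vn /=; rewrite cat_uniq IH ?(ltnW vn) // andbT; apply/andP; split.
  suff H k : (k <= v)%N -> uniq (row_bits (ed v) k) by apply: H.
  elim: k => [//|k IHk] kv /=; rewrite IHk ?(ltnW kv) // andbT.
  apply/negP => /mem_row_bits[i ik] /(ed_inj kv vn (ltn_trans ik kv) vn)[_ ki].
  by rewrite ki ltnn in ik.
apply/hasPn => x /mem_all_bits[v' [u [uv' v'v ->]]]; apply/negP => /mem_row_bits[i iv].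
by move/(ed_inj uv' (ltn_trans v'v vn) iv vn) => [v'E _]; rewrite v'E ltnn in v'v.
Qed.

Lemma size_all_bits v : size (all_bits v) = 'C(v, 2).
Proof.
have sr k e : size (row_bits e k) = k by elim: k => //= k ->.
elim: v => [//|v IH] /=; by rewrite size_cat sr IH binS bin1 addnC.
Qed.

Section OneRow.
Variables (v : nat) (E E1 : {set T}).
Hypotheses (vn : (v < n)%N) (sE : E \subset all_bits v) (sE1 : E1 \subset row_bits (ed v) v).

Lemma low_new u : lower_bit (E1 :|: E) v u = lower_bit E1 v u.
Proof.
rewrite /lower_bit; case: ifP => // uv; rewrite /bit inE; congr (_%:R); congr (nat_of_bool _).
case: (boolP (ed v u \in E)) => [|_]; last by rewrite orbF.
move/(subsetP sE) => /mem_all_bits[v' [u' [u'v' v'v]]].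
by move/(ed_inj uv vn u'v' (ltn_trans v'v vn)) => [vE _]; rewrite vE ltnn in v'v.
Qed.

Lemma low_old u w : (u < v)%N -> lower_bit (E1 :|: E) u w = lower_bit E u w.
Proof.
move=> uv; rewrite /lower_bit; case: ifP => // wu; rewrite /bit inE; congr (_%:R); congr (nat_of_bool _).
case: (boolP (ed u w \in E1)) => [|_] //.
move/(subsetP sE1) => /mem_row_bits[u' u'v].
by move/(ed_inj wu (ltn_trans uv vn) u'v vn) => [uE _]; rewrite uE ltnn in uv.
Qed.

End OneRow.

Lemma row_inj v : (v < n)%N ->
  forall i j, (i < v)%N -> (j < v)%N -> ed v i = ed v j -> i = j.
Proof. by move=> vn i j iv jv /(ed_inj iv vn jv vn)[]. Qed.

(** Potential method: [Phi] does not increase on average when a row is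
    revealed on top of the earlier ones. *)
Lemma expect_rows (Phi : nat -> {set T} -> R) m : (m <= n)%N ->
  (forall v (E : {set T}), (v < m)%N -> E \subset all_bits v ->
     expect p (row_bits (ed v) v) (fun E1 => Phi v.+1 (E1 :|: E)) <= Phi v E) ->
  expect p (all_bits m) (Phi m) <= Phi 0%N set0.
Proof.
elim: m => [//|m IH] mn h /=; rewrite expect_cat //.
apply: le_trans (IH (ltnW mn) _); last by move=> v E vm; apply: h; apply: ltnW.
by apply: expect_le => // E sE; apply: h.
Qed.

(** A supermartingale along one row, whose increments may depend on the
    previous bits of the row. *)
Lemma expect_row_mart (e : nat -> T) k (g : nat -> {set T} -> R) :
  (forall u j (E : {set T}), (u < j)%N -> (j < k)%N -> E \subset row_bits e j -> g u (e j |: E) = g u E) ->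
  (forall u (E : {set T}), (u < k)%N -> E \subset row_bits e u ->
     p * expR (g u (e u |: E)) + (1 - p) * expR (g u E) <= 1) ->
  expect p (row_bits e k) (fun E => expR (\sum_(u < k) g u E)) <= 1.
Proof.
elim: k => [|k IH] loc hg; first by rewrite /= big_ord0 expR0.
apply: le_trans (IH _ _); last first.
- by move=> u E uk; apply: hg; apply: ltnW.
- by move=> u j E uj jk; apply: loc => //; apply: ltnW.
rewrite /=; apply: expect_le => // E sE.
rewrite !big_ord_recr /= !expRD.
under eq_bigr => u _ do rewrite (loc u k) //.
set s := expR (\sum_(i < k) _).
have -> : p * (s * expR (g k (e k |: E))) + (1 - p) * (s * expR (g k E))
   = s * (p * expR (g k (e k |: E)) + (1 - p) * expR (g k E)) by ring.
by rewrite ler_piMr ?expR_ge0 // hg.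
Qed.

End TriangularArray.
Arguments low_new {R T ed n} ed_inj {v E E1}.
Arguments low_old {R T ed n} ed_inj {v E E1}.

(** * Row and column deviations *)

Section Functionals.
Variables (R : realType) (p : R).
Implicit Types (a : nat -> nat -> R) (u v w m : nat).

Definition rowdev a u := \sum_(w < u) (a u w - p).
Definition coldev a v u := \sum_(x < v | (u < x)%N) (a x u - p).
Definition inner a v u := \sum_(w < v) a u w * (a v w - p).
Definition rowdev2 a m := \sum_(u < m) rowdev a u ^+ 2.
Definition coldev2 a v := \sum_(u < v) coldev a v u ^+ 2.
Definition inner2 a v := \sum_(u < v) inner a v u ^+ 2.

(** The squared Hilbert-Schmidt norm of the Gram matrix of the columns; it
    counts closed walks of length four. *)
Definition gram2 a v := \sum_(w < v) \sum_(w' < v) (\sum_(u < v) a u w * a u w') ^+ 2.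
Definition lower_sum a v := \sum_(u < v) \sum_(w < v) a u w.

(** Only rows before [v] enter, so that a new row [v] is still independent of
    this event. *)
Definition tame a v N := (gram2 a v <= 25 * p ^+ 4 * N ^+ 4) && (lower_sum a v <= p * N ^+ 2).
Definition tame_inner2 a m N := \sum_(v < m) (if tame a v N then inner2 a v else 0).

(** The coefficient of [a v u - p] in the Doob decomposition of the number of
    triangles, up to an additive constant. The three terms come from the
    triangles in which [vu] is revealed last, from the centring of the other
    edges of these, and from the triangles in which [vu] is revealed second. *)
Definition slope a v u := inner a v u + p * rowdev a u + p * coldev a v u.

Variables (a b : nat -> nat -> R).
Lemma eq_rowdev u : (forall w, (w < u)%N -> a u w = b u w) -> rowdev a u = rowdev b u.
Proof. by move=> h; apply: eq_bigr => w _; rewrite h. Qed.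

Lemma eq_rowdev2 m : (forall u w, (u < m)%N -> a u w = b u w) -> rowdev2 a m = rowdev2 b m.
Proof. by move=> h; apply: eq_bigr => u _; rewrite (@eq_rowdev u) // => w _; apply: h. Qed.

Lemma eq_coldev v u : (forall u w, (u < v)%N -> a u w = b u w) -> coldev a v u = coldev b v u.
Proof. by move=> h; apply: eq_bigr => w _; rewrite h. Qed.

Lemma eq_coldev2 v : (forall u w, (u < v)%N -> a u w = b u w) -> coldev2 a v = coldev2 b v.
Proof. by move=> h; apply: eq_bigr => u _; rewrite (eq_coldev _ h). Qed.

Lemma eq_inner v u : a u =1 b u -> a v =1 b v -> inner a v u = inner b v u.
Proof. by move=> h1 h2; apply: eq_bigr => w _; rewrite h1 h2. Qed.

Lemma eq_inner2 v : (forall u w, (u < v.+1)%N -> a u w = b u w) -> inner2 a v = inner2 b v.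
Proof.
move=> h; apply: eq_bigr => u _; by rewrite (@eq_inner v u) // => w; apply: h; rewrite // leqW.
Qed.

Lemma eq_tame v N : (forall u w, (u < v)%N -> a u w = b u w) -> tame a v N = tame b v N.
Proof.
move=> h; rewrite /tame; congr (_ && _); congr (_ <= _).
  apply: eq_bigr => w _; apply: eq_bigr => w' _; congr (_ ^+ 2).
  by apply: eq_bigr => u _; rewrite !h.
by apply: eq_bigr => u _; apply: eq_bigr => w _; rewrite h.
Qed.

Lemma eq_tame_inner2 m N : (forall u w, (u < m)%N -> a u w = b u w) ->
  tame_inner2 a m N = tame_inner2 b m N.
Proof.
move=> h; apply: eq_bigr => v _.
rewrite (@eq_tame v) ?(@eq_inner2 v) // => u w uv; apply: h.
  by apply: leq_trans uv _.
by apply: ltn_trans uv _.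
Qed.

End Functionals.

(** Revealing one more bit of a column costs the second summand, by
    [bernoulli_quadratic_mgf]; decreasing the weight pays for it. *)
Lemma coldev_weight_step (R : realType) (x : R) : 0 < x ->
  (32 * (x + 1))^-1 + 32 * (32 * (x + 1))^-1 ^+ 2 <= (32 * x)^-1.
Proof.
move=> xp; have x0 : x != 0 by rewrite gt_eqF.
have x1 : x + 1 != 0 by rewrite gt_eqF //; lra.
rewrite -subr_ge0.
have -> : (32 * x)^-1 - ((32 * (x + 1))^-1 + 32 * (32 * (x + 1))^-1 ^+ 2)
    = (32 * x * (x + 1) ^+ 2)^-1 by field; rewrite x1 x0.
by rewrite invr_ge0 mulr_ge0 ?sqr_ge0 // mulr_ge0 // ltW.
Qed.

Section ExponentialMoments.
Variables (R : realType) (T : finType) (p : R) (ed : nat -> nat -> T) (n : nat).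
Hypothesis p01 : 0 <= p <= 1.
Hypothesis n0 : (0 < n)%N.
Hypothesis ed_inj : forall v u v' u', (u < v)%N -> (v < n)%N -> (u' < v')%N -> (v' < n)%N ->
  ed v u = ed v' u' -> v = v' /\ u = u'.
Notation low := (lower_bit R ed).
Notation all_bits := (all_bits ed).
Notation N := (n%:R : R).

Let p0 : 0 <= p. Proof. by case/andP: p01. Qed.
Let p1 : p <= 1. Proof. by case/andP: p01. Qed.
Let N0 : 0 < N. Proof. by rewrite ltr0n. Qed.

Lemma low_bit E v (i : 'I_v) : low E v i = bit E (ed v i).
Proof. by rewrite /low ltn_ord. Qed.

(** The square of a row sum is a quadratic form of rank one in that row. *)
Lemma expect_rowdev2 m : (m <= n)%N ->
  expect p (all_bits m) (fun E => expR (rowdev2 p (low E) m / (64 * N))) <= expR (m%:R / 16).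
Proof.
move=> mn.
rewrite -(ler_pM2l (expR_gt0 (- (m%:R / 16)))) -expRD addNr expR0 -expect_scale //.
pose Phi v E := expR (- (v%:R / 16)) * expR (rowdev2 p (low E) v / (64 * N)).
have Phi0 : Phi 0%N set0 = 1.
  by rewrite /Phi /rowdev2 big_ord0 !mul0r oppr0 expR0 mul1r.
rewrite -[leRHS]Phi0; apply: (expect_rows p01 (Phi := Phi) mn); rewrite /Phi => {Phi Phi0}.
move=> v E vm sE; have vn := leq_trans vm mn.
rewrite expect_scale // -{1}[v.+1]addn1 natrD mulrDl opprD expRD -mulrA ler_wpM2l ?expR_ge0 //.
rewrite expRN mulrC ler_pdivrMr ?expR_gt0 //.
pose Q (i j : nat) : R := 1 / (64 * N).
rewrite (@eq_expect _ _ p p01 _ _ (fun E1 => expR (rowdev2 p (low E) v / (64 * N)) *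
   expR (\sum_(i < v) \sum_(j < v) Q i j * (bit E1 (ed v i) - p) * (bit E1 (ed v j) - p)))).
  rewrite expect_scale // ler_wpM2l ?expR_ge0 //.
  have v1 : v%:R / N <= 1 by rewrite ler_pdivrMr // mul1r ler_nat ltnW.
  have v0 : 0 <= v%:R / N by rewrite divr_ge0 // ltW.
  have tr : \sum_(i < v) Q i i = v%:R / N / 64.
    by rewrite sumr_const card_ord /Q -mulr_natl invfM; ring.
  apply: le_trans (expect_row_quadratic p01 (h := 1 / 64) (row_inj ed_inj vn) _ _ _ _) _ => //.
  - by move=> i; rewrite /Q divr_ge0 // mulr_ge0 // ltW.
  - lra.
  - rewrite (eq_bigr (fun=> v%:R * (1 / (64 * N)) ^+ 2)); last first.
      by move=> i _; rewrite /Q sumr_const card_ord -[LHS]mulr_natl.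
    rewrite sumr_const card_ord -[X in X <= _]mulr_natl.
    have -> : v%:R * (v%:R * (1 / (64 * N)) ^+ 2) = (v%:R / N) ^+ 2 * (1 / 64) ^+ 2.
      by rewrite invfM; ring.
    by rewrite ler_piMl ?sqr_ge0 // -[X in _ <= X](expr1n _ 2) ler_pXn2r ?nnegrE.
  rewrite ler_expR tr.
  have : p * (v%:R / N / 64 + 1 / 64) <= 1 * (v%:R / N / 64 + 1 / 64).
    by rewrite ler_wpM2r //; lra.
  by lra.
move=> E1 sE1; rewrite -expRD; congr expR.
rewrite {1}/rowdev2 big_ord_recr /= mulrDl; congr (_ + _).
  by congr (_ / _); apply: eq_rowdev2 => u w uv; apply: (low_old ed_inj vn sE1).
rewrite expr2 -mulrA [X in X * _]/rowdev big_distrl /=; apply: eq_bigr => i _.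
rewrite /rowdev big_distrl mulr_sumr; apply: eq_bigr => j _ /=.
rewrite !(low_new ed_inj vn) // !low_bit /Q mul1r.
by rewrite [X in _ = X * _]mulrC -mulrA [X in _ * X = _]mulrC.
Qed.

Lemma expect_coldev2_row v (E : {set T}) : (v < n)%N -> E \subset all_bits v ->
  expect p (row_bits (ed v) v) (fun E1 => expR (coldev2 p (low (E1 :|: E)) v.+1 / (32 * (n + v.+1)%:R)))
  <= expR (1 / 16) * expR (coldev2 p (low E) v / (32 * (n + v)%:R)).
Proof.
move=> vn sE.
set al' := (32 * (n + v.+1)%:R)^-1; set al := (32 * (n + v)%:R)^-1.
pose C (u : nat) := coldev p (low E) v u.
pose f (u : nat) (x : R) := (C u + (x - p)) ^+ 2 * al'.
pose c (u : nat) := 2 * p * al' + C u ^+ 2 * al.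
have nv : (0 : R) < (n + v)%:R by rewrite ltr0n addn_gt0 n0.
have nv1 : (0 : R) < (n + v.+1)%:R by rewrite ltr0n addn_gt0 n0.
have alE : al' + 32 * al' ^+ 2 <= al.
  have nvE : (n + v.+1)%:R = (n + v)%:R + 1 :> R by rewrite addnS natr1.
  by rewrite /al' /al nvE; apply: coldev_weight_step.
have al0 : 0 <= al' by rewrite invr_ge0 mulr_ge0.
have al4 : al' <= 1 / 32.
  rewrite /al' invfM; have : (n + v.+1)%:R^-1 <= 1 :> R.
    by rewrite invf_le1 // ler1n addn_gt0 n0.
  lra.
rewrite (@eq_expect _ _ p p01 _ _ (fun E1 => expR (\sum_(u < v) f u (bit E1 (ed v u))))); last first.
  move=> E1 sE1; congr expR; rewrite /coldev2 big_ord_recr /=.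
  have -> : coldev p (low (E1 :|: E)) v.+1 v = 0.
    by rewrite /coldev big1 // => x; rewrite ltnNge -ltnS ltn_ord.
  rewrite expr0n addr0 mulr_suml; apply: eq_bigr => u _; congr (_ ^+ 2 * _).
  rewrite /C /coldev big_mkcond big_ord_recr -big_mkcond /= ltn_ord; congr (_ + _).
    by apply: eq_bigr => x _; rewrite (low_old ed_inj vn sE1).
  by rewrite (low_new ed_inj vn) // low_bit.
apply: le_trans (expect_row_indep p01 (c := c) (row_inj ed_inj vn) _) _.
  move=> u uv.
  have := @bernoulli_quadratic_mgf _ p al' (al' * C u) p01.
  rewrite al0 (le_trans al4) => [/(_ isT)|]; last lra.
  move=> H.
  have -> : p * expR (f u 1) + (1 - p) * expR (f u 0)
     = expR (al' * C u ^+ 2) * (p * expR (al' * (1 - p) ^+ 2 + 2 * (1 - p) * (al' * C u)) +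
    (1 - p) * expR (al' * (- p) ^+ 2 + 2 * - p * (al' * C u))).
    rewrite mulrDr ![expR _ * (_ * _)]mulrCA -!expRD /f.
    by congr (_ * expR _ + _ * expR _); ring.
  apply: (le_trans (ler_wpM2l (expR_ge0 _) H)).
  rewrite -expRD ler_expR /c.
  have := ler_wpM2l (sqr_ge0 (C u)) alE.
  by rewrite mulrDr; lra.
rewrite -expRD ler_expR /c big_split /= sumr_const card_ord -mulr_suml -/(coldev2 _ _ _) lerD2r.
rewrite -mulr_natr.
have v1 : v%:R * al' <= 1 / 32.
  rewrite /al' invfM mulrCA.
  have : v%:R / (n + v.+1)%:R <= 1 :> R.
    by rewrite ler_pdivrMr // mul1r ler_nat; lia.
  lra.
have : p * (v%:R * al') <= 1 * (1 / 32) by rewrite ler_pM // mulr_ge0.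
lra.
Qed.

(** Every row adds one bit to each column sum, so the weight in front of the
    squares has to decrease from row to row; from [1/(32 N)] it never falls
    below [1/(64 N)]. *)
Lemma expect_coldev2 m v : (v <= m)%N -> (m <= n)%N ->
  expect p (all_bits m) (fun E => expR (coldev2 p (low E) v / (64 * N))) <= expR (v%:R / 16).
Proof.
move=> vm mn.
(* The rows after [v] do not enter, so the potential is stopped at [v]. *)
pose Phi j E := expR (- ((minn j v)%:R / 16)) *
   expR (coldev2 p (low E) (minn j v) / (32 * (n + minn j v)%:R)).
have Phi0 : Phi 0%N set0 = 1.
  by rewrite /Phi min0n /coldev2 big_ord0 !mul0r oppr0 expR0 mul1r.
rewrite -(ler_pM2l (expR_gt0 (- (v%:R / 16)))) -expRD addNr expR0 -[leRHS]Phi0.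
apply: le_trans (expect_rows p01 (Phi := Phi) mn _); rewrite /Phi.
  rewrite (minn_idPr vm) expect_scale // ler_wpM2l ?expR_ge0 //.
  apply: expect_le => // E _; rewrite ler_expR ler_wpM2l ?sumr_ge0 // => [i _|]; first exact: sqr_ge0.
  rewrite lef_pV2 ?posrE ?mulr_gt0 // ?ltr0n ?addn_gt0 ?n0 //.
  have : (n + v)%:R <= 2 * N by rewrite -natrM ler_nat; lia.
  lra.
move=> j E jm sE; have jn := leq_trans jm mn.
rewrite expect_scale //.
have [jv|jv] := ltnP j v.
  rewrite (minn_idPl jv).
  rewrite -{1}[j.+1]addn1 natrD mulrDl opprD expRD -mulrA ler_wpM2l ?expR_ge0 //.
  rewrite expRN mulrC ler_pdivrMr ?expR_gt0 // [leRHS]mulrC.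
  exact: expect_coldev2_row.
rewrite (minn_idPr (leqW jv)) ler_wpM2l ?expR_ge0 //.
rewrite -[leRHS](expect_cst p01 (row_bits (ed j) j)); apply: expect_le => // E1 sE1.
rewrite (@eq_coldev2 _ p _ (low E)) // => u w uv; apply: (low_old ed_inj jn sE1).
exact: leq_trans uv jv.
Qed.

End ExponentialMoments.

(** * The triangle martingale *)

Section TriangleMartingale.
Variables (R : realType) (T : finType) (p : R) (ed : nat -> nat -> T) (n : nat).
Hypothesis p01 : 0 <= p <= 1.
Hypothesis n0 : (0 < n)%N.
Hypothesis ed_inj : forall v u v' u', (u < v)%N -> (v < n)%N -> (u' < v')%N -> (v' < n)%N ->
  ed v u = ed v' u' -> v = v' /\ u = u'.
Notation low := (lower_bit R ed).
Notation all_bits := (all_bits ed).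
Notation N := (n%:R : R).

Let p0 : 0 <= p. Proof. by case/andP: p01. Qed.
Let p1 : p <= 1. Proof. by case/andP: p01. Qed.
Let N0 : 0 < N. Proof. by rewrite ltr0n. Qed.

Lemma low01 E u w : 0 <= low E u w <= 1.
Proof. by rewrite /low; case: ifP => _; rewrite ?bit01 // lexx ler01. Qed.

Lemma low_sqr E u w : low E u w * low E u w = low E u w.
Proof. by rewrite /low /bit; case: ifP => _; rewrite ?mul0r // -natrM mulnb andbb. Qed.

(** Given the earlier rows, [inner2] is a quadratic form in the new row. Its
    matrix is the Gram matrix of the columns, whose Hilbert-Schmidt norm and
    trace are bounded on the tame event. *)
Lemma expect_tame_inner2_row v (E : {set T}) : 0 < p -> (v < n)%N -> E \subset all_bits v ->
  tame p (low E) v N ->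
  expect p (row_bits (ed v) v)
    (fun E1 => expR (inner2 p (low (E1 :|: E)) v / (320 * p ^+ 2 * N ^+ 2))) <= expR (1 / 10).
Proof.
move=> pp vn sE /andP[gr tot].
set th := (320 * p ^+ 2 * N ^+ 2)^-1.
have den0 : 0 < 320 * p ^+ 2 * N ^+ 2.
  by apply: mulr_gt0; [apply: mulr_gt0; [lra|exact: exprn_gt0]|exact: exprn_gt0].
have th0 : 0 <= th by rewrite invr_ge0 ltW.
pose a := low E.
pose Q (w w' : nat) := th * \sum_(u < v) a u w * a u w'.
rewrite (@eq_expect _ _ p p01 _ _ (fun E1 => expR (\sum_(i < v) \sum_(j < v)
   Q i j * (bit E1 (ed v i) - p) * (bit E1 (ed v j) - p)))); last first.
  move=> E1 sE1; congr expR; rewrite mulrC /inner2.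
  pose x (w : nat) := bit E1 (ed v w) - p.
  have innE (u : 'I_v) : inner p (low (E1 :|: E)) v u = \sum_(w < v) a u w * x w.
    apply: eq_bigr => w _.
    by rewrite (low_old ed_inj vn sE1) // (low_new ed_inj vn sE) // low_bit.
  under eq_bigr => u _ do rewrite innE.
  rewrite mulr_sumr.
  transitivity (\sum_(u < v) \sum_(i < v) \sum_(j < v) th * (a u i * a u j) * x i * x j).
    apply: eq_bigr => u _; rewrite expr2 big_distrl /= mulr_sumr; apply: eq_bigr => i _.
    by rewrite mulr_sumr mulr_sumr; apply: eq_bigr => j _; ring.
  rewrite exchange_big; apply: eq_bigr => i _ /=.
  rewrite exchange_big; apply: eq_bigr => j _ /=.
  by rewrite -/(x i) -/(x j) /Q mulr_sumr !mulr_suml.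
apply: le_trans (expect_row_quadratic p01 (h := 1 / 64) (row_inj ed_inj vn) _ _ _ _) _.
- by move=> i j; rewrite /Q; congr (_ * _); apply: eq_bigr => u _; rewrite mulrC.
- move=> i; rewrite /Q mulr_ge0 // sumr_ge0 // => u _; rewrite low_sqr.
  by case/andP: (low01 E u i).
- lra.
- have -> : \sum_(i < v) \sum_(j < v) Q i j ^+ 2 = th ^+ 2 * gram2 a v.
    rewrite /gram2 mulr_sumr; apply: eq_bigr => i _; rewrite mulr_sumr.
    by apply: eq_bigr => j _; rewrite /Q exprMn.
  apply: (le_trans (ler_wpM2l (sqr_ge0 _) gr)).
  rewrite /th exprVn ler_pdivrMl ?exprn_gt0 //.
  by rewrite le_eqVlt; apply/orP; left; apply/eqP; field.
have tr : \sum_(i < v) Q i i <= (320 * p)^-1.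
  have -> : \sum_(i < v) Q i i = th * lower_sum a v.
    rewrite /Q -mulr_sumr; congr (_ * _); rewrite exchange_big; apply: eq_bigr => u _.
    by apply: eq_bigr => w _; rewrite low_sqr.
  apply: (le_trans (ler_wpM2l th0 tot)).
  rewrite /th ler_pdivrMl //.
  by rewrite le_eqVlt; apply/orP; left; apply/eqP; field; rewrite gt_eqF.
rewrite ler_expR.
have := ler_wpM2l p0 tr.
have -> : p * (320 * p)^-1 = 1 / 320 by field; rewrite gt_eqF.
set S := \sum_(i < v) _.
rewrite mulrDr -[2 * p * S]mulrA.
by move: (p * S) p1 => pS p1'; lra.
Qed.

Lemma expect_tame_inner2 m : 0 < p -> (m <= n)%N ->
  expect p (all_bits m) (fun E => expR (tame_inner2 p (low E) m N / (320 * p ^+ 2 * N ^+ 2)))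
  <= expR (m%:R / 10).
Proof.
move=> pp mn.
rewrite -(ler_pM2l (expR_gt0 (- (m%:R / 10)))) -expRD addNr expR0 -expect_scale //.
pose Phi v E := expR (- (v%:R / 10)) * expR (tame_inner2 p (low E) v N / (320 * p ^+ 2 * N ^+ 2)).
have Phi0 : Phi 0%N set0 = 1.
  by rewrite /Phi /tame_inner2 big_ord0 !mul0r oppr0 expR0 mul1r.
rewrite -[leRHS]Phi0; apply: (expect_rows p01 (Phi := Phi) mn); rewrite /Phi => {Phi Phi0}.
move=> v E vm sE; have vn := leq_trans vm mn.
rewrite expect_scale // -{1}[v.+1]addn1 natrD mulrDl opprD expRD -mulrA ler_wpM2l ?expR_ge0 //.
rewrite expRN mulrC ler_pdivrMr ?expR_gt0 //.
set D := 320 * p ^+ 2 * N ^+ 2.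
rewrite (@eq_expect _ _ p p01 _ _ (fun E1 => expR (tame_inner2 p (low E) v N / D) *
   expR ((if tame p (low E) v N then inner2 p (low (E1 :|: E)) v else 0) / D))).
  rewrite expect_scale // ler_wpM2l ?expR_ge0 //.
  case: (boolP (tame p (low E) v N)) => ht; first exact: expect_tame_inner2_row.
  by rewrite mul0r expR0 expect_cst // -[leLHS]expR0 ler_expR; lra.
move=> E1 sE1; rewrite -expRD; congr expR.
rewrite {1}/tame_inner2 big_ord_recr /= mulrDl; congr (_ / _ + _ / _).
  by apply: eq_tame_inner2 => u w uv; apply: (low_old ed_inj vn sE1).
by rewrite (@eq_tame _ p _ (low E)) // => u w uv; apply: (low_old ed_inj vn sE1).
Qed.

(** The last edge [uv] of a triangle [w < u < v] sees the two earlier ones: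
    [devsum] is the Doob decomposition of the triangle count, up to a multiple
    of the number of edges. *)
Definition devsum (a : nat -> nat -> R) m := \sum_(v < m) \sum_(u < v) (a v u - p) * slope p a v u.
Definition slope2 (a : nat -> nat -> R) m := \sum_(v < m) \sum_(u < v) slope p a v u ^+ 2.

Lemma innerE a v u : (u <= v)%N -> (forall w, (u <= w)%N -> a u w = 0) ->
  inner p a v u = \sum_(w < u) a u w * (a v w - p).
Proof.
move=> uv a0; rewrite (big_ord_widen v (fun w => a u w * (a v w - p)) uv) /inner.
rewrite [RHS]big_mkcond /=; apply: eq_bigr => w _; case: ltnP => // uw.
by rewrite a0 // mul0r.
Qed.

(** Codegrees are nonnegative, so the slope cannot be far below zero, although
    it may be huge above. *)
Lemma slope_ge a v u : (u < v)%N -> (v <= n)%N -> (forall w, (u <= w)%N -> a u w = 0) ->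
  (forall x w, 0 <= a x w) -> - (2 * p ^+ 2 * N) <= slope p a v u.
Proof.
move=> uv vn az a0; rewrite /slope innerE ?(ltnW uv) //.
have h1 : - (p ^+ 2 * N) <= \sum_(w < u) a u w * (a v w - p) + p * rowdev p a u.
  rewrite /rowdev mulr_sumr -big_split /=.
  apply: (@le_trans _ _ (\sum_(w < u) (- p ^+ 2))).
    rewrite sumr_const card_ord -[leRHS]mulr_natr mulNr lerN2 ler_wpM2l ?sqr_ge0 // ler_nat.
    exact: leq_trans (ltnW uv) vn.
  apply: ler_sum => w _.
  have -> : a u w * (a v w - p) + p * (a u w - p) = a u w * a v w - p ^+ 2 by ring.
  by rewrite lerDr mulr_ge0.
have h2 : - (p ^+ 2 * N) <= p * coldev p a v u.
  rewrite /coldev mulr_sumr.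
  apply: (@le_trans _ _ (\sum_(x < v | (u < x)%N) (- p ^+ 2))).
    rewrite sumr_const -[leRHS]mulr_natr mulNr lerN2 ler_wpM2l ?sqr_ge0 // ler_nat.
    by apply: leq_trans vn; rewrite -[X in (_ <= X)%N]card_ord max_card.
  apply: ler_sum => x _.
  have -> : p * (a x u - p) = p * a x u - p ^+ 2 by ring.
  by rewrite lerDr mulr_ge0.
lra.
Qed.

(** The compensated increments satisfy [bernoulli_lower_mgf], thanks to the
    one-sided bound [slope_ge]. *)
Lemma expect_devsum_row lam v (E : {set T}) : 0 <= lam -> lam * (2 * p ^+ 2 * N) <= 1 / 2 ->
  (v < n)%N -> E \subset all_bits v ->
  expect p (row_bits (ed v) v) (fun E1 => expR (\sum_(u < v)
    (- (lam * ((low (E1 :|: E) v u - p) * slope p (low (E1 :|: E)) v u))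
     - 2 * p * lam ^+ 2 * slope p (low (E1 :|: E)) v u ^+ 2))) <= 1.
Proof.
move=> lam0 lamp vn sE.
pose c u := p * rowdev p (low E) u + p * coldev p (low E) v u.
pose sl (u : nat) E1 := \sum_(w < u) low E u w * (bit E1 (ed v w) - p) + c u.
pose g (u : nat) E1 := - (lam * ((bit E1 (ed v u) - p) * sl u E1)) - 2 * p * lam ^+ 2 * sl u E1 ^+ 2.
have slE u (E1 : {set T}) : (u < v)%N -> E1 \subset row_bits (ed v) v ->
    slope p (low (E1 :|: E)) v u = sl u E1.
  move=> uv sE1; rewrite /slope innerE ?(ltnW uv) //; last first.
    by move=> w uw; rewrite /low ltnNge uw.
  rewrite /sl /c addrA; congr (_ + p * _ + p * _).
  - apply: eq_bigr => w _; have wv := ltn_trans (ltn_ord w) uv.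
    by rewrite (low_old ed_inj vn sE1) // (low_new ed_inj vn sE) // /low wv.
  - by apply: eq_rowdev => w _; rewrite (low_old ed_inj vn sE1).
  - by apply: eq_coldev => x w xv; rewrite (low_old ed_inj vn sE1).
have slloc u j (E1 : {set T}) : (u <= j)%N -> (j < v)%N -> sl u (ed v j |: E1) = sl u E1.
  move=> uj jv; rewrite /sl; congr (_ + _); apply: eq_bigr => w _; rewrite bit_setU1.
  case: eqP => // /(row_inj ed_inj vn (ltn_trans (leq_trans (ltn_ord w) uj) jv) jv) wj.
  by have := leq_trans (ltn_ord w) uj; rewrite wj ltnn.
rewrite (@eq_expect _ _ p p01 _ _ (fun E1 => expR (\sum_(u < v) g u E1))); last first.
  move=> E1 sE1; congr expR; apply: eq_bigr => u _.
  by rewrite !slE // (low_new ed_inj vn sE) // low_bit.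
apply: (expect_row_mart p01).
  move=> u j E1 uj jv _; rewrite /g slloc ?(ltnW uj) // bit_setU1.
  case: eqP => // /(row_inj ed_inj vn (ltn_trans uj jv) jv) ujE.
  by rewrite ujE ltnn in uj.
move=> u E1 uv sE1.
have uE1 : ed v u \notin E1.
  apply/negP => /(subsetP sE1) /mem_row_bits[i iu].
  by move/(row_inj ed_inj vn uv (ltn_trans iu uv)) => ui; rewrite ui ltnn in iu.
have bu : bit E1 (ed v u) = 0 :> R by rewrite /bit (negbTE uE1).
rewrite /g slloc // bit_setU1 eqxx bu.
set s := sl u E1.
have sE1' : E1 \subset row_bits (ed v) v.
  apply/subsetP => x /(subsetP sE1) /mem_row_bits[i iu ->].
  by apply/mem_row_bits; exists i => //; apply: ltn_trans uv.
have s_ge : - (1 / 2) <= lam * s.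
  have := slope_ge uv (ltnW vn) (a := low (E1 :|: E)).
  rewrite slE // -/s => H.
  have {}H : - (2 * p ^+ 2 * N) <= s.
    apply: H => [w uw|x w]; first by rewrite /low ltnNge uw.
    by case/andP: (low01 (E1 :|: E) x w).
  have := ler_wpM2l lam0 H; lra.
have H := bernoulli_lower_mgf p01 s_ge.
set t := 2 * p * lam ^+ 2 * s ^+ 2.
have -> : p * expR (- (lam * ((1 - p) * s)) - t) + (1 - p) * expR (- (lam * ((0 - p) * s)) - t)
   = (p * expR (- (lam * s * (1 - p))) + (1 - p) * expR (lam * s * p)) * expR (- t).
  have -> : - (lam * ((1 - p) * s)) = - (lam * s * (1 - p)) by ring.
  have -> : - (lam * ((0 - p) * s)) = lam * s * p by ring.
  by rewrite ![expR (_ - t)]expRD; ring.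
apply: (le_trans (ler_wpM2r (expR_ge0 _) H)).
by rewrite -expRD (_ : _ + _ = 0) ?expR0 // /t; ring.
Qed.

Lemma expect_devsum lam : 0 <= lam -> lam * (2 * p ^+ 2 * N) <= 1 / 2 ->
  expect p (all_bits n)
    (fun E => expR (- (lam * devsum (low E) n) - 2 * p * lam ^+ 2 * slope2 (low E) n)) <= 1.
Proof.
move=> lam0 lamp.
pose Phi v E := expR (- (lam * devsum (low E) v) - 2 * p * lam ^+ 2 * slope2 (low E) v).
have Phi0 : Phi 0%N set0 = 1.
  by rewrite /Phi /devsum /slope2 !big_ord0 !mulr0 oppr0 addr0 expR0.
rewrite -[leRHS]Phi0; apply: (expect_rows p01 (Phi := Phi) (leqnn n)); rewrite /Phi => {Phi Phi0}.
move=> v E vn sE.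
rewrite (@eq_expect _ _ p p01 _ _ (fun E1 =>
   expR (- (lam * devsum (low E) v) - 2 * p * lam ^+ 2 * slope2 (low E) v) *
   expR (\sum_(u < v) (- (lam * ((low (E1 :|: E) v u - p) * slope p (low (E1 :|: E)) v u))
     - 2 * p * lam ^+ 2 * slope p (low (E1 :|: E)) v u ^+ 2)))).
  by rewrite expect_scale // ler_piMr ?expR_ge0 // expect_devsum_row.
move=> E1 sE1; rewrite -expRD; congr expR.
have slE (w u : nat) : (w < v)%N -> (u < w)%N ->
    slope p (low (E1 :|: E)) w u = slope p (low E) w u.
  move=> wv uw; rewrite /slope; congr (_ + _ * _ + _ * _).
  - apply: eq_inner => x; apply: (low_old ed_inj vn sE1) => //; exact: ltn_trans wv.
  - by apply: eq_rowdev => x _; apply: (low_old ed_inj vn sE1); apply: ltn_trans wv.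
  - by apply: eq_coldev => x y xw; apply: (low_old ed_inj vn sE1); apply: ltn_trans wv.
rewrite {1}/devsum {1}/slope2 !big_ord_recr /= big_split /= !sumrN -!mulr_sumr.
rewrite -[X in - (lam * (X + _))]/(devsum (low (E1 :|: E)) v).
have -> : devsum (low (E1 :|: E)) v = devsum (low E) v.
  by apply: eq_bigr => w _; apply: eq_bigr => u _; rewrite slE // (low_old ed_inj vn sE1).
have -> : \sum_(i < v) \sum_(u < i) slope p (low (E1 :|: E)) i u ^+ 2 = slope2 (low E) v.
  by apply: eq_bigr => w _; apply: eq_bigr => u _; rewrite slE.
by ring.
Qed.

End TriangleMartingale.

(** * A deterministic bound on the quadratic variation *)

Lemma ler_sum_widen (R : realType) (u v : nat) (f : nat -> R) : (u <= v)%N ->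
  (forall i, 0 <= f i) -> \sum_(i < u) f i <= \sum_(i < v) f i.
Proof.
move=> uv f0; rewrite (big_ord_widen v f uv) [leLHS]big_mkcond /=.
by apply: ler_sum => i _; case: ifP.
Qed.

Section Bootstrap.
Variables (R : realType) (p : R) (n : nat) (a : nat -> nat -> R).
Notation N := (n%:R : R).
Hypotheses (p0 : 0 < p) (pN : 256 <= p ^+ 2 * N).
Hypotheses (a0 : forall u w, 0 <= a u w) (aa : forall u w, a u w * a u w = a u w).
Hypothesis alow : forall u w, (u <= w)%N -> a u w = 0.

Let N0 : 0 <= N. Proof. exact: ler0n. Qed.
Let deg u := \sum_(w < u) a u w.

Lemma sum_low u v (f : nat -> R) : (u <= v)%N ->
  \sum_(w < v) a u w * f w = \sum_(w < u) a u w * f w.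
Proof.
move=> uv; rewrite (big_ord_widen v (fun w => a u w * f w) uv) [RHS]big_mkcond /=.
by apply: eq_bigr => w _; case: ltnP => // uw; rewrite alow // mul0r.
Qed.

(** [tr (A^T A)^2 = tr (A A^T)^2]. *)
Lemma gram2_transpose v :
  gram2 a v = \sum_(u < v) \sum_(u' < v) (\sum_(w < v) a u w * a u' w) ^+ 2.
Proof.
transitivity (\sum_(w < v) \sum_(w' < v) \sum_(u < v) \sum_(u' < v)
   (a u w * a u' w) * (a u w' * a u' w')).
  apply: eq_bigr => w _; apply: eq_bigr => w' _.
  rewrite expr2 big_distrl /=; apply: eq_bigr => u _; rewrite mulr_sumr.
  by apply: eq_bigr => u' _; ring.
under eq_bigr => w _ do rewrite exchange_big /=.
rewrite exchange_big /=; apply: eq_bigr => u _.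
under eq_bigr => w _ do rewrite exchange_big /=.
rewrite exchange_big /=; apply: eq_bigr => u' _.
rewrite expr2 big_distrl /=; apply: eq_bigr => w _; rewrite mulr_sumr.
by apply: eq_bigr => w' _.
Qed.

Lemma common_inner u u' v : (u < u')%N -> (u' <= v)%N ->
  \sum_(w < v) a u w * a u' w = inner p a u' u + p * deg u.
Proof.
move=> uu u'v; rewrite (sum_low (fun w => a u' w)) ?(leq_trans (ltnW uu)) //.
rewrite innerE ?(ltnW uu) //; last by move=> w; apply: alow.
rewrite /deg mulr_sumr -big_split /=; apply: eq_bigr => w _; ring.
Qed.

Lemma deg2_le v : (v <= n)%N -> rowdev2 p a n <= 128 * N ^+ 2 ->
  \sum_(u < v) deg u ^+ 2 <= 3 * p ^+ 2 * N ^+ 3.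
Proof.
move=> vn hr.
have h1 : \sum_(u < v) deg u ^+ 2 <= \sum_(u < n) (2 * rowdev p a u ^+ 2 + 2 * (p ^+ 2 * N ^+ 2)).
  apply: le_trans (_ : \sum_(u < n) deg u ^+ 2 <= _).
    by apply: (ler_sum_widen (f := fun u => deg u ^+ 2)) => // u; apply: sqr_ge0.
  apply: ler_sum => u _.
  have -> : deg u = rowdev p a u + p * u%:R.
    by rewrite /rowdev sumrB sumr_const card_ord mulr_natr subrK.
  have : (p * u%:R) ^+ 2 <= p ^+ 2 * N ^+ 2.
    by rewrite exprMn ler_wpM2l ?sqr_ge0 // ler_pXn2r ?nnegrE // ler_nat ltnW.
  have := sqr_ge0 (rowdev p a u - p * u%:R).
  have -> : (rowdev p a u - p * u%:R) ^+ 2 =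
     2 * rowdev p a u ^+ 2 + 2 * (p * u%:R) ^+ 2 - (rowdev p a u + p * u%:R) ^+ 2 by ring.
  lra.
apply: (le_trans h1); rewrite big_split /= -mulr_sumr -/(rowdev2 p a n).
rewrite sumr_const card_ord -[X in _ + X <= _]mulr_natr.
have h2 : 256 * N ^+ 2 <= (p ^+ 2 * N) * N ^+ 2 by rewrite ler_wpM2r ?sqr_ge0.
have -> : 3 * p ^+ 2 * N ^+ 3 = (p ^+ 2 * N) * N ^+ 2 + 2 * (p ^+ 2 * N ^+ 2) * N by ring.
lra.
Qed.

Lemma sum_lower_triangle v (f : nat -> nat -> R) :
  \sum_(u < v) \sum_(u' < v) (if (u < u')%N then f u' u else 0) = \sum_(u' < v) \sum_(u < u') f u' u.
Proof.
rewrite exchange_big /=; apply: eq_bigr => u' _.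
rewrite (big_ord_widen v (fun u => f u' u)) ?(ltnW (ltn_ord u')) //.
by rewrite [RHS]big_mkcond.
Qed.

(** By [common_inner] the codegrees are inner products plus multiples of
    degrees, so [gram2] is bounded by the sums of [inner2] over earlier rows. *)
Lemma gram2_le v : (v <= n)%N -> rowdev2 p a n <= 128 * N ^+ 2 ->
  \sum_(u < v) inner2 p a u <= 640 * p ^+ 2 * N ^+ 3 ->
  gram2 a v <= 25 * p ^+ 4 * N ^+ 4.
Proof.
move=> vn hr hi; rewrite gram2_transpose.
pose f u' u := 2 * inner p a u' u ^+ 2 + 2 * p ^+ 2 * deg u ^+ 2.
have fE u' u (uu : (u < u')%N) (u'v : (u' < v)%N) :
    (\sum_(w < v) a u w * a u' w) ^+ 2 <= f u' u.
  rewrite (common_inner uu (ltnW u'v)) /f.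
  have := sqr_ge0 (inner p a u' u - p * deg u).
  set x := inner _ _ _ _; set y := deg u => h.
  have -> : 2 * x ^+ 2 + 2 * p ^+ 2 * y ^+ 2 = (x + p * y) ^+ 2 + (x - p * y) ^+ 2 by ring.
  by rewrite lerDl.
have step : \sum_(u < v) \sum_(u' < v) (\sum_(w < v) a u w * a u' w) ^+ 2
   <= \sum_(u < v) \sum_(u' < v) (if (u < u')%N then f u' u else 0)
    + (\sum_(u < v) \sum_(u' < v) (if (u' < u)%N then f u u' else 0)
    + \sum_(u < v) \sum_(u' < v) (if u == u' then deg u ^+ 2 else 0)).
  rewrite -!big_split; apply: ler_sum => u _ /=; rewrite -!big_split; apply: ler_sum => u' _ /=.
  have [uu|uu|uu] := ltngtP u u'.
  - by rewrite (_ : (u == u') = false) ?addr0 ?fE //; apply/eqP => h; rewrite h ltnn in uu.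
  - rewrite (_ : (u == u') = false) ?addr0 ?add0r; last by apply/eqP => h; rewrite h ltnn in uu.
    by under eq_bigr do rewrite mulrC; apply: fE.
  - have -> : u = u' by apply: val_inj.
    rewrite eqxx !add0r (sum_low (fun w => a u' w)) ?(ltnW (ltn_ord u')) //.
    by under eq_bigr do rewrite aa.
apply: (le_trans step).
rewrite [X in _ + (X + _)]exchange_big /= !sum_lower_triangle.
have -> : \sum_(u < v) \sum_(u' < v) (if u == u' then deg u ^+ 2 else 0) = \sum_(u < v) deg u ^+ 2.
  by apply: eq_bigr => u _; rewrite -big_mkcond (big_pred1 u) // => u'; rewrite eq_sym.
have hd := deg2_le vn hr; set D := \sum_(u < v) deg u ^+ 2 in hd *.
have hf : \sum_(u' < v) \sum_(u < u') f u' u <= 2 * (640 * p ^+ 2 * N ^+ 3) + 2 * p ^+ 2 * (N * D).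
  apply: le_trans (_ : 2 * (\sum_(u < v) inner2 p a u) + 2 * p ^+ 2 * (N * D) <= _); last first.
    by rewrite lerD2r ler_wpM2l.
  rewrite /f; under eq_bigr do rewrite big_split /= -!mulr_sumr.
  rewrite big_split /= -!mulr_sumr lerD2l; apply: ler_wpM2l; first by rewrite mulr_ge0 ?sqr_ge0.
  apply: le_trans (_ : \sum_(u < v) D <= _).
    apply: ler_sum => u _; apply: (ler_sum_widen (f := fun u => deg u ^+ 2)).
      exact: ltnW.
    by move=> i; apply: sqr_ge0.
  rewrite sumr_const card_ord -[leLHS]mulr_natl ler_wpM2r ?ler_nat //.
  by apply: sumr_ge0 => u _; apply: sqr_ge0.
have xN := pN; set x := p ^+ 2 * N in xN.
have e1 : p ^+ 4 * N ^+ 4 = x * x * N ^+ 2 by rewrite /x; ring.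
have e2 : p ^+ 2 * N ^+ 3 = x * N ^+ 2 by rewrite /x; ring.
have e3 : p ^+ 2 * (N * D) = x * D by rewrite /x; ring.
have x0 : 0 <= x by lra.
set y := x * N ^+ 2 in e2.
have hd' : D <= 3 * y by rewrite -e2 mulrA.
have {}hf : \sum_(u' < v) \sum_(u < u') f u' u <= 1280 * y + 2 * (x * D).
  by rewrite -e3 -e2; move: hf; rewrite !mulrA -natrM.
have y0 : 0 <= y by rewrite mulr_ge0 ?sqr_ge0.
have h3 : x * D <= x * (3 * y) by apply: ler_wpM2l.
have h4 : 256 * y <= x * y by apply: ler_wpM2r.
have -> : 25 * p ^+ 4 * N ^+ 4 = 25 * (x * y) by rewrite /y /x; ring.
lra.
Qed.

(** Induction on [v]: if the rows before [v] are tame, the truncated and the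
    full sums of [inner2] agree up to [v], and [gram2_le] makes row [v] tame. *)
Lemma tame_all : rowdev2 p a n <= 128 * N ^+ 2 -> lower_sum a n <= p * N ^+ 2 ->
  tame_inner2 p a n N <= 640 * p ^+ 2 * N ^+ 3 ->
  forall v, (v <= n)%N -> \sum_(u < v) inner2 p a u = tame_inner2 p a v N.
Proof.
move=> hr hs ht; elim=> [|v IH] vn; first by rewrite /tame_inner2 !big_ord0.
rewrite /tame_inner2 !big_ord_recr /= -/(tame_inner2 _ _ _ _) (IH (ltnW vn)); congr (_ + _).
suff -> : tame p a v N by [].
have i0 u : 0 <= inner2 p a u by apply: sumr_ge0 => w _; apply: sqr_ge0.
apply/andP; split.
  apply: gram2_le; rewrite ?(ltnW vn) // IH ?(ltnW vn) //; apply: le_trans ht.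
  apply: (ler_sum_widen (f := fun u => if tame p a u N then inner2 p a u else 0) (ltnW vn)).
  by move=> u; case: ifP.
apply: le_trans hs; rewrite /lower_sum.
have s0 u : 0 <= \sum_(w < n) a u w by apply: sumr_ge0.
apply: (@le_trans _ _ (\sum_(u < v) \sum_(w < n) a u w)).
  by apply: ler_sum => u _; apply: (ler_sum_widen (f := a u) (ltnW vn)).
exact: (ler_sum_widen (f := fun u => \sum_(w < n) a u w) (ltnW vn)).
Qed.

Lemma slope2_le : rowdev2 p a n <= 128 * N ^+ 2 -> lower_sum a n <= p * N ^+ 2 ->
  tame_inner2 p a n N <= 640 * p ^+ 2 * N ^+ 3 ->
  (forall v, (v < n)%N -> coldev2 p a v <= 128 * N ^+ 2) ->
  slope2 p a n <= 3 * 10 ^+ 3 * p ^+ 2 * N ^+ 3.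
Proof.
move=> hr hs ht hc.
have hi := tame_all hr hs ht (leqnn n).
apply: (@le_trans _ _ (\sum_(v < n) (3 * inner2 p a v + 3 * p ^+ 2 * rowdev2 p a n
    + 3 * p ^+ 2 * coldev2 p a v))).
  apply: ler_sum => v _.
  apply: (@le_trans _ _ (3 * inner2 p a v + 3 * p ^+ 2 * rowdev2 p a v + 3 * p ^+ 2 * coldev2 p a v)).
    rewrite /inner2 /rowdev2 /coldev2 !mulr_sumr -!big_split /=; apply: ler_sum => u _.
    rewrite /slope; set x := inner _ _ _ _; set y := rowdev _ _ _; set z := coldev _ _ _ _.
    have := sqr_ge0 (x - p * y); have := sqr_ge0 (x - p * z); have := sqr_ge0 (p * y - p * z).
    have -> : 3 * x ^+ 2 + 3 * p ^+ 2 * y ^+ 2 + 3 * p ^+ 2 * z ^+ 2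
       = (x + p * y + p * z) ^+ 2 + ((x - p * y) ^+ 2 + (x - p * z) ^+ 2 + (p * y - p * z) ^+ 2) by ring.
    by move=> h1 h2 h3; rewrite lerDl !addr_ge0.
  rewrite lerD2r lerD2l; apply: ler_wpM2l; first by rewrite mulr_ge0 ?sqr_ge0.
  apply: (ler_sum_widen (f := fun u => rowdev p a u ^+ 2) (ltnW (ltn_ord v))).
  by move=> i; apply: sqr_ge0.
rewrite !big_split /= -!mulr_sumr hi sumr_const card_ord -[rowdev2 p a n *+ n]mulr_natr.
have hcs : \sum_(v < n) coldev2 p a v <= 128 * N ^+ 3.
  apply: le_trans (_ : \sum_(v < n) 128 * N ^+ 2 <= _); first by apply: ler_sum => v _; apply: hc.
  by rewrite sumr_const card_ord -[leLHS]mulr_natr -mulrA -exprSr.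
have p2 : 0 <= p ^+ 2 by apply: sqr_ge0.
have h1 : p ^+ 2 * \sum_(v < n) coldev2 p a v <= p ^+ 2 * (128 * N ^+ 3) by apply: ler_wpM2l.
have h2 : p ^+ 2 * (rowdev2 p a n * N) <= p ^+ 2 * (128 * N ^+ 2 * N).
  by apply: ler_wpM2l => //; apply: ler_wpM2r.
have h3 : 0 <= p ^+ 2 * N ^+ 3 by apply: mulr_ge0 => //; apply: exprn_ge0.
have -> : 3 * 10 ^+ 3 * p ^+ 2 * N ^+ 3 = 3 * (640 * p ^+ 2 * N ^+ 3) + 3 * (p ^+ 2 * (128 * N ^+ 2 * N))
   + 3 * (p ^+ 2 * (128 * N ^+ 3)) + 312 * (p ^+ 2 * N ^+ 3) by ring.
have e x : 3 * p ^+ 2 * x = 3 * (p ^+ 2 * x) by ring.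
rewrite !e; lra.
Qed.

End Bootstrap.

Section TriangleIdentity.
Variables (R : realType) (p : R) (a : nat -> nat -> R).
Hypothesis alow : forall u w, (u <= w)%N -> a u w = 0.

Definition triangles n := \sum_(v < n) \sum_(u < v) \sum_(w < u) a u w * a v w * a v u.

Lemma sum_pairs_twice n (g : nat -> R) :
  \sum_(u < n) \sum_(w < u) (g u + g w) = (n%:R - 1) * \sum_(u < n) g u.
Proof.
elim: n => [|n IH]; first by rewrite !big_ord0 mulr0.
rewrite !big_ord_recr /= IH big_split /= sumr_const card_ord -[_ *+ n]mulr_natr -natr1.
by ring.
Qed.

Lemma sum_triples_edges n (f : nat -> nat -> R) :
  \sum_(v < n) \sum_(u < v) \sum_(w < u) (f v u + f u w + f v w)
  = (n%:R - 2) * \sum_(v < n) \sum_(u < v) f v u.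
Proof.
elim: n => [|n IH]; first by rewrite !big_ord0 mulr0.
rewrite !big_ord_recr /= IH.
have -> : \sum_(u < n) \sum_(w < u) (f n u + f u w + f n w)
   = (n%:R - 1) * \sum_(u < n) f n u + \sum_(u < n) \sum_(w < u) f u w.
  rewrite -(sum_pairs_twice n (f n)) -big_split /=; apply: eq_bigr => u _.
  by rewrite -big_split /=; apply: eq_bigr => w _; ring.
by rewrite -natr1; ring.
Qed.

(** For one triangle [w < u < v], with [b = a - p],
    [a_uw a_vw a_vu - p^3] expands into [b_vu a_uw b_vw], terms [p b b] and terms
    [p^2 b]. Summing the last ones counts every edge [n - 2] times. *)
Lemma triangles_devsum n :
  triangles n - p ^+ 3 * 'C(n, 3)%:R = devsum p a n
   + p ^+ 2 * (n%:R - 2) * (\sum_(v < n) \sum_(u < v) (a v u - p)).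
Proof.
have C3 : 'C(n, 3)%:R = \sum_(v < n) \sum_(u < v) \sum_(w < u) (1 : R).
  elim: n => [|n IH]; first by rewrite big_ord0.
  rewrite big_ord_recr /= -IH binS natrD; congr (_ + _).
  elim: n {IH} => [|n IH]; first by rewrite big_ord0.
  by rewrite big_ord_recr /= -IH binS natrD bin1 sumr_const card_ord.
pose b u w := a u w - p.
have -> : devsum p a n = \sum_(v < n) \sum_(u < v) \sum_(w < u)
    (b v u * (a u w * a v w - p ^+ 2) + p * (b v w * b u w)).
  apply: eq_bigr => v _.
  have sw : \sum_(u < v) b v u * (p * coldev p a v u) = \sum_(u < v) \sum_(w < u) p * (b v w * b u w).
    transitivity (\sum_(u < v) \sum_(x < v) (if (u < x)%N then p * (b v u * b x u) else 0)).
      apply: eq_bigr => u _; rewrite -big_mkcond /= /coldev !mulr_sumr.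
      by apply: eq_bigr => x _; rewrite -/(b x u); ring.
    by rewrite (sum_lower_triangle v (fun x u => p * (b v u * b x u))).
  under [RHS]eq_bigr => u _ do rewrite big_split /=.
  rewrite big_split /= -sw -big_split /=; apply: eq_bigr => u _.
  rewrite -mulr_sumr -mulrDr /slope; congr (_ * _); congr (_ + _).
  rewrite innerE ?(ltnW (ltn_ord u)) //; last by move=> w; apply: alow.
  rewrite /rowdev mulr_sumr -big_split /=; apply: eq_bigr => w _; ring.
have -> : p ^+ 2 * (n%:R - 2) * (\sum_(v < n) \sum_(u < v) (a v u - p))
   = p ^+ 2 * \sum_(v < n) \sum_(u < v) \sum_(w < u) (b v u + b u w + b v w).
  by rewrite sum_triples_edges mulrA.
rewrite C3 /triangles mulr_sumr mulr_sumr -sumrB -big_split /=; apply: eq_bigr => v _.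
rewrite !mulr_sumr -sumrB -big_split /=; apply: eq_bigr => u _.
rewrite !mulr_sumr -sumrB -big_split /=; apply: eq_bigr => w _.
by rewrite /b; ring.
Qed.

End TriangleIdentity.

(** * The lower tail under the product measure *)

Section ProductTail.
Variables (R : realType) (T : finType) (p : R) (ed : nat -> nat -> T) (n : nat).
Hypothesis p01 : 0 <= p <= 1.
Hypothesis n0 : (0 < n)%N.
Hypothesis ed_inj : forall v u v' u', (u < v)%N -> (v < n)%N -> (u' < v')%N -> (v' < n)%N ->
  ed v u = ed v' u' -> v = v' /\ u = u'.
Notation low := (lower_bit R ed).
Notation all_bits := (all_bits ed).
Notation N := (n%:R : R).
Hypotheses (p0 : 0 < p) (pN : 256 <= p ^+ 2 * N).

Let N0 : 0 < N. Proof. by rewrite ltr0n. Qed.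

(** Chernoff bound with [lam = b / (12 10^3 p^3 N^3)], which balances the
    linear and the quadratic term when [slope2] is at most
    [3 10^3 p^2 N^3]. The other [N + 2] terms are the exceptional events: one
    for the row deviations, one for the inner products, and [n] for the column
    deviations of each row. *)
Lemma expect_devsum_tail b : 0 < b -> b <= 3 * 10 ^+ 3 * p * N ^+ 2 ->
  expect p (all_bits n)
    (fun E => ((lower_sum (low E) n <= p * N ^+ 2) && (devsum p (low E) n < - b))%:R)
  <= expR (- (b ^+ 2 / (24 * 10 ^+ 3 * p ^+ 3 * N ^+ 3))) + (N + 2) * expR (- N).
Proof.
move=> b0 bp.
have N3 : 0 < N ^+ 3 by rewrite exprn_gt0.
have N2 : 0 < N ^+ 2 by rewrite exprn_gt0.
have p3 : 0 < p ^+ 3 by rewrite exprn_gt0.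
have p2 : 0 < p ^+ 2 by rewrite exprn_gt0.
(* The indicator is bounded by a sum of exponentials, one of which is at least
   one: [f1] on the good event, the others when one of the sums exceeds twice
   [N] times its exponential scale. *)
pose lam := b / (12 * 10 ^+ 3 * p ^+ 3 * N ^+ 3).
have lam0 : 0 <= lam by rewrite divr_ge0 ?(ltW b0) // ltW // !mulr_gt0.
have lamp : lam * (2 * p ^+ 2 * N) <= 1 / 2.
  have -> : lam * (2 * p ^+ 2 * N) = b / (6 * 10 ^+ 3 * p * N ^+ 2).
    by rewrite /lam; field; rewrite !gt_eqF.
  rewrite ler_pdivrMr; last by rewrite !mulr_gt0.
  by apply: (le_trans bp); rewrite le_eqVlt; apply/orP; left; apply/eqP; field.
pose K1 := expR (- (b ^+ 2 / (24 * 10 ^+ 3 * p ^+ 3 * N ^+ 3))).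
pose K2 := expR (- (2 * N)).
pose f1 E := expR (- (lam * devsum p (low E) n) - 2 * p * lam ^+ 2 * slope2 p (low E) n).
pose f2 E := expR (rowdev2 p (low E) n / (64 * N)).
pose f3 v E := expR (coldev2 p (low E) v / (64 * N)).
pose f4 E := expR (tame_inner2 p (low E) n N / (320 * p ^+ 2 * N ^+ 2)).
have h1 : expect p (all_bits n) f1 <= 1 by apply: expect_devsum.
have h2 : expect p (all_bits n) f2 <= expR (N / 16) by apply: expect_rowdev2.
have h3 v : (v < n)%N -> expect p (all_bits n) (f3 v) <= expR (N / 16).
  move=> vn; apply: (le_trans (expect_coldev2 p01 n0 ed_inj (ltnW vn) (leqnn n))).
  by rewrite ler_expR ler_wpM2r // ler_nat ltnW.
have h4 : expect p (all_bits n) f4 <= expR (N / 10) by apply: expect_tame_inner2.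
apply: (@le_trans _ _ (expect p (all_bits n) (fun E => K1 * f1 E + (K2 * f2 E +
   (K2 * f4 E + \sum_(v < n) K2 * f3 v E))))).
  apply: expect_le => // E sE.
  have f1p : 0 <= K1 * f1 E by rewrite mulr_ge0 ?expR_ge0.
  have f2p : 0 <= K2 * f2 E by rewrite mulr_ge0 ?expR_ge0.
  have f3p v : 0 <= K2 * f3 v E by rewrite mulr_ge0 ?expR_ge0.
  have f4p : 0 <= K2 * f4 E by rewrite mulr_ge0 ?expR_ge0.
  have sp : 0 <= \sum_(v < n) K2 * f3 v E by apply: sumr_ge0.
  case: (boolP (_ && _)) => [/andP[hs hd]|_]; last by rewrite !addr_ge0.
  have big x D : 0 < D -> 2 * N * D < x -> 1 <= K2 * expR (x / D).
    move=> D0 h; rewrite -expRD -[leLHS]expR0 ler_expR addrC subr_ge0.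
    by rewrite ler_pdivlMr // ltW.
  rewrite mulr1n.
  have [hr|hr] := lerP (rowdev2 p (low E) n) (128 * N ^+ 2); last first.
    have : 1 <= K2 * f2 E.
      by apply: big; rewrite ?mulr_gt0 //; apply: le_lt_trans hr; rewrite le_eqVlt; apply/orP; left; apply/eqP; ring.
    lra.
  have [ht|ht] := lerP (tame_inner2 p (low E) n N) (640 * p ^+ 2 * N ^+ 3); last first.
    have : 1 <= K2 * f4 E.
      apply: big; first by apply: mulr_gt0; [apply: mulr_gt0; [lra|exact: p2]|exact: N2].
      by apply: le_lt_trans ht; rewrite le_eqVlt; apply/orP; left; apply/eqP; ring.
    lra.
  case: (boolP [forall v : 'I_n, coldev2 p (low E) v <= 128 * N ^+ 2]) => [/forallP hc|]; last first.
    rewrite negb_forall => /existsP[v]; rewrite -ltNge => hc.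
    have : 1 <= K2 * f3 v E.
      by apply: big; rewrite ?mulr_gt0 //; apply: le_lt_trans hc; rewrite le_eqVlt; apply/orP; left; apply/eqP; ring.
    have : K2 * f3 v E <= \sum_(v < n) K2 * f3 v E.
      by rewrite (bigD1 v) //= lerDl sumr_ge0.
    lra.
  have hS : slope2 p (low E) n <= 3 * 10 ^+ 3 * p ^+ 2 * N ^+ 3.
    apply: slope2_le => //.
    - by move=> u w; case/andP: (low01 R ed E u w).
    - by move=> u w; apply: low_sqr.
    - by move=> u w uw; rewrite /lower_bit ltnNge uw.
    - by move=> v vn; apply: (hc (Ordinal vn)).
  suff : 1 <= K1 * f1 E by lra.
  rewrite -expRD -[leLHS]expR0 ler_expR.
  have e1 : lam * b <= - (lam * devsum p (low E) n).
    by rewrite -mulrN ler_wpM2l // lerNr ltW.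
  have e2 : 2 * p * lam ^+ 2 * slope2 p (low E) n <= 2 * p * lam ^+ 2 * (3 * 10 ^+ 3 * p ^+ 2 * N ^+ 3).
    by apply: ler_wpM2l => //; apply: mulr_ge0; rewrite ?sqr_ge0 // mulr_ge0 // ltW.
  have e3 : lam * b - 2 * p * lam ^+ 2 * (3 * 10 ^+ 3 * p ^+ 2 * N ^+ 3) = b ^+ 2 / (24 * 10 ^+ 3 * p ^+ 3 * N ^+ 3).
    by rewrite /lam; field; rewrite !gt_eqF.
  lra.
rewrite !expectD // !expect_scale // expect_sum //.
under eq_bigr => v _ do rewrite expect_scale //.
have K1p : 0 <= K1 by apply: expR_ge0.
have K2p : 0 <= K2 by apply: expR_ge0.
have K2e y : y <= N -> K2 * expR y <= expR (- N).
  by move=> yN; rewrite -expRD ler_expR; lra.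
have g1 := ler_wpM2l K1p h1.
have N00 := ltW N0.
have g2 : K2 * expect p (all_bits n) f2 <= expR (- N).
  by apply: (le_trans (ler_wpM2l K2p h2)); apply: K2e; lra.
have g4 : K2 * expect p (all_bits n) f4 <= expR (- N).
  by apply: (le_trans (ler_wpM2l K2p h4)); apply: K2e; lra.
have g3 : \sum_(v < n) K2 * expect p (all_bits n) (f3 v) <= N * expR (- N).
  apply: (@le_trans _ _ (\sum_(v < n) expR (- N))); last first.
    by rewrite sumr_const card_ord mulr_natl.
  apply: ler_sum => v _; apply: (le_trans (ler_wpM2l K2p (h3 v (ltn_ord v)))).
  by apply: K2e; lra.
rewrite mulr1 in g1; rewrite -/K1.
have -> : (N + 2) * expR (- N) = N * expR (- N) + 2 * expR (- N) by ring.
move: g1 g2 g3 g4; set x1 := K1 * _; set x2 := K2 * _; set x4 := K2 * _; set x3 := \sum_(v < n) _.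
by move=> g1 g2 g3 g4; lra.
Qed.

End ProductTail.

(** * From the product measure to uniform sets of fixed size *)

(** The terms of the binomial expansion of [(m + (M - m))^M] increase up to
    index [m] and decrease afterwards, so none of the [M + 1] terms exceeds that
    of index [m]. *)
Lemma binomial_mode M m : (m <= M)%N ->
  (M ^ M <= M.+1 * ('C(M, m) * m ^ m * (M - m) ^ (M - m)))%N.
Proof.
move=> mM.
pose t k := ('C(M, k) * m ^ k * (M - m) ^ (M - k))%N.
have rel k : (k < M)%N -> (k.+1 * t k.+1 * (M - m) = (M - k) * m * t k)%N.
  move=> kM; rewrite /t.
  have e1 : (k.+1 * 'C(M, k.+1) = (M - k) * 'C(M, k))%N.
    by rewrite mul_bin_left.
  have e2 : ((M - m) ^ (M - k) = (M - m) * (M - m) ^ (M - k.+1))%N.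
    by rewrite -expnS subnSK.
  by rewrite e2 !mulnA e1 expnS; nia.
have up k : (k < m)%N -> (t k <= t k.+1)%N.
  move=> km; have kM := leq_trans km mM; have := rel k kM.
  have [MmE|] := posnP (M - m).
    have kM' : (0 < M - k)%N by lia.
    by move=> _; rewrite {1}/t MmE exp0n // muln0.
  move=> Mm H; have h : (k.+1 * (M - m) <= (M - k) * m)%N by nia.
  have : (k.+1 * (M - m) * t k <= k.+1 * (M - m) * t k.+1)%N.
    apply: (@leq_trans ((M - k) * m * t k)); first by rewrite leq_mul2r h orbT.
    by rewrite -H; apply: eq_leq; ring.
  by rewrite leq_pmul2l // muln_gt0.
have down k : (m <= k)%N -> (k < M)%N -> (t k.+1 <= t k)%N.
  move=> mk kM; have := rel k kM.
  have Mm : (0 < M - m)%N by rewrite subn_gt0 (leq_ltn_trans mk).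
  move=> H; have h : ((M - k) * m <= k.+1 * (M - m))%N by nia.
  have : (k.+1 * (M - m) * t k.+1 <= k.+1 * (M - m) * t k)%N.
    apply: (@leq_trans ((M - k) * m * t k)); last by rewrite leq_mul2r h orbT.
    by rewrite -H; apply: eq_leq; ring.
  by rewrite leq_pmul2l // muln_gt0.
have le_t k : (k <= M)%N -> (t k <= t m)%N.
  move=> kM; have [km|mk] := leqP k m.
    have : (m - k <= m)%N by apply: leq_subr.
    rewrite -{2}(subKn km); elim: (m - k)%N => [|d IH] dm; first by rewrite subn0.
    apply: leq_trans (IH (ltnW dm)).
    by have := up (m - d.+1)%N; rewrite subnSK //; apply; lia.
  have : (m + (k - m) <= M)%N by rewrite subnKC // ltnW.
  rewrite -{2}(subnKC (ltnW mk)); elim: (k - m)%N => [|d IH] dm; first by rewrite addn0.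
  rewrite addnS in dm *; apply: leq_trans (IH (ltnW dm)).
  by apply: down => //; apply: leq_addr.
have -> : (M ^ M = \sum_(k < M.+1) t k)%N.
  rewrite -{1}(subnK mM) expnDn; apply: eq_bigr => k _.
  by rewrite /t -mulnA [(m ^ _ * _)%N]mulnC mulnA.
apply: (@leq_trans (\sum_(k < M.+1) t m)%N).
  by apply: leq_sum => k _; apply: le_t; rewrite -ltnS.
by rewrite sum_nat_const card_ord.
Qed.

(** Conditioned on the size, the product measure is uniform; and the size
    [m = p M], being the mode, has probability at least [1/(M + 1)]. *)
Lemma unif_prob_le_expect (R : realType) (T : finType) (l : seq T) (m : nat) (p : R) (A : pred {set T}) :
  uniq l -> (0 < size l)%N -> (m <= size l)%N -> p = m%:R / (size l)%:R ->
  unif_prob R [set E : {set T} | (E \subset l) && (#|E| == m)] A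
  <= (size l).+1%:R * expect p l (fun E => ((#|E| == m) && A E)%:R).
Proof.
move=> ul l0 ml pE; set M := size l in pE *; set S := [set E | _].
have M0 : 0 < M%:R :> R by rewrite ltr0n.
have p01 : 0 <= p <= 1.
  by rewrite pE divr_ge0 //= ler_pdivrMr // mul1r ler_nat.
have cS : #|S| = 'C(M, m).
  rewrite /M -(card_uniqP ul) -(cardsE (mem l)) -cards_draws; apply: eq_card => E.
  rewrite !inE; congr (_ && _).
  by apply/subsetP/subsetP => h x /h; rewrite inE.
pose w := p ^+ m * (1 - p) ^+ (M - m).
have q0 : 0 <= 1 - p by rewrite subr_ge0; case/andP: p01.
have pp0 : 0 <= p by case/andP: p01.
have eE : expect p l (fun E => ((#|E| == m) && A E)%:R) = w * #|[set x in S | A x]|%:R.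
  rewrite expectE // -sum1_card natr_sum mulr_sumr.
  rewrite [LHS](bigID (fun E : {set T} => (#|E| == m) && A E)) /= [X in _ + X]big1 ?addr0; last first.
    by move=> E /andP[_ /negbTE ->]; rewrite mulr0.
  apply: eq_big => [E|E]; first by rewrite !inE -andbA.
  by move=> /andP[_ /andP[/eqP -> ->]]; rewrite eqxx /w !mulr1.
have mode : 1 <= M.+1%:R * ('C(M, m)%:R * w).
  have := binomial_mode ml; rewrite -(ler_nat R) !natrM !natrX natrB // => h.
  have MM : 0 < M%:R ^+ M :> R by rewrite exprn_gt0.
  rewrite -(ler_pM2r MM) mul1r; apply: (le_trans h).
  have wE : w * M%:R ^+ M = m%:R ^+ m * (M%:R - m%:R) ^+ (M - m).
    have -> : M%:R ^+ M = M%:R ^+ m * M%:R ^+ (M - m) :> R by rewrite -exprD subnKC.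
    rewrite /w mulrACA -!exprMn pE divfK ?gt_eqF //; congr (_ * _ ^+ _).
    by rewrite mulrBl mul1r divfK ?gt_eqF //.
  have -> : M.+1%:R * ('C(M, m)%:R * w) * M%:R ^+ M = M.+1%:R * ('C(M, m)%:R * (w * M%:R ^+ M)) by ring.
  by rewrite wE !mulrA.
rewrite /unif_prob cS eE.
have C0 : 0 < 'C(M, m)%:R :> R by rewrite ltr0n bin_gt0.
rewrite ler_pdivrMr //.
set B := #|_|%:R.
have := ler_wpM2r (ler0n _ _ : 0 <= B) mode; rewrite mul1r => h; apply: (le_trans h).
by rewrite le_eqVlt; apply/orP; left; apply/eqP; ring.
Qed.

Section EdgeCount.
Variables (R : realType) (T : finType) (ed : nat -> nat -> T) (n : nat).
Hypothesis ed_inj : forall v u v' u', (u < v)%N -> (v < n)%N -> (u' < v')%N -> (v' < n)%N ->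
  ed v u = ed v' u' -> v = v' /\ u = u'.

Lemma sum_low_card (E : {set T}) : E \subset all_bits ed n ->
  \sum_(v < n) \sum_(u < v) lower_bit R ed E v u = #|E|%:R.
Proof.
move=> sE.
have -> : #|E|%:R = \sum_(x <- all_bits ed n) bit E x :> R.
  rewrite (big_uniq _ (uniq_all_bits ed_inj (leqnn n))) /= -sum1_card natr_sum.
  rewrite [RHS](bigID (mem E)) /= [X in _ + X]big1 ?addr0; last first.
    by move=> x /andP[_ /negbTE xE]; rewrite /bit xE.
  apply: eq_big => [x|x]; first by case: (boolP (x \in E)) => [/(subsetP sE) ->|]; rewrite ?andbF.
  by rewrite /bit => ->.
elim: {sE} n => [|m IH] /=; first by rewrite big_ord0 big_nil.
rewrite big_ord_recr big_cat /= IH addrC; congr (_ + _).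
have H k : (k <= m)%N -> \sum_(u < k) lower_bit R ed E m u = \sum_(x <- row_bits (ed m) k) bit E x.
  elim: k => [|k IHk] km; first by rewrite big_ord0 big_nil.
  by rewrite big_ord_recr big_cons /= IHk ?(ltnW km) // addrC /lower_bit km.
exact: H.
Qed.

Lemma lower_sum_card (E : {set T}) : E \subset all_bits ed n -> lower_sum (lower_bit R ed E) n = #|E|%:R.
Proof.
move=> sE; rewrite -sum_low_card // /lower_sum; apply: eq_bigr => u _.
rewrite (big_ord_widen n (lower_bit R ed E u) (ltnW (ltn_ord u))) [RHS]big_mkcond /=.
by apply: eq_bigr => w _; rewrite /lower_bit; case: ifP.
Qed.

End EdgeCount.

(** * Uniform sets of fixed size *)

Section UniformExpectation.
Variables (R : realType) (T : finType) (S : {set T}).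
Implicit Types (X Y : T -> R).
Notation EX := (unif_expect (R := R) S).

Lemma ue_le X Y : (forall x, x \in S -> X x <= Y x) -> EX X <= EX Y.
Proof. by move=> h; rewrite /unif_expect ler_wpM2r ?invr_ge0 // ler_sum. Qed.

Lemma eq_ue X Y : (forall x, x \in S -> X x = Y x) -> EX X = EX Y.
Proof. by move=> h; rewrite /unif_expect (eq_bigr Y). Qed.

Lemma ueD X Y : EX (fun x => X x + Y x) = EX X + EX Y.
Proof. by rewrite /unif_expect big_split mulrDl. Qed.

Lemma ueN X : EX (fun x => - X x) = - EX X.
Proof. by rewrite /unif_expect sumrN mulNr. Qed.

Lemma ueB X Y : EX (fun x => X x - Y x) = EX X - EX Y.
Proof. by rewrite -ueN -ueD. Qed.

Lemma ueZ a X : EX (fun x => a * X x) = a * EX X.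
Proof. by rewrite /unif_expect -mulr_sumr mulrA. Qed.

Lemma ue_sum (I : Type) (r : seq I) (P : pred I) (F : I -> T -> R) :
  EX (fun x => \sum_(i <- r | P i) F i x) = \sum_(i <- r | P i) EX (F i).
Proof. by rewrite /unif_expect exchange_big mulr_suml. Qed.

Lemma ue_ge0 X : (forall x, x \in S -> 0 <= X x) -> 0 <= EX X.
Proof. by move=> h; rewrite /unif_expect divr_ge0 // sumr_ge0. Qed.

Lemma ue_prob (A : pred T) : unif_prob R S A = EX (fun x => (A x)%:R).
Proof.
rewrite /unif_prob /unif_expect; congr (_ / _); rewrite -sum1_card natr_sum.
rewrite big_mkcond [RHS]big_mkcond; apply: eq_bigr => x _; rewrite inE.
by case: (x \in S) => //=; case: (A x).
Qed.

Lemma ue_cst a : (0 < #|S|)%N -> EX (fun=> a) = a.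
Proof.
by move=> S0; rewrite /unif_expect sumr_const -[a *+ _]mulr_natr mulfK // pnatr_eq0 -lt0n.
Qed.

Lemma ue_cauchy_schwarz X Y : EX (fun x => X x * Y x) ^+ 2 <= EX (fun x => X x ^+ 2) * EX (fun x => Y x ^+ 2).
Proof.
rewrite /unif_expect exprMn [leRHS]mulrACA -expr2 ler_wpM2r ?sqr_ge0 //.
exact: sum_cauchy_schwarz.
Qed.

Lemma ue_invol (s : T -> T) X : (forall x, x \in S -> s x \in S) -> involutive s ->
  EX (fun x => X (s x)) = EX X.
Proof.
move=> sS sK; rewrite /unif_expect; congr (_ / _).
rewrite [RHS](reindex_inj (inv_inj sK)) /=; apply: eq_bigl => x.
by apply/idP/idP => [/sS //|/sS]; rewrite sK.
Qed.

End UniformExpectation.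

Section UniformSubsets.
Variables (R : realType) (T : finType) (P : {set T}) (m : nat).
Definition draws := [set E : {set T} | (E \subset P) && (#|E| == m)].
Notation M := #|P|.
Hypothesis mM : (m <= M)%N.

Lemma card_draws_set : #|draws| = 'C(M, m).
Proof. exact: cards_draws. Qed.

Lemma card_draws_gt0 : (0 < #|draws|)%N.
Proof. by rewrite card_draws_set bin_gt0. Qed.

Lemma card_draws_pattern (J L : {set T}) : J \subset P -> L \subset P -> [disjoint J & L] ->
  (#|J| <= m)%N ->
  #|[set E in draws | (J \subset E) && [disjoint E & L]]| = 'C(M - (#|J| + #|L|), m - #|J|).
Proof.
move=> JP LP JL Jm.
have cJL : #|J :|: L| = (#|J| + #|L|)%N.
  by rewrite cardsU (disjoint_setI0 JL) cards0 subn0.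
have -> : (M - (#|J| + #|L|))%N = #|P :\: (J :|: L)|.
  by rewrite cardsD (setIidPr _) ?subUset ?JP // cJL.
rewrite -cards_draws.
set B := [set A : {set T} | _ & _].
have Bdis A : A \in B -> [disjoint A & J] /\ [disjoint A & L].
  rewrite inE => /andP[/subsetP AP _]; split; rewrite disjoint_subset; apply/subsetP => x /AP.
    by rewrite !inE negb_or -andbA => /andP[].
  by rewrite !inE negb_or -andbA => /and3P[].
have imE : [set E in draws | (J \subset E) && [disjoint E & L]] = [set A :|: J | A in B].
  apply/setP => E; apply/idP/imsetP.
    rewrite !inE => /andP[/andP[EP /eqP Em] /andP[JE EL]].
    exists (E :\: J); last first.
      apply/setP => x; rewrite !inE; case: (boolP (x \in J)) => [xJ|_]; last by rewrite orbF.
      by rewrite orbT (subsetP JE).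
    rewrite inE finset.cardsD (finset.setIidPr JE) Em eqxx andbT; apply/subsetP => x.
    rewrite !inE => /andP[xJ xE]; rewrite negb_or xJ (subsetP EP) // andbT /=.
    by rewrite (disjointFr EL xE).
  move=> [A AB ->]; have [AJ AL] := Bdis A AB.
  move: AB; rewrite !inE => /andP[/subsetP AP /eqP Am].
  rewrite finset.subsetUr finset.subUset JP andbT.
  have -> : A \subset P by apply/subsetP => x /AP; rewrite !inE => /andP[].
  rewrite -setI_eq0 setIUl finset.setU_eq0 !setI_eq0 AL JL !andbT /=.
  by rewrite cardsU (disjoint_setI0 AJ) cards0 subn0 Am subnK.
rewrite imE card_in_imset // => A A' /Bdis[AJ _] /Bdis[AJ' _] /setP h.
apply/setP => x; have := h x; rewrite !inE.
case: (boolP (x \in J)) => xJ; last by rewrite !orbF.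
by rewrite (disjointFl AJ xJ) (disjointFl AJ' xJ).
Qed.

Notation EX := (unif_expect (R := R) draws).

Definition pattern (J L E : {set T}) : R := ((J \subset E) && [disjoint E & L])%:R.

Lemma ue_pattern (J L : {set T}) : J \subset P -> L \subset P -> [disjoint J & L] -> (#|J| <= m)%N ->
  EX (pattern J L) = 'C(M - (#|J| + #|L|), m - #|J|)%:R / 'C(M, m)%:R.
Proof.
move=> JP LP JL Jm; rewrite -(card_draws_pattern JP LP JL Jm) -card_draws_set.
by rewrite -(ue_prob _ _ (fun E : {set T} => (J \subset E) && [disjoint E & L])).
Qed.

Lemma binomial_ratio_le k : (k <= m)%N -> (M ^ k * 'C(M - k, m - k) <= m ^ k * 'C(M, m))%N.
Proof.
elim: k => [|k IH] km; first by rewrite !subn0 !expn0 !mul1n.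
have {}IH := IH (ltnW km).
have e : ((M - k) * 'C(M - k.+1, m - k.+1) = (m - k) * 'C(M - k, m - k))%N.
  have := mul_bin_diag (M - k) (m - k.+1).
  by rewrite -subnS subnSK.
have M0 : (0 < M - k)%N by rewrite subn_gt0 (leq_trans km).
rewrite -(leq_pmul2l M0).
have -> : ((M - k) * (M ^ k.+1 * 'C(M - k.+1, m - k.+1)) = M * (m - k) * (M ^ k * 'C(M - k, m - k)))%N.
  by rewrite mulnCA e expnS; ring.
apply: (@leq_trans (M * (m - k) * (m ^ k * 'C(M, m)))%N); first by rewrite leq_mul2l IH orbT.
have -> : ((M - k) * (m ^ k.+1 * 'C(M, m)) = (M - k) * m * (m ^ k * 'C(M, m)))%N.
  by rewrite expnS; ring.
rewrite leq_mul2r; apply/orP; right.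
by rewrite mulnBl mulnBr leq_sub2l // [X in (_ <= X)%N]mulnC leq_mul2l mM orbT.
Qed.

(** Edges of a uniform graph are negatively correlated. *)
Lemma ue_edges_le (J : {set T}) : J \subset P ->
  EX (fun E : {set T} => (J \subset E)%:R) <= (m%:R / M%:R) ^+ #|J|.
Proof.
move=> JP; have [Jm|mJ] := leqP #|J| m; last first.
  rewrite (@eq_ue _ _ _ _ (fun=> 0)) ?ue_cst ?card_draws_gt0 ?exprn_ge0 ?divr_ge0 //.
  move=> E; rewrite inE => /andP[_ /eqP Em]; case: (boolP (J \subset E)) => // /subset_leq_card.
  by rewrite Em leqNgt mJ.
have -> : EX (fun E : {set T} => (J \subset E)%:R) = EX (pattern J set0).
  by apply: eq_ue => E _; rewrite /pattern disjoint_sym -setI_eq0 finset.set0I eqxx andbT.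
rewrite ue_pattern ?sub0set // ?cards0 ?addn0; last by rewrite disjoint_sym -setI_eq0 finset.set0I.
have C0 : 0 < 'C(M, m)%:R :> R by rewrite ltr0n bin_gt0.
rewrite ler_pdivrMr // expr_div_n mulrAC.
have [M0|M0] := posnP M.
  have J0 : #|J| = 0%N by apply/eqP; rewrite -leqn0 -M0 subset_leq_card.
  by rewrite J0 !expr0 !subn0 divr1 mul1r.
rewrite ler_pdivlMr ?exprn_gt0 ?ltr0n // -!natrX -!natrM ler_nat mulnC.
exact: binomial_ratio_le.
Qed.

Lemma ue_bits_le (s : seq T) : uniq s -> {subset s <= P} ->
  EX (fun E : {set T} => \prod_(e <- s) bit E e) <= (m%:R / M%:R) ^+ size s.
Proof.
move=> us sP; have cs : #|[set x in s]| = size s by rewrite cardsE; apply/card_uniqP.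
rewrite -cs; apply: le_trans (ue_edges_le _); last first.
  by apply/subsetP => x; rewrite inE; apply: sP.
apply: ue_le => E _; elim: s {us sP cs} => [|e s IH].
  rewrite big_nil; case: (boolP (_ \subset _)) => // /subsetPn[x].
  by rewrite inE.
rewrite big_cons /bit; case: (boolP (e \in E)) => eE; last by rewrite mul0r.
rewrite mul1r; apply: (le_trans IH); rewrite ler_nat.
case: (boolP ([set x in s] \subset E)) => // /subsetP h; case: (boolP (_ \subset _)) => // /subsetPn[x].
by rewrite !inE => /orP[/eqP ->|xs]; rewrite ?eE // h ?inE.
Qed.

End UniformSubsets.

(** * Graphs as triangular arrays *)

Section SymmetricSums.
Variables (R : realType) (B : nat -> nat -> R).
Hypotheses (Bsym : forall i j, B i j = B j i) (Bdiag : forall i, B i i = 0).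

Lemma sum_symmetric_pairs n (h : nat -> nat -> R) : (forall i j, h i j = h j i) ->
  (forall i, h i i = 0) ->
  \sum_(i < n) \sum_(j < n) h i j = 2 * \sum_(u < n) \sum_(w < u) h u w.
Proof.
move=> hs hd; elim: n => [|n IH]; first by rewrite !big_ord0 mulr0.
rewrite !big_ord_recr /= hd addr0.
under eq_bigr do rewrite big_ord_recr /=.
rewrite big_split /= IH.
under [X in _ + X + _]eq_bigr do rewrite hs.
by ring.
Qed.

Lemma sum_symmetric_triples n :
  \sum_(i < n) \sum_(j < n) \sum_(k < n) B i j * B j k * B i k
  = 6 * \sum_(v < n) \sum_(u < v) \sum_(w < u) B u w * B v w * B v u.
Proof.
elim: n => [|n IH]; first by rewrite !big_ord0 mulr0.
have H : \sum_(j < n) \sum_(k < n) B n j * B j k * B n k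
   = 2 * \sum_(u < n) \sum_(w < u) B u w * B n w * B n u.
  rewrite (@sum_symmetric_pairs n (fun j k => B n j * B j k * B n k)).
  - by congr (2 * _); apply: eq_bigr => u _; apply: eq_bigr => w _; ring.
  - by move=> i j; rewrite (Bsym i j); ring.
  - by move=> i; rewrite Bdiag mulr0 mul0r.
rewrite big_ord_recr /= [X in _ = 6 * X]big_ord_recr /= mulrDr -IH.
have e1 : \sum_(j < n.+1) \sum_(k < n.+1) B n j * B j k * B n k =
    \sum_(j < n) \sum_(k < n) B n j * B j k * B n k.
  rewrite big_ord_recr /= [X in _ + X]big1 ?addr0; last by move=> k _; rewrite Bdiag !mul0r.
  by apply: eq_bigr => j _; rewrite big_ord_recr /= Bdiag mulr0 addr0.
have e2 : \sum_(i < n) \sum_(j < n.+1) \sum_(k < n.+1) B i j * B j k * B i k =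
    \sum_(i < n) \sum_(j < n) \sum_(k < n) B i j * B j k * B i k
    + 2 * \sum_(j < n) \sum_(k < n) B n j * B j k * B n k.
  have -> : 2 * \sum_(j < n) \sum_(k < n) B n j * B j k * B n k =
     \sum_(i < n) \sum_(j < n) B i j * B j n * B i n + \sum_(i < n) \sum_(k < n) B i n * B n k * B i k.
    rewrite mulr_natl mulr2n; congr (_ + _).
      by apply: eq_bigr => i _; apply: eq_bigr => j _; rewrite (Bsym j n) (Bsym i n); ring.
    by apply: eq_bigr => i _; apply: eq_bigr => j _; rewrite (Bsym i n); ring.
  rewrite -!big_split; apply: eq_bigr => i _ /=.
  rewrite big_ord_recr /= [X in _ + X]big_ord_recr /= Bdiag mulr0 mul0r addr0 addrA; congr (_ + _).
  by rewrite -big_split; apply: eq_bigr => j _; rewrite big_ord_recr.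
rewrite e1 e2 H; ring.
Qed.

End SymmetricSums.

Section Graphs.
Variables (R : realType) (k : nat).
Notation n := k.+1.
Implicit Types (E : {set {set 'I_n}}).

Definition edge (i j : nat) : {set 'I_n} := [set inord i; inord j].
Definition pairs : {set {set 'I_n}} := [set e : {set 'I_n} | #|e| == 2%N].

Lemma inord_inj i j : (i < n)%N -> (j < n)%N -> inord i = inord j :> 'I_n -> i = j.
Proof. by move=> hi hj /(congr1 val); rewrite /= !inordK. Qed.

Lemma edgeC i j : edge i j = edge j i.
Proof. exact: finset.setUC. Qed.

Lemma edge_eq i j i' j' : (i < n)%N -> (j < n)%N -> (i' < n)%N -> (j' < n)%N ->
  edge i j = edge i' j' -> (i = i' /\ j = j') \/ (i = j' /\ j = i').
Proof.
move=> hi hj hi' hj' h.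
have q x y : (x < n)%N -> (y < n)%N -> (inord x == inord y :> 'I_n) = (x == y).
  by move=> hx hy; apply/eqP/eqP => [/inord_inj|->//]; apply.
have m1 : (i == i') || (i == j').
  by rewrite -!q // -in_set2 -[[set _; _]]/(edge i' j') -h !inE eqxx.
have m2 : (j == i') || (j == j').
  by rewrite -!q // -in_set2 -[[set _; _]]/(edge i' j') -h !inE eqxx orbT.
have m3 : (i' == i) || (i' == j).
  by rewrite -!q // -in_set2 -[[set _; _]]/(edge i j) h !inE eqxx.
have m4 : (j' == i) || (j' == j).
  by rewrite -!q // -in_set2 -[[set _; _]]/(edge i j) h !inE eqxx orbT.
by lia.
Qed.

Lemma edge_inj v u v' u' : (u < v)%N -> (v < n)%N -> (u' < v')%N -> (v' < n)%N ->
  edge v u = edge v' u' -> v = v' /\ u = u'.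
Proof.
move=> uv vn uv' vn'.
by case/(edge_eq vn (ltn_trans uv vn) vn' (ltn_trans uv' vn')); lia.
Qed.

Lemma edge_pairs i j : (i < n)%N -> (j < n)%N -> (edge i j \in pairs) = (i != j).
Proof.
move=> hi hj; rewrite inE cards2; have [->|ij] := eqVneq i j; first by rewrite eqxx.
by rewrite (_ : inord i != inord j) //; apply: contra ij => /eqP /inord_inj ->.
Qed.

Lemma mem_all_bits_pairs e : (e \in all_bits edge n) = (e \in pairs).
Proof.
apply/idP/idP => [/mem_all_bits[v [u [uv vn ->]]]|].
  by rewrite edge_pairs ?(ltn_trans uv vn) // neq_ltn uv orbT.
rewrite inE => /cards2P[x [y [xy ->]]]; apply/mem_all_bits.
have xyn : (x != y :> nat) by apply: contra xy => /eqP/val_inj ->.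
case: (ltngtP x y) => h; last by rewrite h eqxx in xyn.
  by exists y, x; rewrite h /edge !inord_val finset.setUC.
by exists x, y; rewrite h /edge !inord_val.
Qed.

Lemma graphs_nm_draws m : graphs_nm n m = draws pairs m.
Proof. by []. Qed.

Lemma subset_pairs E : (E \subset pairs) = (E \subset all_bits edge n).
Proof. by apply/subsetP/subsetP => h x /h; rewrite mem_all_bits_pairs. Qed.

Lemma card_pairs : #|pairs| = 'C(n, 2).
Proof.
have -> : pairs = [set A : {set 'I_n} | A \subset [set: 'I_n] & #|A| == 2%N].
  by apply/setP => A; rewrite !inE subsetT.
by rewrite cards_draws cardsT card_ord.
Qed.

Definition adjR E (i j : nat) : R := bit E (edge i j).

Lemma adjRC E i j : adjR E i j = adjR E j i.
Proof. by rewrite /adjR edgeC. Qed.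

Lemma adjR_diag E i : E \subset pairs -> adjR E i i = 0.
Proof.
move=> sE; rewrite /adjR /bit; case: (boolP (_ \in E)) => // /(subsetP sE).
by rewrite inE /edge finset.setUid cards1.
Qed.

Lemma triangle_count_sum E : E \subset pairs ->
  (triangle_count E)%:R = \sum_(i < n) \sum_(j < n) \sum_(l < n) adjR E i j * adjR E j l * adjR E i l.
Proof.
move=> sE; rewrite /triangle_count -sum1_card natr_sum.
pose h (x : 'I_n * ('I_n * 'I_n)) : {ffun 'I_3 -> 'I_n} :=
  [ffun i => tnth [tuple x.1; x.2.1; x.2.2] i].
pose g (f : {ffun 'I_3 -> 'I_n}) := (f (@Ordinal 3 0 isT), (f (@Ordinal 3 1 isT), f (@Ordinal 3 2 isT))).
have hK : cancel h g by case=> x [y z]; rewrite /g /h !ffunE.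
have gK : cancel g h.
  move=> f; apply/ffunP => i; rewrite ffunE /g /=.
  case: i => [[|[|[|i]]] hi] //=; rewrite /tnth /=; congr (f _); exact: val_inj.
rewrite (reindex h) /=; last by exists g => x _; [apply: hK|apply: gK].
under [RHS]eq_bigr => i _ do rewrite (pair_bigA _ (fun j l : 'I_n => adjR E i j * adjR E j l * adjR E i l)) /=.
rewrite (pair_bigA _ (fun (i : 'I_n) (x : 'I_n * 'I_n) => adjR E i x.1 * adjR E x.1 x.2 * adjR E i x.2)) /=.
rewrite big_mkcond /=; apply: eq_bigr => [[x [y z]]] _ /=.
rewrite inE.
have aE (u v : 'I_n) : adjR E u v = (adj E u v)%:R by rewrite /adjR /bit /edge /adj !inord_val.
rewrite !aE -!natrM !mulnb.
suff -> : injectiveb (h (x, (y, z))) && [forall i, forall j, (i != j) ==> adj E (h (x, (y, z)) i) (h (x, (y, z)) j)]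
  = adj E x y && adj E y z && adj E x z by case: (_ && _).
have nloop (u v : 'I_n) : adj E u v -> u != v.
  move=> /(subsetP sE); rewrite inE; apply: contraTneq => ->.
  by rewrite finset.setUid cards1.
have adjC (u v : 'I_n) : adj E u v = adj E v u by rewrite /adj finset.setUC.
apply/andP/idP.
  move=> [_ /forallP H].
  have H01 := forallP (H (@Ordinal 3 0 isT)) (@Ordinal 3 1 isT).
  have H02 := forallP (H (@Ordinal 3 0 isT)) (@Ordinal 3 2 isT).
  have H12 := forallP (H (@Ordinal 3 1 isT)) (@Ordinal 3 2 isT).
  rewrite /h !ffunE in H01 H02 H12; move: H01 H02 H12; rewrite /tnth /=.
  by move=> -> -> ->.
move=> /andP[/andP[xy yz] xz].
have A (i j : 'I_3) : i != j -> adj E (h (x, (y, z)) i) (h (x, (y, z)) j).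
  rewrite /h !ffunE.
  case: i => [[|[|[|i]]] hi] //=; case: j => [[|[|[|j]]] hj] //=; rewrite /tnth /=.
  - by rewrite adjC.
  - by rewrite adjC.
  - by rewrite adjC.
split.
  apply/injectiveP => i j hij; apply/eqP; apply: contraT => /A /nloop.
  by rewrite hij eqxx.
by apply/forallP => i; apply/forallP => j; apply/implyP; apply: A.
Qed.

Lemma triangle_count_low E : E \subset pairs ->
  (triangle_count E)%:R = 6 * triangles (lower_bit R edge E) n.
Proof.
move=> sE; rewrite triangle_count_sum // sum_symmetric_triples; last first.
- by move=> i; apply: adjR_diag.
- exact: adjRC.
congr (6 * _); apply: eq_bigr => v _; apply: eq_bigr => u _; apply: eq_bigr => w _.
by rewrite /lower_bit !ltn_ord (ltn_trans (ltn_ord w) (ltn_ord u)).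
Qed.

End Graphs.

(** * The Gaussian upper bound with polynomial factors *)

Section UpperBound.
Variables (R : realType) (k m : nat) (t : R).
Notation n := k.+1.
Notation N := (n%:R : R).
Hypothesis n2 : (2 <= n)%N.
Hypothesis tE : t = m%:R / 'C(n, 2)%:R.
Hypothesis t1 : t <= 1.
Notation EX := (unif_expect (graphs_nm n m)).

Lemma C2_gt0 : 0 < 'C(n, 2)%:R :> R.
Proof. by rewrite ltr0n bin_gt0. Qed.

Lemma mE : m%:R = t * 'C(n, 2)%:R.
Proof. by rewrite tE divfK // gt_eqF // C2_gt0. Qed.

Lemma m_le_pairs : (m <= #|pairs k|)%N.
Proof. by rewrite card_pairs -(ler_nat R) mE ler_piMl. Qed.

Lemma C2_le : 'C(n, 2)%:R <= N ^+ 2 / 2 :> R.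
Proof.
have -> : 'C(n, 2)%:R = N * (N - 1) / 2 :> R.
  have : ('C(n, 2) * 2 = n * n.-1)%N by rewrite mulnC -mul_bin_diag bin1.
  move/(congr1 (fun x => x%:R : R)); rewrite !natrM /= => h.
  have -> : N - 1 = k%:R by rewrite -natr1 addrK.
  by rewrite -h mulfK.
rewrite ler_pM2r ?invr_gt0 // expr2 ler_wpM2l //; lra.
Qed.

Lemma expected_triangles_le :
  EX (fun E => (triangle_count E)%:R) <= 6 * (t ^+ 3 * 'C(n, 3)%:R).
Proof.
rewrite graphs_nm_draws.
rewrite (@eq_ue _ _ _ _ (fun E => 6 * triangles (lower_bit R (@edge k) E) n)); last first.
  by move=> E; rewrite inE => /andP[sE _]; apply: triangle_count_low.
rewrite ueZ ler_pM2l // /triangles ue_sum.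
have -> : 'C(n, 3)%:R = \sum_(v < n) \sum_(u < v) \sum_(w < u) (1 : R).
  elim: (n) => [|n' IH]; first by rewrite big_ord0.
  rewrite big_ord_recr /= -IH binS natrD; congr (_ + _).
  elim: (n') {IH} => [|n'' IH]; first by rewrite big_ord0.
  by rewrite big_ord_recr /= -IH binS natrD bin1 sumr_const card_ord.
rewrite mulr_sumr; apply: ler_sum => v _; rewrite ue_sum mulr_sumr; apply: ler_sum => u _.
rewrite ue_sum mulr_sumr; apply: ler_sum => w _; rewrite mulr1.
have vn := ltn_ord v; have uv := ltn_ord u; have wu := ltn_ord w.
have un := ltn_trans uv vn; have wn := ltn_trans wu un; have wv := ltn_trans wu uv.
have us : uniq [:: @edge k u w; edge k v w; edge k v u].
  rewrite /= !inE negb_or !andbT -!andbA; apply/and3P; split; apply/eqP.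
  - by move/(edge_eq un wn vn wn); lia.
  - by move/(edge_eq un wn vn un); lia.
  - by move/(edge_eq vn wn vn un); lia.
have sP : {subset [:: @edge k u w; edge k v w; edge k v u] <= pairs k}.
  by move=> e; rewrite !inE => /or3P[] /eqP ->; rewrite -[_ == _](in_set (fun e : {set 'I_n} => #|e| == 2%N)) edge_pairs //; lia.
have := ue_bits_le R m_le_pairs us sP; rewrite /= card_pairs -tE; apply: le_trans.
apply: ue_le => E _; rewrite !big_cons big_nil mulr1 mulrA.
by rewrite /lower_bit wu uv (ltn_trans wu uv).
Qed.

(** The number of edges equals its mean under the product measure, so the
    edge term of [triangles_devsum] vanishes; each triangle is counted six
    times. *)
Lemma lower_tail_upper a : 256 <= t ^+ 2 * N -> 0 < a -> a <= 18 * 10 ^+ 3 * t * N ^+ 2 ->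
  unif_prob R (graphs_nm n m) (fun E => triangle_deviation R m E < - a)
  <= ('C(n, 2).+1)%:R * (expR (- (a ^+ 2 / (864 * 10 ^+ 3 * t ^+ 3 * N ^+ 3))) + (N + 2) * expR (- N)).
Proof.
move=> tN a0 aN.
have t0 : 0 < t.
  rewrite lt_neqAle eq_sym tE divr_ge0 // andbT -tE; apply: contraL tN => /eqP ->.
  by rewrite expr0n mul0r; lra.
have p01 : 0 <= t <= 1 by rewrite ltW.
have uq : uniq (all_bits (@edge k) n) by apply: (uniq_all_bits (@edge_inj k)).
have sz := size_all_bits (@edge k) n.
have graphsE : graphs_nm n m = [set E : {set {set 'I_n}} | (E \subset all_bits (@edge k) n) && (#|E| == m)].
  by apply/setP => E; rewrite !inE -subset_pairs.
pose A (E : {set {set 'I_n}}) := triangle_deviation R m E < - a.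
rewrite graphsE.
apply: le_trans (@unif_prob_le_expect R _ _ m t A uq _ _ _) _.
- by rewrite sz bin_gt0.
- by rewrite sz -card_pairs m_le_pairs.
- by rewrite sz.
rewrite sz ler_pM2l ?ltr0n //.
have b0 : 0 < a / 6 by rewrite divr_gt0.
have bN : a / 6 <= 3 * 10 ^+ 3 * t * N ^+ 2 by lra.
apply: le_trans (_ : expect t (all_bits (@edge k) n) (fun E => ((lower_sum (lower_bit R (@edge k) E) n <= t * N ^+ 2) &&
   (devsum t (lower_bit R (@edge k) E) n < - (a / 6)))%:R) <= _); last first.
  apply: (le_trans (expect_devsum_tail p01 (ltn0Sn k) (@edge_inj k) t0 tN b0 bN)).
  rewrite lerD2r ler_expR lerN2 expr_div_n le_eqVlt; apply/orP; left; apply/eqP.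
  have N0 : N != 0 by rewrite pnatr_eq0.
  have t0' : t != 0 by rewrite gt_eqF.
  by move: (N) N0 => x x0; field; rewrite x0 t0'.
apply: expect_le => // E sE; rewrite ler_nat; case: (boolP (_ && _)) => // /andP[/eqP Em].
rewrite /A /triangle_deviation => hD.
suff -> : (lower_sum (lower_bit R (@edge k) E) n <= t * N ^+ 2) && (devsum t (lower_bit R (@edge k) E) n < - (a / 6)) by [].
have cE := lower_sum_card R (@edge_inj k) sE.
apply/andP; split.
  rewrite cE Em mE ler_wpM2l ?(ltW t0) //; apply: (le_trans C2_le).
  by rewrite ler_piMr // ?sqr_ge0 //; lra.
have hE := expected_triangles_le.
have sp : E \subset pairs k by rewrite subset_pairs.
rewrite (triangle_count_low R sp) in hD.
have low0 u w : (u <= w)%N -> lower_bit R (@edge k) E u w = 0 by move=> uw; rewrite /lower_bit ltnNge uw.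
have := triangles_devsum t low0 n.
have -> : \sum_(v < n) \sum_(u < v) (lower_bit R (@edge k) E v u - t) = 0.
  under eq_bigr => v _ do rewrite big_split /=.
  rewrite big_split /= (sum_low_card R (@edge_inj k) sE) Em mE.
  under [X in _ + X]eq_bigr => v _ do rewrite sumr_const card_ord.
  suff -> : \sum_(v < n) (- t) *+ v = - t * 'C(n, 2)%:R by rewrite mulNr subrr.
  elim: (n) => [|n' IH]; first by rewrite big_ord0 mulr0.
  by rewrite big_ord_recr /= IH binS natrD bin1 mulrDr -[- t *+ n']mulr_natr.
rewrite mulr0 addr0 => hT.
lra.
Qed.

End UpperBound.

(** * Tilting along a family of involutions *)

Section Orthogonality.
Variables (R : realType) (T : finType) (S : {set T}) (I : finType) (s : I -> T -> T).
Notation EX := (unif_expect (R := R) S).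
Variables (W : T -> R) (xi : I -> T -> R).

Definition invariant_under i (f : T -> R) := forall x, x \in S -> f (s i x) = f x.
Definition invariant_all f := forall i, invariant_under i f.

Hypothesis centred : forall i f, invariant_under i f -> EX (fun x => W x * xi i x * f x) = 0.
Hypothesis xi_inv : forall i j, i != j -> invariant_under i (xi j).

Notation rk := (@enum_rank I).

(** Cross terms vanish: the index of larger rank contributes a factor [xi i],
    which averages to zero against the remaining factors because they are
    invariant under [s i]. *)
Lemma orthogonal_increments (g : I -> T -> R) :
  (forall i j, (rk j <= rk i)%N -> invariant_under i (g j)) ->
  EX (fun x => W x * (\sum_i xi i x * g i x) ^+ 2) = \sum_i EX (fun x => W x * (xi i x * g i x) ^+ 2).
Proof.
move=> gI.
transitivity (\sum_i \sum_j EX (fun x => W x * (xi i x * g i x) * (xi j x * g j x))).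
  rewrite -[RHS]/(\sum_i \sum_j _); under [RHS]eq_bigr => i _ do rewrite -ue_sum.
  rewrite -ue_sum; apply: eq_ue => x _; rewrite expr2 big_distrl mulr_sumr /=; apply: eq_bigr => i _.
  by rewrite mulrA mulr_sumr; apply: eq_bigr => j _; ring.
apply: eq_bigr => i _; rewrite (bigD1 i) //= big1 ?addr0.
  by apply: eq_ue => x _; ring.
move=> j ji.
have [h|h] := leqP (rk j) (rk i).
  rewrite -(centred (i := i) (f := fun x => g i x * (xi j x * g j x))).
    by apply: eq_ue => x _; ring.
  by move=> x xS; rewrite (gI i i) // (xi_inv _) 1?eq_sym // (gI i j).
rewrite -(centred (i := j) (f := fun x => g j x * (xi i x * g i x))).
  by apply: eq_ue => x _; ring.
by move=> x xS; rewrite (gI j j) // (xi_inv _) // (gI j i) // ltnW.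
Qed.

End Orthogonality.

Section OddFunctions.
Variables (R : realType) (T : finType) (S : {set T}) (s : T -> T).
Hypotheses (sS : forall x, x \in S -> s x \in S) (sK : involutive s).

Lemma ue_odd (f : T -> R) : (forall x, x \in S -> f (s x) = - f x) -> unif_expect S f = 0.
Proof.
move=> h; have : unif_expect S f = - unif_expect S f.
  rewrite -{1}(ue_invol f sS sK) -ueN; exact: eq_ue.
by move=> e; lra.
Qed.
End OddFunctions.

(** The part of [L] above [l] carries at least half of the mean; apply
    Cauchy-Schwarz to it. *)
Lemma paley_zygmund (R : realType) (T : finType) (S : {set T}) (L : T -> R) (l K : R) :
  (0 < #|S|)%N -> 0 <= l -> 2 * l <= unif_expect S L -> unif_expect S (fun x => L x ^+ 2) <= K ->
  l ^+ 2 <= K * unif_expect S (fun x => (l <= L x)%R%:R).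
Proof.
move=> S0 l0 h1 h2; set A : T -> R := fun x => (l <= L x)%R%:R.
have h3 : l <= unif_expect S (fun x => L x * A x).
  have : unif_expect S L <= unif_expect S (fun x => L x * A x + l).
    apply: ue_le => x _; rewrite /A; case: (lerP l (L x)) => h; rewrite /= ?mulr1n ?mulr0n ?mulr1 ?mulr0; lra.
  rewrite ueD ue_cst //; lra.
apply: (@le_trans _ _ (unif_expect S (fun x => L x * A x) ^+ 2)).
  by rewrite ler_pXn2r ?nnegrE // (le_trans l0).
apply: (le_trans (ue_cauchy_schwarz S L A)).
rewrite (@eq_ue _ _ S (fun x => A x ^+ 2) A); last first.
  by move=> x _; rewrite /A; case: (_ <= _); rewrite ?expr1n ?expr0n.
by rewrite ler_wpM2r // ue_ge0 // => x _; rewrite /A ler0n.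
Qed.

Section Tilting.
Variables (R : realType) (T : finType) (S : {set T}) (I : finType) (s : I -> T -> T).
Notation EX := (unif_expect (R := R) S).
Hypothesis S0 : (0 < #|S|)%N.
Hypotheses (sS : forall i x, x \in S -> s i x \in S) (sK : forall i, involutive (s i)).
Notation inv_all := (invariant_all S s).
Variables (z : I -> T -> R) (F0 : T -> R) (a : I -> T -> R) (c : I -> I -> T -> R) (dl : R).
Hypothesis z3 : forall i x, z i x ^+ 3 = z i x.
Hypothesis z_odd : forall i x, x \in S -> z i (s i x) = - z i x.
Hypothesis z_inv : forall i j, i != j -> invariant_under S s i (z j).
Hypotheses (F0_inv : inv_all F0) (a_inv : forall i, inv_all (a i)).
Hypothesis c_inv : forall i j, inv_all (c i j).
Hypothesis c_sym : forall i j x, c i j x = c j i x.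
Hypothesis c_diag : forall i x, c i i x = 0.
Hypothesis dl01 : 0 <= dl <= 1.

Let e i x := - dl * Num.sg (a i x).

(** The density that favours signs [z i] opposite to [a i]. *)
Definition tilt x := \prod_i (1 + e i x * z i x).
Let xi i x := z i x - e i x * z i x ^+ 2.

Let e_inv i : inv_all (e i).
Proof. by move=> j x xS; rewrite /e a_inv. Qed.

Let z2_inv i : inv_all (fun x => z i x ^+ 2).
Proof.
move=> j x xS; have [->|ji] := eqVneq j i; first by rewrite z_odd // sqrrN.
by rewrite z_inv.
Qed.

Let z_cases i x : [\/ z i x = 0, z i x = 1 | z i x = -1].
Proof.
have := z3 i x => /eqP; rewrite -subr_eq0.
have -> : z i x ^+ 3 - z i x = z i x * ((z i x - 1) * (z i x + 1)) by ring.
rewrite !mulf_eq0 subr_eq0 addr_eq0 => /orP[/eqP h|/orP[/eqP h|/eqP h]].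
- exact: Or31.
- exact: Or32.
- exact: Or33.
Qed.

Let e_le i x : `|e i x| <= dl.
Proof.
case/andP: dl01 => d0 d1; rewrite normrM normrN (ger0_norm d0) ler_piMr // normr_sg lern1.
by case: (_ != _).
Qed.

Let factor_ge0 i x : 0 <= 1 + e i x * z i x.
Proof.
have := e_le i x; rewrite ler_norml; case/andP: dl01 => d0 d1 /andP[h1 h2].
by case: (z_cases i x) => ->; lra.
Qed.

Lemma tilt_ge0 x : 0 <= tilt x.
Proof. by apply: prodr_ge0 => i _; apply: factor_ge0. Qed.

Let xi_le i x : xi i x ^+ 2 <= 4 * z i x ^+ 2.
Proof.
have := e_le i x; rewrite ler_norml /xi; case/andP: dl01 => d0 d1 /andP[h1 h2].
case: (z_cases i x) => ->.
- by rewrite expr0n /= mulr0 subr0 expr0n /= mulr0.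
- have -> : (1 - e i x * 1 ^+ 2) ^+ 2 = (1 - e i x) ^+ 2 by ring.
  have -> : 4 * 1 ^+ 2 = 2 ^+ 2 :> R by ring.
  rewrite ler_pXn2r ?nnegrE //; lra.
- have -> : (-1 - e i x * (-1) ^+ 2) ^+ 2 = (1 + e i x) ^+ 2 by ring.
  have -> : 4 * (-1) ^+ 2 = 2 ^+ 2 :> R by ring.
  rewrite ler_pXn2r ?nnegrE //; lra.
Qed.

Let prod_inv i (r : seq I) (f : R -> R) : i \notin r -> forall x, x \in S ->
  \prod_(j <- r) f (e j (s i x) * z j (s i x)) = \prod_(j <- r) f (e j x * z j x).
Proof.
elim: r => [|j r IH]; first by move=> _ x _; rewrite !big_nil.
rewrite inE negb_or => /andP[ij ir] x xS; rewrite !big_cons IH // e_inv // z_inv //.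
Qed.

(** Applying [s i] flips the sign of [z i] in a single factor, so that this
    factor averages to one. *)
Lemma ue_tilt (G : T -> R) : inv_all G -> EX (fun x => tilt x * G x) = EX G.
Proof.
move=> GI; rewrite /tilt -[index_enum I]enumT.
have : uniq (enum I) by apply: enum_uniq.
elim: (enum I) => [|i r IH]; first by move=> _; apply: eq_ue => x _; rewrite big_nil mul1r.
move=> /= /andP[ir ur]; rewrite -IH //.
rewrite (@eq_ue _ _ _ _ (fun x => (\prod_(j <- r) (1 + e j x * z j x)) * G x +
   z i x * (e i x * (\prod_(j <- r) (1 + e j x * z j x)) * G x))); last first.
  by move=> x _; rewrite big_cons; ring.
rewrite ueD (ue_odd (f := fun x => z i x * _) (sS i) (sK i)) ?addr0 // => x xS.
by rewrite z_odd // e_inv // GI // (prod_inv (fun u => 1 + u) ir) // mulNr.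
Qed.

(** The average of the square of a factor over the involution is
    [1 + dl^2 z^2] or less. *)
Lemma ue_tilt_sqr K : (forall x, x \in S -> \sum_i z i x ^+ 2 <= K) ->
  EX (fun x => tilt x ^+ 2) <= expR (dl ^+ 2 * K).
Proof.
move=> hK.
have step (r : seq I) : uniq r -> forall G, inv_all G ->
    EX (fun x => (\prod_(i <- r) (1 + e i x * z i x) ^+ 2) * G x)
    = EX (fun x => (\prod_(i <- r) (1 + (e i x * z i x) ^+ 2)) * G x).
  elim: r => [|i r IH] /=; first by move=> _ G _; apply: eq_ue => x _; rewrite !big_nil.
  move=> /andP[ir ur] G GI.
  rewrite (@eq_ue _ _ _ _ (fun x => (\prod_(j <- r) (1 + e j x * z j x) ^+ 2) * ((1 + (e i x * z i x) ^+ 2) * G x) +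
     z i x * (2 * e i x * (\prod_(j <- r) (1 + e j x * z j x) ^+ 2) * G x))); last first.
    by move=> x _; rewrite big_cons; ring.
  rewrite ueD (ue_odd (f := fun x => z i x * _) (sS i) (sK i)) ?addr0; last first.
    move=> x xS.
    by rewrite z_odd // e_inv // GI // (prod_inv (fun u => (1 + u) ^+ 2) ir) // mulNr.
  rewrite IH //.
    by apply: eq_ue => x _; rewrite big_cons; ring.
  by move=> j x xS; rewrite /= GI // [X in 1 + X]exprMn e_inv // z2_inv // -exprMn.
have := step (index_enum I) (index_enum_uniq I) (fun=> 1) (fun _ _ _ => erefl).
rewrite (@eq_ue _ _ S _ (fun x => tilt x ^+ 2)); last first.
  by move=> x _; rewrite mulr1 /tilt prodrXl.
move=> ->.
rewrite -[leRHS](ue_cst _ S0); apply: ue_le => x xS; rewrite mulr1.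
apply: (@le_trans _ _ (\prod_i expR ((e i x * z i x) ^+ 2))).
  by apply: ler_prod => i _; rewrite addr_ge0 ?sqr_ge0 //= expR_ge1Dx.
rewrite -expR_sum ler_expR; apply: le_trans (_ : dl ^+ 2 * \sum_i z i x ^+ 2 <= _); last first.
  by rewrite ler_wpM2l ?sqr_ge0 // hK.
rewrite mulr_sumr; apply: ler_sum => i _; rewrite exprMn ler_wpM2r ?sqr_ge0 //.
rewrite -[leLHS]real_normK ?num_real // ler_pXn2r ?nnegrE //.
by case/andP: dl01.
Qed.

Let centred i f : invariant_under S s i f -> EX (fun x => tilt x * xi i x * f x) = 0.
Proof.
move=> fI.
rewrite (@eq_ue _ _ _ _ (fun x => z i x * ((1 - e i x ^+ 2) * (\prod_(j | j != i) (1 + e j x * z j x)) * f x))).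
  apply: (ue_odd (sS i) (sK i)) => x xS; rewrite z_odd // mulNr fI // e_inv //.
  congr (- (_ * (_ * _ * _))); apply: eq_bigr => j ji; by rewrite e_inv // z_inv // eq_sym.
move=> x _; rewrite /tilt (bigD1 i) //= /xi.
set P := \prod_(j | j != i) _; set u := e i x.
have -> : (1 + u * z i x) * P * (z i x - u * z i x ^+ 2) * f x = (z i x - u ^+ 2 * z i x ^+ 3) * P * f x by ring.
by rewrite z3; ring.
Qed.

Let xi_inv i j : i != j -> invariant_under S s i (xi j).
Proof. by move=> ij x xS; rewrite /xi e_inv // z_inv. Qed.

Let eta i x := e i x * z i x ^+ 2.

Let eta_le i x : `|eta i x| <= dl * z i x ^+ 2.
Proof. by rewrite /eta normrM [X in _ * X]ger0_norm ?sqr_ge0 // ler_wpM2r ?sqr_ge0. Qed.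

Let eta_inv i : inv_all (eta i).
Proof. by move=> j x xS; rewrite /eta e_inv // z2_inv. Qed.

Let z4 i x : z i x ^+ 2 * z i x ^+ 2 = z i x ^+ 2.
Proof. by rewrite -exprD (exprD _ 3 1) z3 expr1 expr2. Qed.

Notation rk := (@enum_rank I).

Let lin x := \sum_i xi i x * (a i x + 2 * \sum_j c i j x * eta j x).
Let quad x := \sum_i xi i x * (2 * \sum_(j | (rk j < rk i)%N) c i j x * xi j x).
Let mean_quad x := \sum_i \sum_j c i j x * eta i x * eta j x.
(** The amount by which the tilt lowers the linear part, per unit of [dl]. *)
Definition tilt_drift x := \sum_i z i x ^+ 2 * `|a i x|.

Let sym_split (f : I -> I -> R) : (forall i j, f i j = f j i) -> (forall i, f i i = 0) ->
  \sum_i \sum_j f i j = 2 * \sum_i \sum_(j | (rk j < rk i)%N) f i j.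
Proof.
move=> fs fd.
have -> : 2 * \sum_i \sum_(j | (rk j < rk i)%N) f i j =
   \sum_i \sum_(j | (rk j < rk i)%N) f i j + \sum_i \sum_(j | (rk i < rk j)%N) f i j.
  rewrite mulr_natl mulr2n; congr (_ + _); rewrite (exchange_big_dep xpredT) //=.
  by apply: eq_bigr => i _; apply: eq_bigr => j _; rewrite fs.
rewrite -big_split /=; apply: eq_bigr => i _.
rewrite (bigID (fun j => (rk j < rk i)%N)) /=; congr (_ + _).
rewrite (bigID (fun j => (rk i < rk j)%N)) /= [X in _ + X]big1 ?addr0.
  by apply: eq_bigl => j; rewrite -leqNgt; case: ltngtP.
move=> j; rewrite -!leqNgt => /andP[h1 h2].
have -> : j = i by apply: enum_rank_inj; apply: val_inj; apply/eqP; rewrite eqn_leq h1 h2.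
exact: fd.
Qed.

(** Each sign is replaced by [xi], its recentred version under the tilted
    measure, and [eta = z - xi]; what is linear in [xi] is collected in [lin],
    what is quadratic in [quad]. *)
Lemma tilt_decomposition x :
  F0 x + \sum_i z i x * a i x + \sum_i \sum_j c i j x * z i x * z j x
  = F0 x - dl * tilt_drift x + lin x + quad x + mean_quad x.
Proof.
have zE i : z i x = xi i x + eta i x by rewrite /xi /eta subrK.
have h1 : \sum_i z i x * a i x = \sum_i xi i x * a i x - dl * tilt_drift x.
  rewrite /tilt_drift mulr_sumr -sumrB; apply: eq_bigr => i _; rewrite {1}zE mulrDl; congr (_ + _).
  have -> : `|a i x| = Num.sg (a i x) * a i x by rewrite -normrEsg.
  by rewrite /eta /e; ring.
have h2 : \sum_i \sum_j c i j x * z i x * z j x =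
   \sum_i \sum_j c i j x * xi i x * xi j x + 2 * \sum_i \sum_j c i j x * xi i x * eta j x + mean_quad x.
  have -> : 2 * \sum_i \sum_j c i j x * xi i x * eta j x =
     \sum_i \sum_j c i j x * xi i x * eta j x + \sum_i \sum_j c i j x * eta i x * xi j x.
    rewrite mulr_natl mulr2n; congr (_ + _); rewrite exchange_big /=.
    by apply: eq_bigr => i _; apply: eq_bigr => j _; rewrite c_sym; ring.
  rewrite /mean_quad -!big_split /=; apply: eq_bigr => i _; rewrite -!big_split /=.
  by apply: eq_bigr => j _; rewrite !zE; ring.
have h3 : \sum_i \sum_j c i j x * xi i x * xi j x = quad x.
  rewrite (@sym_split (fun i j => c i j x * xi i x * xi j x)); first last.
  - by move=> i; rewrite c_diag !mul0r.
  - by move=> i j; rewrite c_sym; ring.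
  rewrite /quad mulr_sumr; apply: eq_bigr => i _; rewrite !mulr_sumr.
  by apply: eq_bigr => j _; ring.
have h4 : lin x = \sum_i xi i x * a i x + 2 * \sum_i \sum_j c i j x * xi i x * eta j x.
  rewrite /lin mulr_sumr -big_split /=; apply: eq_bigr => i _; rewrite mulrDr !mulr_sumr; congr (_ + _).
  by apply: eq_bigr => j _; ring.
by rewrite h1 h2 h3 h4; ring.
Qed.

Definition lin_moment := EX (fun x => \sum_i z i x ^+ 2 * a i x ^+ 2).
Definition cross_moment := EX (fun x => \sum_i z i x ^+ 2 * (\sum_j `|c i j x| * z j x ^+ 2) ^+ 2).
Definition quad_moment := EX (fun x => \sum_i \sum_j c i j x ^+ 2 * z i x ^+ 2 * z j x ^+ 2).
Definition shift_moment := EX (fun x => \sum_i \sum_j `|c i j x| * z i x ^+ 2 * z j x ^+ 2).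

Let ue_xi2 i (G : T -> R) : (forall x, 0 <= G x) ->
  EX (fun x => tilt x * (xi i x ^+ 2 * G x)) <= 4 * EX (fun x => tilt x * (z i x ^+ 2 * G x)).
Proof.
move=> G0; rewrite -ueZ; apply: ue_le => x _.
have := ler_wpM2r (G0 x) (xi_le i x) => /(ler_wpM2l (tilt_ge0 x)) h.
by apply: (le_trans h); rewrite le_eqVlt; apply/orP; left; apply/eqP; ring.
Qed.

Lemma ue_lin : EX (fun x => tilt x * lin x ^+ 2) <= 8 * lin_moment + 32 * dl ^+ 2 * cross_moment.
Proof.
pose g i x := a i x + 2 * \sum_j c i j x * eta j x.
have gI i : inv_all (g i).
  move=> j x xS; rewrite /g a_inv //; congr (_ + 2 * _); apply: eq_bigr => l _.
  by rewrite c_inv // eta_inv.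
have -> : EX (fun x => tilt x * lin x ^+ 2) = \sum_i EX (fun x => tilt x * (xi i x * g i x) ^+ 2).
  by rewrite -(orthogonal_increments centred xi_inv (g := g)) // => i j _; apply: gI.
have h i : EX (fun x => tilt x * (xi i x * g i x) ^+ 2) <= 4 * EX (fun x => z i x ^+ 2 * g i x ^+ 2).
  rewrite -[X in _ <= 4 * X]ue_tilt; last first.
    by move=> j x xS; rewrite z2_inv // gI.
  rewrite (@eq_ue _ _ _ _ (fun x => tilt x * (xi i x ^+ 2 * g i x ^+ 2))); last first.
    by move=> x _; rewrite exprMn.
  by apply: ue_xi2 => x; apply: sqr_ge0.
apply: (le_trans (ler_sum _ (fun i _ => h i))).
rewrite -mulr_sumr -ue_sum /lin_moment /cross_moment -!ueZ -ueD; apply: ue_le => x _.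
rewrite !mulr_sumr -big_split /=; apply: ler_sum => i _.
rewrite /g; set u := \sum_j c i j x * eta j x; set v := \sum_j `|c i j x| * z j x ^+ 2.
case/andP: dl01 => d0 d1.
have uv : `|u| <= dl * v.
  apply: (le_trans (ler_norm_sum _ _ _)); rewrite /v mulr_sumr; apply: ler_sum => j _.
  by rewrite normrM mulrCA ler_wpM2l.
have u2 : u ^+ 2 <= dl ^+ 2 * v ^+ 2.
  rewrite -[leLHS]real_normK ?num_real // -exprMn ler_pXn2r ?nnegrE //.
  by apply: le_trans uv.
have : (a i x + 2 * u) ^+ 2 <= 2 * a i x ^+ 2 + 8 * (dl ^+ 2 * v ^+ 2).
  have := sqr_ge0 (a i x - 2 * u).
  have -> : (a i x - 2 * u) ^+ 2 = 2 * a i x ^+ 2 + 8 * u ^+ 2 - (a i x + 2 * u) ^+ 2 by ring.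
  lra.
move/(ler_wpM2l (sqr_ge0 (z i x))) => h'.
have -> : 8 * (z i x ^+ 2 * a i x ^+ 2) + 32 * dl ^+ 2 * (z i x ^+ 2 * v ^+ 2) =
   4 * (z i x ^+ 2 * (2 * a i x ^+ 2 + 8 * (dl ^+ 2 * v ^+ 2))) by ring.
by rewrite ler_wpM2l.
Qed.

Lemma ue_quad : EX (fun x => tilt x * quad x ^+ 2) <= 64 * quad_moment.
Proof.
pose g i x := 2 * \sum_(j | (rk j < rk i)%N) c i j x * xi j x.
have -> : EX (fun x => tilt x * quad x ^+ 2) = \sum_i EX (fun x => tilt x * (xi i x * g i x) ^+ 2).
  rewrite -(orthogonal_increments centred xi_inv (g := g)) // => i j ji x xS.
  rewrite /g; congr (2 * _); apply: eq_bigr => l lj.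
  rewrite c_inv // xi_inv //; apply: contraTneq (leq_trans lj ji) => ->.
  by rewrite ltnn.
have h i : EX (fun x => tilt x * (xi i x * g i x) ^+ 2)
   <= 64 * EX (fun x => \sum_j c i j x ^+ 2 * z i x ^+ 2 * z j x ^+ 2).
  rewrite (@eq_ue _ _ _ _ (fun x => tilt x * (xi i x ^+ 2 * g i x ^+ 2))); last first.
    by move=> x _; rewrite exprMn.
  apply: le_trans (ue_xi2 i _) _; first by move=> x; apply: sqr_ge0.
  pose gg j x := if (rk j < rk i)%N then 2 * (z i x ^+ 2 * c i j x) else 0.
  rewrite (@eq_ue _ _ _ _ (fun x => tilt x * (\sum_j xi j x * gg j x) ^+ 2)); last first.
    move=> x _; congr (_ * _); rewrite -{1}z4 -expr2 -exprMn /g mulr_sumr mulr_sumr big_mkcond; congr (_ ^+ 2).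
    by apply: eq_bigr => j _; rewrite /gg; case: ifP => _; ring.
  rewrite (orthogonal_increments centred xi_inv); last first.
    move=> l j _ x xS; rewrite /gg; case: ifP => // _.
    by rewrite z2_inv // c_inv.
  rewrite ue_sum !mulr_sumr; apply: ler_sum => j _.
  have p0 : 0 <= EX (fun x => c i j x ^+ 2 * z i x ^+ 2 * z j x ^+ 2).
    by apply: ue_ge0 => x _; rewrite -!exprMn sqr_ge0.
  rewrite /gg; case: (rk j < rk i)%N; last first.
    rewrite (@eq_ue _ _ _ _ (fun=> 0)) ?ue_cst //; last by move=> x _; rewrite mulr0 expr0n mulr0.
    rewrite mulr0 mulr_ge0 //.
  rewrite (@eq_ue _ _ _ _ (fun x => tilt x * (xi j x ^+ 2 * (2 * (z i x ^+ 2 * c i j x)) ^+ 2))); last first.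
    by move=> x _; rewrite exprMn.
  have h1 := @ue_xi2 j (fun x => (2 * (z i x ^+ 2 * c i j x)) ^+ 2) (fun x => sqr_ge0 _).
  have h2 : EX (fun x => tilt x * (z j x ^+ 2 * (2 * (z i x ^+ 2 * c i j x)) ^+ 2))
      = 4 * EX (fun x => c i j x ^+ 2 * z i x ^+ 2 * z j x ^+ 2).
    rewrite -ueZ ue_tilt; last by move=> l x xS; rewrite !z2_inv // c_inv.
    apply: eq_ue => x _; transitivity (4 * (c i j x ^+ 2 * (z i x ^+ 2 * z i x ^+ 2) * z j x ^+ 2)).
      by ring.
    by rewrite z4.
  by move: h1; rewrite h2 /=; lra.
apply: (le_trans (ler_sum _ (fun i _ => h i))).
by rewrite -mulr_sumr -ue_sum.
Qed.

Let mean_quad_le x : `|mean_quad x| <= dl ^+ 2 * \sum_i \sum_j `|c i j x| * z i x ^+ 2 * z j x ^+ 2.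
Proof.
rewrite mulr_sumr; apply: (le_trans (ler_norm_sum _ _ _)); apply: ler_sum => i _.
rewrite mulr_sumr; apply: (le_trans (ler_norm_sum _ _ _)); apply: ler_sum => j _.
have -> : dl ^+ 2 * (`|c i j x| * z i x ^+ 2 * z j x ^+ 2)
  = `|c i j x| * ((dl * z i x ^+ 2) * (dl * z j x ^+ 2)) by ring.
apply: (@le_trans _ _ (`|c i j x| * (`|eta i x| * `|eta j x|))).
  by rewrite -!normrM mulrA.
by apply: ler_wpM2l => //; apply: ler_pM => //; apply: eta_le.
Qed.

(** Bounding the tail from below by changing the measure: under the tilted
    measure the event is likely, and the second moment of the density is the
    price. *)
Lemma tilted_lower_tail (F : T -> R) (f0 b l : R) (K : R) :
  (forall x, x \in S -> F x = F0 x + \sum_i z i x * a i x + \sum_i \sum_j c i j x * z i x * z j x) ->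
  (forall x, x \in S -> \sum_i z i x ^+ 2 <= K) ->
  0 < b -> 4 * b <= dl * l ->
  EX (fun x => (l <= tilt_drift x)%R%:R)
   - (EX (fun x => Num.max (F0 x - f0) 0) / b + 2 * dl ^+ 2 * shift_moment / b
      + 4 * (8 * lin_moment + 32 * dl ^+ 2 * cross_moment) / b ^+ 2 + 4 * (64 * quad_moment) / b ^+ 2)
  <= EX (fun x => tilt x * (F x - f0 < - b)%R%:R).
Proof.
move=> FE zK b0 bl.
have d0 : 0 <= dl by case/andP: dl01.
have drift_inv : inv_all (fun x => (l <= tilt_drift x)%R%:R : R).
  move=> i x xS /=; suff -> : tilt_drift (s i x) = tilt_drift x by [].
  by apply: eq_bigr => j _; rewrite z2_inv // a_inv.
have pos_inv : inv_all (fun x => Num.max (F0 x - f0) 0) by move=> i x xS; rewrite F0_inv.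
have mq_inv : inv_all (fun x => \sum_i \sum_j `|c i j x| * z i x ^+ 2 * z j x ^+ 2).
  by move=> k x xS; apply: eq_bigr => i _; apply: eq_bigr => j _; rewrite c_inv // !z2_inv.
have b2 : 0 < b ^+ 2 by rewrite exprn_gt0.
rewrite -(ue_tilt drift_inv) -(ue_tilt pos_inv) /shift_moment -(ue_tilt mq_inv).
have hl := ue_lin; have hq := ue_quad.
pose ub x := tilt x * (l <= tilt_drift x)%R%:R
   - (b^-1 * (tilt x * Num.max (F0 x - f0) 0)
   + 2 * dl ^+ 2 / b * (tilt x * \sum_i \sum_j `|c i j x| * z i x ^+ 2 * z j x ^+ 2)
   + 4 / b ^+ 2 * (tilt x * lin x ^+ 2) + 4 / b ^+ 2 * (tilt x * quad x ^+ 2)).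
apply: (@le_trans _ _ (EX ub)).
  rewrite /ub ueB !ueD !ueZ lerD2l lerN2.
  have ib : 0 <= 4 / b ^+ 2 by rewrite divr_ge0 // ltW.
  have := ler_wpM2l ib hl; have := ler_wpM2l ib hq.
  set A1 := EX (fun x => tilt x * Num.max _ _).
  set A2 := EX (fun x => tilt x * \sum_i _).
  set A3 := EX _; set A4 := EX _; move=> h1 h2.
  have -> : b^-1 * A1 = A1 / b by rewrite mulrC.
  have -> : 2 * dl ^+ 2 / b * A2 = 2 * dl ^+ 2 * A2 / b by rewrite mulrAC.
  rewrite -!addrA !lerD2l; apply: lerD; by rewrite [4 * _ / _]mulrAC.
apply: ue_le => x xS; rewrite /ub.
have -> : tilt x * (l <= tilt_drift x)%R%:R
   - (b^-1 * (tilt x * Num.max (F0 x - f0) 0)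
   + 2 * dl ^+ 2 / b * (tilt x * \sum_i \sum_j `|c i j x| * z i x ^+ 2 * z j x ^+ 2)
   + 4 / b ^+ 2 * (tilt x * lin x ^+ 2) + 4 / b ^+ 2 * (tilt x * quad x ^+ 2))
  = tilt x * ((l <= tilt_drift x)%R%:R - (Num.max (F0 x - f0) 0 / b
    + 2 * (dl ^+ 2 * \sum_i \sum_j `|c i j x| * z i x ^+ 2 * z j x ^+ 2) / b
    + 4 * (lin x ^+ 2 / b ^+ 2) + 4 * (quad x ^+ 2 / b ^+ 2))) by ring.
apply: ler_wpM2l; first exact: tilt_ge0.
set M := dl ^+ 2 * _; set mx := Num.max _ _.
have M0 : 0 <= M.
  rewrite /M mulr_ge0 ?sqr_ge0 // sumr_ge0 // => i _; rewrite sumr_ge0 // => j _.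
  exact: mulr_ge0 (mulr_ge0 (normr_ge0 _) (sqr_ge0 _)) (sqr_ge0 _).
have mx0 : 0 <= mx by rewrite /mx le_max lexx orbT.
have q1 : 0 <= mx / b by rewrite divr_ge0 // ltW.
have q2 : 0 <= M / b by rewrite divr_ge0 // ltW.
have q3 : 0 <= lin x ^+ 2 / b ^+ 2 by rewrite divr_ge0 ?sqr_ge0.
have q4 : 0 <= quad x ^+ 2 / b ^+ 2 by rewrite divr_ge0 ?sqr_ge0.
have qM : 2 * M / b = 2 * (M / b) by rewrite mulrA.
have suff1 D : D <= 1 -> D - (mx / b + 2 * (M / b) + 4 * (lin x ^+ 2 / b ^+ 2) + 4 * (quad x ^+ 2 / b ^+ 2)) <= 1.
  by move: q1 q2 q3 q4; lra.
rewrite qM.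
have [hF|hF] := ltrP (F x - f0) (- b).
  by rewrite mulr1n; apply: suff1; rewrite lern1 leq_b1.
have [hd|hd] := lerP l (tilt_drift x); last first.
  by rewrite !mulr0n sub0r oppr_le0; move: q1 q2 q3 q4; lra.
(* The tilt gains at least [4 b]. If [F] does not drop by [b], the four errors
   have sum at least [3 b], so one of them exceeds its share [b], [b/2], [b/2],
   [b/2]. *)
suff : 1 <= mx / b + 2 * (M / b) + 4 * (lin x ^+ 2 / b ^+ 2) + 4 * (quad x ^+ 2 / b ^+ 2).
  by rewrite mulr1n mulr0n subr_le0.
have mxF : F0 x - f0 <= mx by rewrite /mx le_max lexx.
have dd : 4 * b <= dl * tilt_drift x by apply: (le_trans bl); rewrite ler_wpM2l.
have Fx := FE x xS; rewrite tilt_decomposition in Fx.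
have mqM : mean_quad x <= M by apply: le_trans (ler_norm _) (mean_quad_le x).
have sq v : v <= b / 2 \/ 1 <= 4 * (v ^+ 2 / b ^+ 2).
  have [h|h] := lerP v (b / 2); [by left|right].
  rewrite mulrA ler_pdivlMr // mul1r.
  have : (b / 2) ^+ 2 <= v ^+ 2 by apply: lerXn2r; rewrite ?nnegrE; lra.
  have -> : (b / 2) ^+ 2 = b ^+ 2 / 4 by field.
  lra.
have [h1|h1] := lerP b mx.
  have : 1 <= mx / b by rewrite ler_pdivlMr // mul1r.
  lra.
have [h2|h2] := lerP (b / 2) M.
  have : 1 / 2 <= M / b by rewrite ler_pdivlMr //; lra.
  lra.
case: (sq (lin x)) => h3; last lra.
case: (sq (quad x)) => h4; last lra.
lra.
Qed.

End Tilting.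

(** * Exchanging two elements of a uniform set *)

Section Swaps.
Variables (R : realType) (T : finType).
Implicit Types (E P : {set T}).

Definition swap (e f : T) E : {set T} := [set tperm e f x | x in E].

Lemma mem_swap e f E g : (g \in swap e f E) = (tperm e f g \in E).
Proof.
apply/imsetP/idP => [[x xE ->]|gE]; first by rewrite tpermK.
by exists (tperm e f g); rewrite ?tpermK.
Qed.

Lemma bit_swap e f E g : bit (swap e f E) g = bit E (tperm e f g) :> R.
Proof. by rewrite /bit mem_swap. Qed.

Lemma swapK e f : involutive (swap e f).
Proof. by move=> E; apply/setP => g; rewrite !mem_swap tpermK. Qed.

Lemma swap_draws P m e f E : e \in P -> f \in P -> E \in draws P m -> swap e f E \in draws P m.
Proof.
move=> eP fP; rewrite !inE => /andP[/subsetP sE cE].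
rewrite card_imset ?cE ?andbT; last exact: perm_inj.
apply/subsetP => g; rewrite mem_swap; case: tpermP => [->|->|_ _] // /sE //.
Qed.

End Swaps.

Lemma binomial_pattern_shifted r L : (1 <= r)%N -> (2 * r.+3 <= L.+1.+4)%N ->
  (r.+3 ^ 3 * 'C(L.+1.+4, r.+3) <= 32 * L.+1.+4 ^ 3 * 'C(L, r))%N.
Proof.
move=> r1 Lr.
have e1 := mul_bin_diag L.+1.+4 r.+2.
have e2 := mul_bin_diag L.+4 r.+1.
have e3 := mul_bin_diag L.+3 r.
have e4 := mul_bin_down L.+2 r.
have e5 := mul_bin_down L.+1 r.
rewrite /= in e1 e2 e3 e4 e5.
move: e1 e2 e3 e4 e5.
set C0 := 'C(L.+1.+4, r.+3); set C1 := 'C(L.+4, r.+2); set C2 := 'C(L.+3, r.+1).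
set C3 := 'C(L.+2, r); set C4 := 'C(L.+1, r); set C5 := 'C(L, r) => e1 e2 e3 e4 e5.
set M' := L.+1.+4.
have f1 : (r.+3 * C0 <= M' * C1)%N by rewrite /M' e1.
have f2 : (r.+3 * C1 <= 2 * M' * C2)%N.
  apply: (@leq_trans (2 * (r.+2 * C1))); first by rewrite mulnA leq_mul2r; apply/orP; right; lia.
  by rewrite -e2 mulnA leq_mul2r; apply/orP; right; rewrite /M'; lia.
have f3 : (r.+3 * C2 <= 2 * M' * C3)%N.
  apply: (@leq_trans (2 * (r.+1 * C2))); first by rewrite mulnA leq_mul2r; apply/orP; right; lia.
  by rewrite -e3 mulnA leq_mul2r; apply/orP; right; rewrite /M'; lia.
have f4 : (C3 <= 2 * C4)%N.
  rewrite -(leq_pmul2l (ltn0Sn L.+1)) mulnCA e4 mulnA leq_mul2r; apply/orP; right; lia.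
have f5 : (C4 <= 4 * C5)%N.
  rewrite -(leq_pmul2l (ltn0Sn L)) mulnCA e5 mulnA leq_mul2r; apply/orP; right; lia.
clearbody M' C0 C1 C2 C3 C4 C5.
apply: (@leq_trans (r.+3 ^ 2 * (M' * C1))); first by rewrite expnSr -mulnA leq_mul2l f1 orbT.
apply: (@leq_trans (r.+3 * (M' * (2 * M' * C2)))%N).
  rewrite -[(r.+3 ^ 2)%N]/(r.+3 * r.+3)%N -mulnA leq_mul2l; apply/orP; right.
  by rewrite mulnCA leq_mul2l f2 orbT.
apply: (@leq_trans (2 * M' ^ 2 * (2 * M' * C3))%N).
  have -> : (r.+3 * (M' * (2 * M' * C2)) = 2 * M' ^ 2 * (r.+3 * C2))%N by ring.
  by rewrite leq_mul2l f3 orbT.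
have -> : (2 * M' ^ 2 * (2 * M' * C3) = 4 * M' ^ 3 * C3)%N by ring.
have -> : (32 * M' ^ 3 * C5 = 4 * M' ^ 3 * (8 * C5))%N by ring.
by rewrite leq_mul2l; apply/orP; right; lia.
Qed.

Lemma binomial_pattern M m : (4 <= m)%N -> (2 * m <= M)%N ->
  (m ^ 3 * 'C(M, m) <= 32 * M ^ 3 * 'C(M - 5, m - 3))%N.
Proof.
move=> m4 Mm; have := @binomial_pattern_shifted (m - 3) (M - 5).
have -> : (m - 3).+3 = m by lia.
have -> : (M - 5).+1.+4 = M by lia.
by apply; lia.
Qed.

Section BlockMoments.
Variables (R : realType) (T : finType) (P : {set T}) (m : nat).
Hypothesis mM : (m <= #|P|)%N.
Notation EX := (unif_expect (R := R) (draws P m)).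
Notation t := (m%:R / #|P|%:R : R).

(** Expanding the product block by block and moving the chosen edge to
    [acc] reduces the claim to [ue_bits_le]; disjointness of the blocks keeps
    the chosen edges distinct. *)
Lemma ue_blocks_acc (acc : seq T) (bs : seq (seq T)) :
  uniq acc -> {subset acc <= P} -> all (all (mem P)) bs ->
  all (fun b => all (fun e => e \notin acc) b) bs ->
  pairwise (fun b b' : seq T => all (fun e => e \notin b') b) bs ->
  EX (fun E => (\prod_(e <- acc) bit E e) * \prod_(b <- bs) \sum_(e <- b) bit E e)
  <= t ^+ size acc * \prod_(b <- bs) ((size b)%:R * t).
Proof.
have t0 : 0 <= t by rewrite divr_ge0.
elim: bs acc => [|b bs IH] acc ua aP /=.
  move=> _ _ _; rewrite big_nil mulr1.
  rewrite (@eq_ue _ _ _ _ (fun E : {set T} => \prod_(e <- acc) bit E e)); last first.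
    by move=> E _; rewrite big_nil mulr1.
  exact: ue_bits_le.
move=> /andP[bP bsP] /andP[ba bsa] /andP[bb bsbs].
rewrite (@eq_ue _ _ _ _ (fun E => \sum_(e <- b) (\prod_(e' <- e :: acc) bit E e') *
     \prod_(b <- bs) \sum_(e <- b) bit E e)); last first.
  move=> E _; rewrite big_cons mulrCA mulr_suml; apply: eq_bigr => e _.
  by rewrite big_cons mulrA.
rewrite ue_sum big_cons.
have -> : t ^+ size acc * ((size b)%:R * t * \prod_(j <- bs) ((size j)%:R * t))
  = \sum_(e <- b) t ^+ (size acc).+1 * \prod_(j <- bs) ((size j)%:R * t).
  rewrite big_const_seq count_predT iter_addr addr0 -[RHS]mulr_natl exprS; ring.
rewrite big_seq [leRHS]big_seq; apply: ler_sum => e eb; apply: (IH (e :: acc)) => //=.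
- by rewrite ua andbT (allP ba).
- by move=> x; rewrite inE => /orP[/eqP ->|/aP //]; apply: (allP bP).
- apply/allP => b' b'bs; apply/allP => x xb'; rewrite inE negb_or (allP (allP bsa b' b'bs) x xb') andbT.
  apply/eqP => xe; have := allP (allP bb b' b'bs) e eb.
  by rewrite -xe xb'.
Qed.

Lemma ue_blocks (bs : seq (seq T)) : all (all (mem P)) bs ->
  pairwise (fun b b' : seq T => all (fun e => e \notin b') b) bs ->
  EX (fun E => \prod_(b <- bs) \sum_(e <- b) bit E e) <= \prod_(b <- bs) ((size b)%:R * t).
Proof.
move=> h1 h2; have := @ue_blocks_acc [::] bs isT _ h1 _ h2; rewrite /= expr0 mul1r.
rewrite (@eq_ue _ _ _ _ (fun E : {set T} => \prod_(b <- bs) \sum_(e <- b) bit E e)); last first.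
  by move=> E _; rewrite big_nil mul1r.
apply => //; apply/allP => b _; exact/allP.
Qed.

(** At density at most one half the absent edges only cost a constant
    factor. *)
Lemma ue_pattern_ge (J L : {set T}) : (4 <= m)%N -> (2 * m <= #|P|)%N ->
  J \subset P -> L \subset P -> [disjoint J & L] -> #|J| = 3%N -> #|L| = 2%N ->
  t ^+ 3 / 32 <= EX (pattern R J L).
Proof.
move=> m4 Mm JP LP JL cJ cL; rewrite ue_pattern ?cJ ?cL //; last by apply: leq_trans m4.
have M0 : (0 < #|P|)%N by apply: leq_trans Mm; rewrite muln_gt0 (leq_trans _ m4).
have := binomial_pattern m4 Mm; rewrite -(ler_nat R) natrM natrX [leRHS]natrM [(32 * _)%:R]natrM natrX => h.
rewrite ler_pdivlMr ?ltr0n ?bin_gt0 // expr_div_n.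
have Mr : 0 < #|P|%:R :> R by rewrite ltr0n.
set C0 := 'C(#|P|, m)%:R in h *; set C5 := 'C(_, _)%:R in h *.
move: (#|P|%:R) Mr h => x x0 h.
have -> : m%:R ^+ 3 / x ^+ 3 / 32 * C0 = m%:R ^+ 3 * C0 / (32 * x ^+ 3).
  by field; rewrite gt_eqF.
by rewrite ler_pdivrMr ?mulr_gt0 ?exprn_gt0 // mulrC [C5 * _]mulrC mulrC.
Qed.

End BlockMoments.

(** * Even and odd parts of the adjacency matrix *)

Section CubicExpansion.
Variables (R : realType) (n : nat).
Implicit Types (f g h : nat -> nat -> R).

Definition trace3 f g h := \sum_(i < n) \sum_(j < n) \sum_(l < n) f i j * g j l * h i l.

Definition symmetric f := forall i j, f i j = f j i.

Lemma trace3_swap12 f g h : symmetric f -> symmetric g -> symmetric h -> trace3 f g h = trace3 g f h.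
Proof.
move=> fs gs hs; rewrite /trace3.
under eq_bigr => i _ do rewrite exchange_big /=.
rewrite exchange_big /=; apply: eq_bigr => l _; rewrite exchange_big /=; apply: eq_bigr => j _.
apply: eq_bigr => i _; rewrite (fs i j) (gs j l) (hs i l); ring.
Qed.

Lemma trace3_swap13 f g h : symmetric f -> symmetric g -> symmetric h -> trace3 f g h = trace3 h g f.
Proof.
move=> fs gs hs; rewrite /trace3; apply: eq_bigr => i _; rewrite exchange_big /=.
by apply: eq_bigr => l _; apply: eq_bigr => j _; rewrite (gs j l); ring.
Qed.

(** The term of degree three in [g] drops out because no triangle has all its
    edges in the support of [g]. *)
Lemma trace3_expand f g : symmetric f -> symmetric g ->
  (forall i j l, g i j * g j l * g i l = 0) ->
  trace3 (fun i j => f i j + g i j) (fun i j => f i j + g i j) (fun i j => f i j + g i j)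
  = trace3 f f f + 3 * trace3 f f g + 3 * trace3 f g g.
Proof.
move=> fs gs g3.
have -> : 3 * trace3 f f g = trace3 f f g + trace3 f g f + trace3 g f f.
  have -> : trace3 g f f = trace3 f f g by rewrite trace3_swap13.
  have -> : trace3 f g f = trace3 f f g by rewrite trace3_swap12 // trace3_swap13.
  ring.
have -> : 3 * trace3 f g g = trace3 f g g + trace3 g f g + trace3 g g f.
  have -> : trace3 g g f = trace3 f g g by rewrite trace3_swap13.
  have -> : trace3 g f g = trace3 f g g by rewrite trace3_swap12.
  ring.
rewrite /trace3 -!big_split /=; apply: eq_bigr => i _; rewrite -!big_split /=; apply: eq_bigr => j _.
rewrite -!big_split /=; apply: eq_bigr => l _.
rewrite -[RHS]addr0 -[in RHS](g3 i j l); ring.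
Qed.

End CubicExpansion.

Section Slots.
Variables (R : realType) (k q : nat).
Notation n := k.+1.
Hypothesis q4 : (4 * q <= n)%N.
Implicit Types (E : {set {set 'I_n}}) (u v w x j : nat).

(** Vertices below [q] form the class X, and the vertices [fst_end j], [snd_end j]
    are paired. The slot [(x, j)] exchanges the edges from [x] to the two
    members of the pair. *)
Definition fst_end j := (q + j)%N.
Definition snd_end j := (2 * q + j)%N.
Definition in_left u := (u < q)%N.
Definition in_right v := (q <= v < 3 * q)%N.
Definition twin v := if (v < 2 * q)%N then (v + q)%N else (v - q)%N.
Definition slot_swap x j E := swap (edge k x (fst_end j)) (edge k x (snd_end j)) E.

Notation A := (@adjR R k).

(** The adjacency matrix after all the slots have been exchanged at once.
    An entry between the two classes meets one slot only, so averaging over the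
    simultaneous exchange already gives something invariant under each of
    them. *)
Definition flipped E u v : R :=
  if in_left u && in_right v then A E u (twin v)
  else if in_left v && in_right u then A E (twin u) v else A E u v.
Definition evenpart E u v : R := (A E u v + flipped E u v) / 2.
Definition oddpart E u v : R := (A E u v - flipped E u v) / 2.
Definition slotdiff E x j : R := A E x (fst_end j) - A E x (snd_end j).

Lemma left_not_right u : in_left u -> in_right u = false.
Proof. by rewrite /in_left /in_right; lia. Qed.

Lemma flippedC E u v : flipped E u v = flipped E v u.
Proof.
rewrite /flipped; case: (boolP (in_left u)) => hu; case: (boolP (in_left v)) => hv /=;
  rewrite ?(left_not_right hu) ?(left_not_right hv) /=; try exact: adjRC.
- by case: (in_right v) => //; [exact: adjRC|exact: adjRC].
- by case: (in_right u) => //; [exact: adjRC|exact: adjRC].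
Qed.

Lemma evenpartC E : symmetric (evenpart E).
Proof. by move=> u v; rewrite /evenpart flippedC adjRC. Qed.

Lemma oddpartC E : symmetric (oddpart E).
Proof. by move=> u v; rewrite /oddpart flippedC adjRC. Qed.

Lemma oddpart0 E u v : ~~ (in_left u && in_right v) -> ~~ (in_left v && in_right u) -> oddpart E u v = 0.
Proof. by rewrite /oddpart /flipped => /negbTE -> /negbTE ->; rewrite subrr mul0r. Qed.

Lemma evenpart_nonslot E u v : ~~ (in_left u && in_right v) -> ~~ (in_left v && in_right u) -> evenpart E u v = A E u v.
Proof.
rewrite /evenpart /flipped => /negbTE -> /negbTE ->; lra.
Qed.

Lemma evenpart_right E u v : in_right u -> in_right v -> evenpart E u v = A E u v.
Proof.
move=> uY vY; apply: evenpart_nonslot; rewrite negb_and.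
  by case: (boolP (in_left u)) => // /left_not_right; rewrite uY.
by case: (boolP (in_left v)) => // /left_not_right; rewrite vY.
Qed.

Lemma twin_fst_end j : (j < q)%N -> twin (fst_end j) = snd_end j.
Proof. by rewrite /twin /fst_end /snd_end => jq; case: ifP; lia. Qed.

Lemma twin_snd_end j : (j < q)%N -> twin (snd_end j) = fst_end j.
Proof. by rewrite /twin /fst_end /snd_end => jq; case: ifP; lia. Qed.

Lemma in_right_fst_end j : (j < q)%N -> in_right (fst_end j).
Proof. by rewrite /in_right /fst_end; lia. Qed.
Lemma in_right_snd_end j : (j < q)%N -> in_right (snd_end j).
Proof. by rewrite /in_right /snd_end; lia. Qed.

Lemma oddpart_fst_end E x j : (x < q)%N -> (j < q)%N -> oddpart E x (fst_end j) = slotdiff E x j / 2.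
Proof.
by move=> xq jq; rewrite /oddpart /flipped /in_left xq in_right_fst_end //= twin_fst_end.
Qed.

Lemma oddpart_snd_end E x j : (x < q)%N -> (j < q)%N -> oddpart E x (snd_end j) = - slotdiff E x j / 2.
Proof.
by move=> xq jq; rewrite /oddpart /flipped /in_left xq in_right_snd_end //= twin_snd_end // opprB.
Qed.

Lemma sum_classes (f : nat -> R) :
  \sum_(v < n) f v = \sum_(x < q) f x + \sum_(j < q) (f (fst_end j) + f (snd_end j))
    + \sum_(w < n - 3 * q) f (3 * q + w)%N.
Proof.
rewrite -(big_mkord xpredT f) (@big_cat_nat _ _ _ q) /=; try lia.
rewrite (@big_cat_nat _ _ _ (2 * q) q) /=; try lia.
rewrite (@big_cat_nat _ _ _ (3 * q) (2 * q)) /=; try lia.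
have sh a b : (a <= b)%N -> \sum_(a <= i < b) f i = \sum_(i < b - a) f (a + i)%N.
  move=> ab; rewrite -{1}[a]add0n big_addn big_mkord; apply: eq_bigr => i _; by rewrite addnC.
rewrite big_mkord !sh; try lia.
have -> : (2 * q - q = q)%N by lia.
have -> : (3 * q - 2 * q = q)%N by lia.
by rewrite big_split /= !addrA.
Qed.

Definition common E u v := \sum_(l < n) evenpart E u l * evenpart E v l.
Definition slotcoef E x j : R := 3 * (common E x (fst_end j) - common E x (snd_end j)).
Definition pairdiff E j j' : R := A E (fst_end j) (fst_end j') - A E (fst_end j) (snd_end j')
  - A E (snd_end j) (fst_end j') + A E (snd_end j) (snd_end j').

Lemma trace3_linear E : trace3 n (evenpart E) (evenpart E) (oddpart E) =
  \sum_(x < q) \sum_(j < q) slotdiff E x j * (common E x (fst_end j) - common E x (snd_end j)).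
Proof.
have -> : trace3 n (evenpart E) (evenpart E) (oddpart E) =
    \sum_(i < n) \sum_(l < n) oddpart E i l * common E i l.
  apply: eq_bigr => i _; rewrite exchange_big /=; apply: eq_bigr => l _.
  by rewrite /common mulr_sumr; apply: eq_bigr => j _; rewrite (evenpartC E j l); ring.
have comC u v : common E u v = common E v u by apply: eq_bigr => l _; rewrite mulrC.
pose r x j := oddpart E x j * common E x j.
have rC x j : r x j = r j x by rewrite /r oddpartC comC.
have row x : (x < q)%N -> \sum_(l < n) r x l = \sum_(j < q) (r x (fst_end j) + r x (snd_end j)).
  move=> xq; rewrite (sum_classes (r x)) [X in X + _ + _]big1 => [|l _]; last first.
    by rewrite /r oddpart0 ?mul0r // /in_left /in_right; have := ltn_ord l; lia.
  rewrite [X in _ + X]big1 ?add0r ?addr0 // => w _.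
  by rewrite /r oddpart0 ?mul0r // /in_left /in_right; lia.
have col v : in_right v -> \sum_(l < n) r v l = \sum_(x < q) r x v.
  move=> vY; rewrite (sum_classes (r v)) [X in _ + X + _]big1 => [|j _]; last first.
    by rewrite /r !oddpart0 ?mul0r ?addr0 // /in_left; move: vY; rewrite /in_right /fst_end /snd_end; have := ltn_ord j; lia.
  rewrite [X in _ + X]big1 ?addr0 => [|w _]; last first.
    by rewrite /r oddpart0 ?mul0r // /in_left /in_right; move: vY; rewrite /in_right; lia.
  by apply: eq_bigr => x _; rewrite rC.
rewrite -/(\sum_(i < n) \sum_(l < n) r i l) (sum_classes (fun i => \sum_(l < n) r i l)).
rewrite [X in _ + X]big1 ?addr0 => [|w _]; last first.
  by apply: big1 => l _; rewrite /r oddpart0 ?mul0r // /in_left /in_right; lia.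
have -> : \sum_(j < q) (\sum_(l < n) r (fst_end j) l + \sum_(l < n) r (snd_end j) l)
   = \sum_(x < q) \sum_(j < q) (r x (fst_end j) + r x (snd_end j)).
  rewrite exchange_big /=; apply: eq_bigr => j _.
  by rewrite !col ?in_right_fst_end ?in_right_snd_end // -big_split.
rewrite -big_split /=; apply: eq_bigr => x _; rewrite row // -big_split /=; apply: eq_bigr => j _.
by rewrite /r oddpart_fst_end // oddpart_snd_end //; field.
Qed.

Lemma trace3_quadratic E : trace3 n (evenpart E) (oddpart E) (oddpart E) =
  \sum_(x < q) \sum_(j < q) \sum_(j' < q) pairdiff E j j' / 4 * slotdiff E x j * slotdiff E x j'
  + \sum_(j < q) \sum_(x < q) \sum_(x' < q) A E x x' / 2 * slotdiff E x j * slotdiff E x' j.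
Proof.
pose s l := \sum_(i < n) \sum_(j < n) evenpart E i j * oddpart E i l * oddpart E j l.
have -> : trace3 n (evenpart E) (oddpart E) (oddpart E) = \sum_(l < n) s l.
  rewrite /trace3; under eq_bigr => i _ do rewrite exchange_big /=.
  rewrite exchange_big /=; apply: eq_bigr => l _; apply: eq_bigr => i _; apply: eq_bigr => j _.
  by ring.
have sX x : (x < q)%N -> s x = \sum_(j < q) \sum_(j' < q) pairdiff E j j' / 4 * slotdiff E x j * slotdiff E x j'.
  move=> xq; rewrite /s.
  pose g i := \sum_(j < n) evenpart E i j * oddpart E i x * oddpart E j x.
  have zX l : (l < q)%N -> oddpart E l x = 0.
    by move=> lq; apply: oddpart0; rewrite /in_left /in_right; lia.
  have zW w : oddpart E (3 * q + w) x = 0 by apply: oddpart0; rewrite /in_left /in_right; lia.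
  have gE i : in_right i -> g i = \sum_(j' < q) (A E i (fst_end j') - A E i (snd_end j')) / 2
       * oddpart E i x * slotdiff E x j'.
    move=> iY; rewrite /g (sum_classes (fun j => evenpart E i j * oddpart E i x * oddpart E j x)).
    rewrite [X in X + _ + _]big1 => [|l _]; last by rewrite (zX l) ?mulr0.
    rewrite [X in _ + X]big1 ?add0r ?addr0 => [|w _]; last by rewrite zW mulr0.
    apply: eq_bigr => j' _; rewrite ![oddpart E _ x]oddpartC oddpart_fst_end // oddpart_snd_end //.
    rewrite !evenpart_right ?in_right_fst_end ?in_right_snd_end //; ring.
  rewrite -/(\sum_(i < n) g i) (sum_classes g) [X in X + _ + _]big1 => [|l _]; last first.
    by rewrite /g big1 // => j _; rewrite (zX l) ?mulr0 ?mul0r.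
  rewrite [X in _ + X]big1 ?add0r ?addr0 => [|w _]; last first.
    by rewrite /g big1 // => j _; rewrite zW mulr0 mul0r.
  apply: eq_bigr => j _; rewrite !gE ?in_right_fst_end ?in_right_snd_end // -big_split /=; apply: eq_bigr => j' _.
  by rewrite ![oddpart E _ x]oddpartC oddpart_fst_end // oddpart_snd_end // /pairdiff; field.
have sY v jj (sg : R) : sg ^+ 2 = 1 -> in_right v -> (forall x, (x < q)%N -> oddpart E x v = sg * slotdiff E x jj / 2) ->
    s v = \sum_(x < q) \sum_(x' < q) A E x x' / 4 * slotdiff E x jj * slotdiff E x' jj.
  move=> sg2 vY hv; rewrite /s.
  have zY u : in_right u -> oddpart E u v = 0.
    by move=> uY; apply: oddpart0; rewrite /in_left; move: uY vY; rewrite /in_right; lia.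
  have zW w : oddpart E (3 * q + w) v = 0 by apply: oddpart0; rewrite /in_left; move: vY; rewrite /in_right; lia.
  pose g i := \sum_(j < n) evenpart E i j * oddpart E i v * oddpart E j v.
  rewrite -/(\sum_(i < n) g i) (sum_classes g) [X in _ + X + _]big1 => [|l _]; last first.
    rewrite /g !big1 ?addr0 // => i _.
      by rewrite (zY (snd_end l)) ?in_right_snd_end // mulr0 mul0r.
    by rewrite (zY (fst_end l)) ?in_right_fst_end // mulr0 mul0r.
  rewrite [X in _ + X]big1 ?addr0 => [|w _]; last first.
    by rewrite /g big1 // => i _; rewrite zW mulr0 mul0r.
  apply: eq_bigr => x _; rewrite /g (sum_classes (fun j => evenpart E x j * oddpart E x v * oddpart E j v)).
  rewrite [X in _ + X + _]big1 => [|l _]; last first.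
    by rewrite (zY (fst_end l)) ?in_right_fst_end // (zY (snd_end l)) ?in_right_snd_end // !mulr0 addr0.
  rewrite [X in _ + X]big1 ?addr0 => [|w _]; last by rewrite zW mulr0.
  apply: eq_bigr => x' _; rewrite !hv // evenpart_nonslot; first last.
  - by rewrite /in_left /in_right; have := ltn_ord x; have := ltn_ord x'; lia.
  - by rewrite /in_left /in_right; have := ltn_ord x; have := ltn_ord x'; lia.
  transitivity (sg ^+ 2 * (A E x x' / 4 * slotdiff E x jj * slotdiff E x' jj)); first by field.
  by rewrite sg2 mul1r.
rewrite (sum_classes s) [X in _ + X]big1 ?addr0 => [|w _]; last first.
  rewrite /s big1 // => i _; rewrite big1 // => j _.
  by rewrite (@oddpart0 _ i) ?mulr0 ?mul0r // /in_left /in_right; lia.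
congr (_ + _); first by apply: eq_bigr => x _; apply: sX.
apply: eq_bigr => j _.
rewrite (sY (fst_end j) j 1) ?expr1n ?in_right_fst_end //; last first.
  by move=> x xq; rewrite oddpart_fst_end // mul1r.
rewrite (sY (snd_end j) j (-1)) ?sqrrN ?expr1n ?in_right_snd_end //; last first.
  by move=> x xq; rewrite oddpart_snd_end // mulN1r.
rewrite -big_split; apply: eq_bigr => x _ /=; rewrite -big_split; apply: eq_bigr => x' _ /=.
by field.
Qed.

End Slots.

(** * The triangle count as a quadratic polynomial in signs *)

Section SlotDecomposition.
Variables (R : realType) (k q m : nat).
Notation n := k.+1.
Hypothesis q4 : (4 * q <= n)%N.
Implicit Types (E : {set {set 'I_n}}) (u v w x j : nat).
Notation A := (@adjR R k).
Notation I := ('I_q * 'I_q)%type.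
Notation first := (fst_end q).
Notation second := (snd_end q).
Notation isX := (in_left q).
Notation isY := (in_right q).
Notation partner := (twin q).
Notation evenpart := (@evenpart R k q).
Notation oddpart := (@oddpart R k q).
Notation slotdiff := (@slotdiff R k q).
Notation pairdiff := (@pairdiff R k q).
Notation slotcoef := (@slotcoef R k q).
Notation slot_swap := (@slot_swap k q).

Definition same_edge u v a b := ((u == a) && (v == b)) || ((u == b) && (v == a)).

Lemma edge_neq u v a b : (u < n)%N -> (v < n)%N -> (a < n)%N -> (b < n)%N ->
  ~~ same_edge u v a b -> edge k u v != edge k a b.
Proof.
move=> un vn an bn; apply: contra => /eqP /(edge_eq un vn an bn).
by rewrite /same_edge => [[[-> ->]|[-> ->]]]; rewrite !eqxx ?orbT.
Qed.

Definition slot_sign (i : I) E : R := slotdiff E i.1 i.2.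
Definition slot_linear (i : I) E : R := slotcoef E i.1 i.2.
Definition slot_quadratic (i i' : I) E : R :=
  if i.1 == i'.1 then (if i.2 == i'.2 then 0 else 3 / 4 * pairdiff E i.2 i'.2)
  else if i.2 == i'.2 then 3 / 2 * A E i.1 i'.1 else 0.
Definition even_count E : R := trace3 n (evenpart E) (evenpart E) (evenpart E)
  + \sum_(x < q) \sum_(j < q) 3 / 4 * pairdiff E j j * slotdiff E x j ^+ 2.
Definition slot_involution (i : I) E := slot_swap i.1 i.2 E.

Lemma adjRE E u v : A E u v = evenpart E u v + oddpart E u v.
Proof. by rewrite /evenpart /oddpart; lra. Qed.

(** The support of the odd part is bipartite. *)
Lemma oddpart_triangle E u v w : oddpart E u v * oddpart E v w * oddpart E u w = 0.
Proof.
case: (boolP ((isX u && isY v) || (isX v && isY u))) => [h1|]; last first.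
  by rewrite negb_or => /andP[h1 h2]; rewrite oddpart0 // !mul0r.
case: (boolP ((isX v && isY w) || (isX w && isY v))) => [h2|]; last first.
  by rewrite negb_or => /andP[h2 h3]; rewrite (@oddpart0 _ _ _ _ v w) // mulr0 mul0r.
rewrite (@oddpart0 _ _ _ _ u w) ?mulr0 //.
all: by move: h1 h2; rewrite /in_left /in_right; lia.
Qed.

(** Expand the cube of [A = evenpart + oddpart]. The diagonal quadratic terms
    contain squares of the signs and are therefore invariant; they are part of
    [even_count]. *)
Lemma slot_decomposition E : E \subset pairs k ->
  (triangle_count E)%:R = even_count E + \sum_i slot_sign i E * slot_linear i E + \sum_i \sum_i' slot_quadratic i i' E * slot_sign i E * slot_sign i' E.
Proof.
move=> sE; rewrite (triangle_count_sum R sE).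
have -> : \sum_(i < n) \sum_(j < n) \sum_(l < n) A E i j * A E j l * A E i l =
   trace3 n (fun i j => evenpart E i j + oddpart E i j) (fun i j => evenpart E i j + oddpart E i j)
     (fun i j => evenpart E i j + oddpart E i j).
  by apply: eq_bigr => i _; apply: eq_bigr => j _; apply: eq_bigr => l _; rewrite -!adjRE.
rewrite trace3_expand; first last.
- exact: oddpart_triangle.
- exact: oddpartC.
- exact: evenpartC.
rewrite trace3_linear // trace3_quadratic // /even_count -!addrA; congr (_ + _).
have -> : \sum_i slot_sign i E * slot_linear i E = 3 * \sum_(x < q) \sum_(j < q)
    slotdiff E x j * (common R q E x (first j) - common R q E x (second j)).
  rewrite -(pair_bigA _ (fun x j : 'I_q => slot_sign (x, j) E * slot_linear (x, j) E)) /= mulr_sumr.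
  apply: eq_bigr => x _; rewrite mulr_sumr; apply: eq_bigr => j _.
  by rewrite /slot_sign /slot_linear /slotcoef /=; ring.
rewrite [RHS]addrCA; congr (_ + _).
have -> : \sum_i \sum_i' slot_quadratic i i' E * slot_sign i E * slot_sign i' E =
    \sum_(x < q) \sum_(j < q) (\sum_(j' < q | j' != j) 3 / 4 * pairdiff E j j' * slotdiff E x j * slotdiff E x j'
     + \sum_(x' < q) 3 / 2 * A E x x' * slotdiff E x j * slotdiff E x' j).
  rewrite -(pair_bigA _ (fun x j : 'I_q => \sum_i' slot_quadratic (x, j) i' E * slot_sign (x, j) E * slot_sign i' E)) /=.
  apply: eq_bigr => x _; apply: eq_bigr => j _.
  rewrite -(pair_bigA _ (fun x' j' : 'I_q => slot_quadratic (x, j) (x', j') E * slot_sign (x, j) E * slot_sign (x', j') E)) /=.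
  rewrite (bigD1 x) //=; congr (_ + _).
    rewrite [RHS]big_mkcond; apply: eq_bigr => j' _; rewrite /slot_quadratic /= eqxx eq_sym.
    by case: (j' == j); rewrite /= ?mul0r.
  rewrite [RHS](bigD1 x) //= adjR_diag // mulr0 !mul0r add0r; apply: eq_bigr => x' xx.
  rewrite (bigD1 j) //= big1 ?addr0 => [|j' jj]; rewrite /slot_quadratic /= eq_sym (negbTE xx).
    by rewrite eqxx.
  by rewrite eq_sym (negbTE jj) !mul0r.
rewrite mulrDr.
have -> : 3 * (\sum_(x < q) \sum_(j < q) \sum_(j' < q) pairdiff E j j' / 4 * slotdiff E x j * slotdiff E x j')
  = \sum_(x < q) \sum_(j < q) (3 / 4 * pairdiff E j j * slotdiff E x j ^+ 2
    + \sum_(j' < q | j' != j) 3 / 4 * pairdiff E j j' * slotdiff E x j * slotdiff E x j').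
  rewrite mulr_sumr; apply: eq_bigr => x _; rewrite mulr_sumr; apply: eq_bigr => j _.
  rewrite mulr_sumr (bigD1 j) //=; congr (_ + _); first by field.
  by apply: eq_bigr => j' _; field.
have -> : 3 * (\sum_(j < q) \sum_(x < q) \sum_(x' < q) A E x x' / 2 * slotdiff E x j * slotdiff E x' j)
  = \sum_(x < q) \sum_(j < q) \sum_(x' < q) 3 / 2 * A E x x' * slotdiff E x j * slotdiff E x' j.
  rewrite exchange_big /= mulr_sumr; apply: eq_bigr => x _; rewrite mulr_sumr; apply: eq_bigr => j _.
  by rewrite mulr_sumr; apply: eq_bigr => x' _; field.
rewrite -!big_split /=; apply: eq_bigr => x _; rewrite -!big_split /=; apply: eq_bigr => j _.
by rewrite addrA.
Qed.

Section OneSwap.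
Variables (x0 j0 : nat).
Hypotheses (x0q : (x0 < q)%N) (j0q : (j0 < q)%N).
Variable E : {set {set 'I_n}}.
Notation E' := (slot_swap x0 j0 E).

Lemma slot_swap_other u v : (u < n)%N -> (v < n)%N ->
  ~~ same_edge u v x0 (first j0) -> ~~ same_edge u v x0 (second j0) -> A E' u v = A E u v.
Proof.
move=> un vn h1 h2; rewrite /adjR bit_swap tpermD //; rewrite eq_sym.
  by apply: edge_neq => //; rewrite /fst_end; lia.
by apply: edge_neq => //; rewrite /snd_end; lia.
Qed.

Lemma slot_swap_first : A E' x0 (first j0) = A E x0 (second j0).
Proof. by rewrite /adjR bit_swap tpermL. Qed.

Lemma slot_swap_second : A E' x0 (second j0) = A E x0 (first j0).
Proof. by rewrite /adjR bit_swap tpermR. Qed.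

Lemma slot_swap_slotdiff : slotdiff E' x0 j0 = - slotdiff E x0 j0.
Proof. by rewrite /slotdiff slot_swap_first slot_swap_second opprB. Qed.

Lemma slot_swap_slotdiff_other x j : (x < q)%N -> (j < q)%N -> (x != x0) || (j != j0) ->
  slotdiff E' x j = slotdiff E x j.
Proof.
move=> xq jq h; rewrite /slotdiff !slot_swap_other // /same_edge /fst_end /snd_end; lia.
Qed.

Lemma slot_swap_nonslot u v : (u < n)%N -> (v < n)%N ->
  ~~ (isX u && isY v) -> ~~ (isX v && isY u) -> A E' u v = A E u v.
Proof.
move=> un vn h1 h2; apply: slot_swap_other => //; move: h1 h2;
  rewrite /same_edge /in_left /in_right /fst_end /snd_end; lia.
Qed.

Lemma slot_swap_even_XY x v : isX x -> isY v ->
  A E' x v + A E' x (partner v) = A E x v + A E x (partner v).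
Proof.
move=> xX vY.
have xn : (x < n)%N by move: xX; rewrite /in_left; lia.
have vn : (v < n)%N by move: vY; rewrite /in_right; lia.
have pn : (partner v < n)%N by move: vY; rewrite /in_right /twin; case: ifP; lia.
case: (boolP ((x == x0) && ((v == first j0) || (v == second j0)))) => [/andP[/eqP -> /orP[]/eqP ->]|h].
- by rewrite (twin_fst_end q4) // slot_swap_first slot_swap_second addrC.
- by rewrite (twin_snd_end q4) // slot_swap_first slot_swap_second addrC.
congr (_ + _); apply: slot_swap_other => //; move: h vY xX;
  rewrite /same_edge /in_left /in_right /twin /fst_end /snd_end; try (case: ifP); lia.
Qed.

Lemma slot_swap_evenpart u v : (u < n)%N -> (v < n)%N -> evenpart E' u v = evenpart E u v.
Proof.
move=> un vn; congr (_ / _); rewrite /flipped.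
case: (boolP (isX u && isY v)) => [/andP[h1 h2]|h1]; first exact: slot_swap_even_XY.
case: (boolP (isX v && isY u)) => [/andP[h2 h3]|h2].
  by rewrite ![A _ u v]adjRC ![A _ (partner u) v]adjRC slot_swap_even_XY.
by rewrite slot_swap_nonslot.
Qed.

Lemma slot_swap_pairdiff j j' : (j < q)%N -> (j' < q)%N -> pairdiff E' j j' = pairdiff E j j'.
Proof.
move=> jq jq'; rewrite /pairdiff !slot_swap_nonslot //;
  rewrite /in_left /in_right /fst_end /snd_end; lia.
Qed.

Lemma slot_swap_slotcoef x j : (x < q)%N -> (j < q)%N -> slotcoef E' x j = slotcoef E x j.
Proof.
move=> xq jq; rewrite /slotcoef /common; congr (_ * (_ - _)); apply: eq_bigr => l _;
  rewrite !slot_swap_evenpart //; rewrite /fst_end /snd_end; lia.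
Qed.

End OneSwap.

Notation S := (draws (pairs k) m).

Lemma slot_involutionK i : involutive (slot_involution i).
Proof. exact: swapK. Qed.

Lemma slot_involution_draws i E : E \in S -> slot_involution i E \in S.
Proof.
case: i => x j; have xq := ltn_ord x; have jq := ltn_ord j.
by apply: swap_draws; rewrite edge_pairs /= /fst_end /snd_end; lia.
Qed.

Lemma slot_sign_odd i E : E \in S -> slot_sign i (slot_involution i E) = - slot_sign i E.
Proof. by move=> _; apply: slot_swap_slotdiff. Qed.

Lemma slot_sign_inv i i' : i != i' -> invariant_under S slot_involution i (slot_sign i').
Proof.
move=> ii E _; apply: slot_swap_slotdiff_other => //.
by move: ii; rewrite -negb_and; apply: contra => /andP[/eqP/val_inj h1 /eqP/val_inj h2]; case: i i' h1 h2 => x j [x' j'] /= -> ->.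
Qed.

Lemma slot_linear_inv i : invariant_all S slot_involution (slot_linear i).
Proof. by move=> i' E _; apply: slot_swap_slotcoef. Qed.

Lemma slot_quadratic_inv i i' : invariant_all S slot_involution (slot_quadratic i i').
Proof.
move=> i0 E _; rewrite /slot_quadratic; case: ifP => _; case: ifP => // _; first by rewrite slot_swap_pairdiff.
rewrite slot_swap_nonslot // /in_left /in_right; have := ltn_ord i.1; have := ltn_ord i'.1; lia.
Qed.

Lemma even_count_inv : invariant_all S slot_involution even_count.
Proof.
move=> i E ES; rewrite /even_count; congr (_ + _).
  by apply: eq_bigr => u _; apply: eq_bigr => v _; apply: eq_bigr => w _; rewrite !slot_swap_evenpart.
apply: eq_bigr => x _; apply: eq_bigr => j _; rewrite slot_swap_pairdiff //; congr (_ * _).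
have [xj|xj] := eqVneq ((x, j) : I) i; last by rewrite -[slotdiff _ x j]/(slot_sign (x, j) _) slot_sign_inv // 1?eq_sym.
by rewrite -[slotdiff _ x j]/(slot_sign (x, j) _) -[slotdiff E x j]/(slot_sign (x, j) E) xj slot_sign_odd // sqrrN.
Qed.

Lemma slot_quadratic_sym i i' E : slot_quadratic i i' E = slot_quadratic i' i E.
Proof.
rewrite /slot_quadratic ![i'.1 == _]eq_sym ![i'.2 == _]eq_sym; case: ifP => _; case: ifP => // _.
  by rewrite /pairdiff [A E (first i.2) (first i'.2)]adjRC [A E (first i.2) (second _)]adjRC
   [A E (second i.2) (first i'.2)]adjRC [A E (second i.2) (second _)]adjRC; ring.
by rewrite adjRC.
Qed.

Lemma slot_quadratic_diag i E : slot_quadratic i i E = 0.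
Proof. by rewrite /slot_quadratic !eqxx. Qed.

Lemma slot_sign_cube i E : slot_sign i E ^+ 3 = slot_sign i E.
Proof.
rewrite /slot_sign /slotdiff /adjR /bit; case: (_ \in _); case: (_ \in _); rewrite /=; ring.
Qed.

End SlotDecomposition.

(** * Moments of the linear coefficients *)

Section SlotMoments.
Variables (R : realType) (k q m : nat) (t : R).
Notation n := k.+1.
Notation N := (n%:R : R).
Hypothesis q4 : (4 * q <= n)%N.
Hypothesis tE : t = m%:R / #|pairs k|%:R.
Hypothesis mM : (m <= #|pairs k|)%N.
Implicit Types (E : {set {set 'I_n}}) (u v w : nat).
Notation A := (@adjR R k).
Notation first := (fst_end q).
Notation second := (snd_end q).
Notation isY := (in_right q).
Notation evenpart := (@evenpart R k q).
Notation slotdiff := (@slotdiff R k q).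
Notation slotcoef := (@slotcoef R k q).
Notation S := (draws (pairs k) m).
Notation EX := (unif_expect (R := R) S).

Let t0 : 0 <= t. Proof. by rewrite tE divr_ge0. Qed.

Lemma adjR01 E u v : A E u v = 0 \/ A E u v = 1.
Proof. by rewrite /adjR /bit; case: (_ \in _); [right|left]. Qed.

Lemma adjR_ge0 E u v : 0 <= A E u v.
Proof. by case: (adjR01 E u v) => ->. Qed.

Lemma adjR_le1 E u v : A E u v <= 1.
Proof. by case: (adjR01 E u v) => ->. Qed.

Definition valid_edge (e : nat * nat) := [&& (e.1 < n)%N, (e.2 < n)%N & e.1 != e.2].
Definition separate (b b' : seq (nat * nat)) :=
  all (fun e => all (fun e' => ~~ same_edge e.1 e.2 e'.1 e'.2) b') b.
Definition block_sum E (b : seq (nat * nat)) := \sum_(e <- b) A E e.1 e.2.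

(** The edges of disjoint blocks appear together with at most the probability
    expected from independence. *)
Lemma ue_vertex_blocks (bs : seq (seq (nat * nat))) :
  all (all valid_edge) bs -> pairwise separate bs ->
  EX (fun E => \prod_(b <- bs) block_sum E b) <= \prod_(b <- bs) ((size b)%:R * t).
Proof.
move=> hv hs; pose conv (b : seq (nat * nat)) := [seq edge k e.1 e.2 | e <- b].
have := @ue_blocks R _ (pairs k) m mM (map conv bs).
rewrite -tE [X in _ <= X]big_map.
have -> : \prod_(b <- bs) ((size (conv b))%:R * t) = \prod_(b <- bs) ((size b)%:R * t).
  by apply: eq_bigr => b _; rewrite size_map.
rewrite (@eq_ue _ _ S _ (fun E => \prod_(b <- bs) block_sum E b)); last first.
  by move=> E _; rewrite big_map; apply: eq_bigr => b _; rewrite big_map.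
apply.
  rewrite all_map; apply/allP => b bbs; rewrite /= all_map; apply/allP => e eb /=.
  have /and3P[e1 e2 e12] := allP (allP hv b bbs) e eb.
  by change (edge k e.1 e.2 \in pairs k); rewrite edge_pairs.
elim: bs hv hs => //= b bs IH /andP[bv bsv] /andP[hb hbs].
rewrite IH // andbT all_map; apply/allP => b' b'bs; rewrite /= all_map; apply/allP => e eb /=.
apply/mapP => -[e' e'b'].
have /and3P[e1 e2 e12] := allP bv e eb.
have /and3P[e1' e2' e12'] := allP (allP bsv b' b'bs) e' e'b'.
apply/eqP; apply: edge_neq => //.
exact: (allP (allP (allP hb b' b'bs) e eb) e' e'b').
Qed.

Definition slot_pairs (x j : nat) := [:: (x, first j); (x, second j)].

Lemma slotdiff_le E x j : slotdiff E x j ^+ 2 <= block_sum E (slot_pairs x j).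
Proof.
rewrite /block_sum /slot_pairs !big_cons big_nil /slotdiff /=.
by case: (adjR01 E x (first j)) => ->; case: (adjR01 E x (second j)) => ->; lra.
Qed.

Section OneSlot.
Variables (x j : nat).
Hypotheses (xq : (x < q)%N) (jq : (j < q)%N).

Definition outer_vertex_of (l : nat) := [&& (q <= l)%N, l != first j & l != second j].
Definition pairdev (l : nat) E := if outer_vertex_of l then A E (first j) l - A E (second j) l else 0.
(** A second family of involutions: exchanging the edges from [l] to the two
    members of the pair [j] changes the sign of the summand of index [l] in
    [slotcoefE], and leaves the other summands and the slot itself alone. *)
Definition path_swap (l : 'I_n) E := if outer_vertex_of l then swap (edge k (first j) l) (edge k (second j) l) E else E.
Notation kap l := (fun E => evenpart E x l).

Lemma slotcoefE E : E \subset pairs k ->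
  slotcoef E x j = 3 * \sum_(l < n) pairdev l E * evenpart E x l.
Proof.
move=> sE; rewrite /slotcoef /common; congr (3 * _); rewrite -sumrB.
have fn : (first j < n)%N by rewrite /fst_end; lia.
have sn : (second j < n)%N by rewrite /snd_end; lia.
have fs : Ordinal sn != Ordinal fn.
  by apply/eqP => /(congr1 val) /=; rewrite /fst_end /snd_end; lia.
have ff : outer_vertex_of (first j) = false by rewrite /outer_vertex_of eqxx andbF.
have fsn : outer_vertex_of (second j) = false by rewrite /outer_vertex_of eqxx !andbF.
rewrite (bigD1 (Ordinal fn)) //= (bigD1 (Ordinal sn)) //= [RHS](bigD1 (Ordinal fn)) //=
   [X in _ = _ + X](bigD1 (Ordinal sn)) //= /pairdev ff fsn !mul0r !add0r addrA.
have kE : evenpart E x (first j) = evenpart E x (second j).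
  rewrite /evenpart /flipped /in_left xq !(in_right_fst_end q4) ?(in_right_snd_end q4) //=.
  by rewrite (twin_fst_end q4) // (twin_snd_end q4) // addrC.
have Y1 := in_right_fst_end q4 jq; have Y2 := in_right_snd_end q4 jq.
rewrite (evenpart_right R q4 E Y1 Y1) (evenpart_right R q4 E Y1 Y2) (evenpart_right R q4 E Y2 Y1) (evenpart_right R q4 E Y2 Y2).
rewrite !adjR_diag // kE [A E (second j) (first j)]adjRC.
have -> : evenpart E x (second j) * 0 - evenpart E x (second j) * A E (first j) (second j)
   + (evenpart E x (second j) * A E (first j) (second j) - evenpart E x (second j) * 0) = 0 by ring.
rewrite add0r; apply: eq_bigr => l /andP[l1 l2].
have l1' : (l : nat) != first j by apply: contra l1 => /eqP h; apply/eqP/val_inj.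
have l2' : (l : nat) != second j by apply: contra l2 => /eqP h; apply/eqP/val_inj.
rewrite /outer_vertex_of l1' l2' !andbT.
case: leqP => ql.
  have ns v : isY v -> evenpart E v l = A E v l.
    move=> vY; apply: evenpart_nonslot; move: vY; rewrite /in_left /in_right; lia.
  by rewrite (ns _ Y1) (ns _ Y2); ring.
rewrite mul0r (evenpartC R q4 E (first j) l) (evenpartC R q4 E (second j) l) /evenpart /flipped /in_left ql !(in_right_fst_end q4) ?(in_right_snd_end q4) //=.
rewrite (twin_fst_end q4) // (twin_snd_end q4) //; ring.
Qed.

Lemma path_swapK l : involutive (path_swap l).
Proof. by move=> E; rewrite /path_swap; case: (outer_vertex_of l); rewrite ?swapK. Qed.

Lemma path_swap_draws l E : E \in S -> path_swap l E \in S.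
Proof.
rewrite /path_swap; case: ifP => // /and3P[h1 h2 h3]; apply: swap_draws; rewrite edge_pairs //.
- by rewrite eq_sym.
- by rewrite /fst_end; lia.
- by rewrite eq_sym.
- by rewrite /snd_end; lia.
Qed.

Lemma path_swap_other (l : 'I_n) E u v : (u < n)%N -> (v < n)%N -> outer_vertex_of l ->
  ~~ same_edge u v (first j) l -> ~~ same_edge u v (second j) l -> A (path_swap l E) u v = A E u v.
Proof.
move=> un vn fl h1 h2; rewrite /path_swap fl /adjR bit_swap tpermD // eq_sym.
  by apply: edge_neq => //; rewrite /fst_end; lia.
by apply: edge_neq => //; rewrite /snd_end; lia.
Qed.

Lemma path_swap_X (l : 'I_n) E v : (v < n)%N -> A (path_swap l E) x v = A E x v.
Proof.
move=> vn; case: (boolP (outer_vertex_of l)) => fl; last by rewrite /path_swap (negbTE fl).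
apply: path_swap_other => //; move: fl; rewrite /same_edge /outer_vertex_of /fst_end /snd_end; lia.
Qed.

Lemma path_swap_evenpart (l : 'I_n) E v : (v < n)%N -> evenpart (path_swap l E) x v = evenpart E x v.
Proof.
move=> vn; rewrite /evenpart /flipped /in_left xq /=; case: ifP => vY.
  by rewrite !path_swap_X //; move: vY; rewrite /in_right /twin; case: ifP; lia.
have -> : (v < q)%N && isY x = false by rewrite /in_right; lia.
by rewrite !path_swap_X.
Qed.

Lemma path_swap_slotdiff (l : 'I_n) E : slotdiff (path_swap l E) x j = slotdiff E x j.
Proof.
by rewrite /slotdiff !path_swap_X //; [rewrite /snd_end|rewrite /fst_end]; lia.
Qed.

Lemma path_swap_pairdev (l : 'I_n) E : pairdev l (path_swap l E) = - pairdev l E.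
Proof.
rewrite /pairdev /path_swap; case: (outer_vertex_of l); last by rewrite oppr0.
by rewrite /adjR !bit_swap tpermL tpermR opprB.
Qed.

Lemma path_swap_pairdev_other (l l' : 'I_n) E : l != l' -> pairdev l' (path_swap l E) = pairdev l' E.
Proof.
move=> ll; have {}ll : (l : nat) != l' by apply: contra ll => /eqP/val_inj ->.
rewrite /pairdev; case: (boolP (outer_vertex_of l')) => // fl'.
case: (boolP (outer_vertex_of l)) => fl; last by rewrite /path_swap (negbTE fl).
by rewrite !path_swap_other //; move: ll fl fl'; rewrite /same_edge /outer_vertex_of /fst_end /snd_end; lia.
Qed.

Notation z2 := (fun E => slotdiff E x j ^+ 2).

Lemma pairdev_centred (W : {set {set 'I_n}} -> R) (l : 'I_n) f :
  invariant_under S path_swap l W -> invariant_under S path_swap l f ->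
  EX (fun E => W E * pairdev l E * f E) = 0.
Proof.
move=> Wi fi; apply: (ue_odd (path_swap_draws l) (path_swapK l)) => E ES.
by rewrite Wi // fi // path_swap_pairdev; ring.
Qed.

Lemma pairdev_inv (l l' : 'I_n) : l != l' -> invariant_under S path_swap l (pairdev l').
Proof. by move=> ll E _; apply: path_swap_pairdev_other. Qed.

Lemma z2_inv : invariant_all S path_swap z2.
Proof. by move=> l E _ /=; rewrite path_swap_slotdiff. Qed.

Lemma kap_inv (l : 'I_n) : invariant_all S path_swap (kap l).
Proof. by move=> l' E _ /=; rewrite path_swap_evenpart. Qed.

Lemma pairdev2_inv (l : 'I_n) : invariant_all S path_swap (fun E => pairdev l E ^+ 2).
Proof.
move=> l' E ES /=; have [->|ll] := eqVneq l' l; first by rewrite path_swap_pairdev sqrrN.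
by rewrite pairdev_inv.
Qed.

Definition slot_term (l : nat) E := pairdev l E * evenpart E x l.

(** The summands are orthogonal, by the involutions [path_swap]. *)
Lemma second_moment : EX (fun E => slotdiff E x j ^+ 2 * (\sum_(l < n) slot_term l E) ^+ 2)
  = \sum_(l < n) EX (fun E => slotdiff E x j ^+ 2 * slot_term l E ^+ 2).
Proof.
apply: (@orthogonal_increments R _ S _ path_swap z2 (fun l : 'I_n => pairdev l) _ _
   (fun (l : 'I_n) E => evenpart E x l)).
- by move=> l f fi; apply: pairdev_centred => //; apply: z2_inv.
- by move=> l l' ll; apply: pairdev_inv.
- by move=> l l' _; apply: kap_inv.
Qed.

(** [(sum y)^2] is the sum of the squares plus twice a sum of orthogonal
    increments, whose second moment is again computed by orthogonality. *)
Lemma fourth_moment : EX (fun E => slotdiff E x j ^+ 2 * (\sum_(l < n) slot_term l E) ^+ 4)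
  <= 10 * \sum_(l < n) \sum_(l' < n) EX (fun E => slotdiff E x j ^+ 2 * slot_term l E ^+ 2 * slot_term l' E ^+ 2).
Proof.
pose h (l : 'I_n) E := \sum_(l' < n | (enum_rank l' < enum_rank l)%N) slot_term l' E.
have term_inv (l l' : 'I_n) : l != l' -> invariant_under S path_swap l (slot_term l').
  by move=> ll E ES; rewrite /slot_term pairdev_inv // kap_inv.
have term2_inv (l : 'I_n) : invariant_all S path_swap (fun E => slot_term l E ^+ 2).
  move=> l' E ES /=; rewrite /slot_term [LHS]exprMn [RHS]exprMn (pairdev2_inv l l' ES); congr (_ * _ ^+ 2).
  exact: (kap_inv l l' ES).
have h2 : EX (fun E => slotdiff E x j ^+ 2 * (\sum_(l < n) slot_term l E * h l E) ^+ 2)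
   = \sum_(l < n) EX (fun E => slotdiff E x j ^+ 2 * slot_term l E ^+ 2 * h l E ^+ 2).
  rewrite (@eq_ue _ _ S _ (fun E => slotdiff E x j ^+ 2 * (\sum_(l < n) pairdev l E * (evenpart E x l * h l E)) ^+ 2)); last first.
    by move=> E _; congr (_ * _ ^+ 2); apply: eq_bigr => l _; rewrite /slot_term mulrA.
  rewrite (@orthogonal_increments R _ S _ path_swap z2 (fun l : 'I_n => pairdev l) _ _
   (fun (l : 'I_n) E => evenpart E x l * h l E)).
  - by apply: eq_bigr => l _; apply: eq_ue => E _; rewrite /slot_term; ring.
  - by move=> l f fi; apply: pairdev_centred => //; apply: z2_inv.
  - by move=> l l' ll; apply: pairdev_inv.
  - move=> l l' ll E ES; rewrite (kap_inv l' l ES); congr (_ * _); apply: eq_bigr => l'' l3.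
    rewrite term_inv //; apply: contraTneq (leq_trans l3 ll) => ->.
    by rewrite ltnn.
have h3 (l : 'I_n) : EX (fun E => slotdiff E x j ^+ 2 * slot_term l E ^+ 2 * h l E ^+ 2)
   = \sum_(l' < n | (enum_rank l' < enum_rank l)%N) EX (fun E => slotdiff E x j ^+ 2 * slot_term l E ^+ 2 * slot_term l' E ^+ 2).
  pose W E := slotdiff E x j ^+ 2 * slot_term l E ^+ 2.
  have WI : invariant_all S path_swap W.
    by move=> l' E ES; rewrite /W (z2_inv l' ES) (term2_inv l l' E ES).
  pose g (l' : 'I_n) E := if (enum_rank l' < enum_rank l)%N then evenpart E x l' else 0.
  rewrite (@eq_ue _ _ S _ (fun E => W E * (\sum_(l' < n) pairdev l' E * g l' E) ^+ 2)); last first.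
    move=> E _; congr (_ * _ ^+ 2); rewrite /h big_mkcond; apply: eq_bigr => l' _.
    by rewrite /g; case: ifP => _; rewrite ?mulr0.
  rewrite (@orthogonal_increments R _ S _ path_swap W (fun l' : 'I_n => pairdev l') _ _ g).
  - rewrite [RHS]big_mkcond; apply: eq_bigr => l' _; rewrite /g; case: (enum_rank l' < enum_rank l)%N.
      by apply: eq_ue => E _.
    rewrite (@eq_ue _ _ S _ (fun=> 0)) ?ue_cst ?card_draws_gt0 // => E _.
    by rewrite mulr0 expr0n mulr0.
  - by move=> l' f fi; apply: pairdev_centred.
  - by move=> i i' ii; apply: pairdev_inv.
  - move=> i i' _ E ES; rewrite /g; case: ifP => // _; exact: (kap_inv i' i ES).
have p0 l l' : 0 <= EX (fun E => slotdiff E x j ^+ 2 * slot_term l E ^+ 2 * slot_term l' E ^+ 2).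
  by apply: ue_ge0 => E _; rewrite -!exprMn sqr_ge0.
apply: (@le_trans _ _ (2 * EX (fun E => slotdiff E x j ^+ 2 * (\sum_(l < n) slot_term l E ^+ 2) ^+ 2)
   + 8 * EX (fun E => slotdiff E x j ^+ 2 * (\sum_(l < n) slot_term l E * h l E) ^+ 2))).
  rewrite -!ueZ -ueD; apply: ue_le => E _.
  have -> : (\sum_(l < n) slot_term l E) ^+ 4 = (\sum_(l < n) slot_term l E ^+ 2 + 2 * \sum_(l < n) slot_term l E * h l E) ^+ 2.
    rewrite -[4%N]/(2 * 2)%N exprM; congr (_ ^+ 2).
    rewrite [LHS]expr2 big_distrl /=.
    have -> : 2 * \sum_(l < n) slot_term l E * h l E = \sum_(l < n) \sum_(l' < n | (enum_rank l' < enum_rank l)%N) slot_term l E * slot_term l' E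
       + \sum_(l < n) \sum_(l' < n | (enum_rank l < enum_rank l')%N) slot_term l E * slot_term l' E.
      rewrite [X in _ + X](exchange_big_dep xpredT) //= mulr_natl mulr2n; congr (_ + _).
        by apply: eq_bigr => l _; rewrite /h mulr_sumr.
      apply: eq_bigr => l _; rewrite /h mulr_sumr; apply: eq_bigr => l' _; ring.
    rewrite -!big_split /=; apply: eq_bigr => l _.
    rewrite mulr_sumr (bigD1 l) //= -expr2; congr (_ + _).
    rewrite (bigID (fun l' => (enum_rank l' < enum_rank l)%N)) /=; congr (_ + _); apply: eq_bigl => l'.
      have [->|//] := eqVneq l' l; by rewrite ltnn.
    have [->|ll] := eqVneq l' l; first by rewrite ltnn.
    rewrite -leqNgt leq_eqVlt /=; case: eqP => // /val_inj /enum_rank_inj e.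
    by rewrite e eqxx in ll.
  set a := \sum_(l < n) slot_term l E ^+ 2; set b := \sum_(l < n) _ * _; set zz := slotdiff E x j ^+ 2.
  have : 0 <= zz * (a - 2 * b) ^+ 2 by rewrite mulr_ge0 ?sqr_ge0.
  have -> : zz * (a - 2 * b) ^+ 2 = 2 * (zz * a ^+ 2) + 8 * (zz * b ^+ 2) - zz * (a + 2 * b) ^+ 2 by ring.
  lra.
have e1 : EX (fun E => slotdiff E x j ^+ 2 * (\sum_(l < n) slot_term l E ^+ 2) ^+ 2)
   = \sum_(l < n) \sum_(l' < n) EX (fun E => slotdiff E x j ^+ 2 * slot_term l E ^+ 2 * slot_term l' E ^+ 2).
  under [RHS]eq_bigr => l _ do rewrite -ue_sum.
  rewrite -ue_sum; apply: eq_ue => E _; rewrite [(\sum_(l < n) _) ^+ 2]expr2 big_distrl mulr_sumr /=; apply: eq_bigr => l _.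
  by rewrite !mulr_sumr; apply: eq_bigr => l' _; ring.
have e2 : EX (fun E => slotdiff E x j ^+ 2 * (\sum_(l < n) slot_term l E * h l E) ^+ 2)
   <= \sum_(l < n) \sum_(l' < n) EX (fun E => slotdiff E x j ^+ 2 * slot_term l E ^+ 2 * slot_term l' E ^+ 2).
  rewrite h2; apply: ler_sum => l _; rewrite h3 [leLHS]big_mkcond; apply: ler_sum => l' _.
  by case: ifP.
rewrite e1; lra.
Qed.

End OneSlot.
End SlotMoments.

Section MomentBounds.
Variables (R : realType) (k q m : nat) (t : R).
Notation n := k.+1.
Notation N := (n%:R : R).
Hypothesis q4 : (4 * q <= n)%N.
Hypothesis tE : t = m%:R / #|pairs k|%:R.
Hypothesis mM : (m <= #|pairs k|)%N.
Implicit Types (E : {set {set 'I_n}}) (u v w : nat).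
Notation first := (fst_end q).
Notation second := (snd_end q).
Notation isY := (in_right q).
Notation partner := (twin q).
Notation evenpart := (@evenpart R k q).
Notation slotdiff := (@slotdiff R k q).
Notation S := (draws (pairs k) m).
Notation EX := (unif_expect (R := R) S).
Notation term := (@slot_term R k q).
Notation outer_vertex := (outer_vertex_of q).
Notation slot_block := (slot_pairs q).
Notation block_sum := (@block_sum R k).

Let t0 : 0 <= t. Proof. by rewrite tE divr_ge0. Qed.

Section OneSlot.
Variables (x j : nat).
Hypotheses (xq : (x < q)%N) (jq : (j < q)%N).

Definition even_block (l : nat) := if isY l then [:: (x, l); (x, partner l)] else [:: (x, l)].
Definition pair_block (l : nat) := [:: (first j, l); (second j, l)].

Lemma evenpart_sqr_le E l : evenpart E x l ^+ 2 <= block_sum E (even_block l) /\ evenpart E x l ^+ 2 <= 1.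
Proof.
rewrite /even_block /evenpart /flipped /in_left xq /=; case: ifP => lY.
  rewrite /block_sum !big_cons big_nil /=.
  by case: (adjR01 R E x l) => ->; case: (adjR01 R E x (partner l)) => ->; split; lra.
have -> : (l < q)%N && isY x = false by rewrite /in_right; lia.
rewrite /block_sum big_cons big_nil /=; case: (adjR01 R E x l) => ->; split; lra.
Qed.

Lemma pairdev_sqr_le E l : @pairdev R k q j l E ^+ 2 <= block_sum E (pair_block l) /\ @pairdev R k q j l E ^+ 2 <= 1.
Proof.
rewrite /pairdev /block_sum !big_cons big_nil /=.
case: (adjR01 R E (first j) l) => ->; case: (adjR01 R E (second j) l) => ->; case: (outer_vertex j l); split; lra.
Qed.

Lemma slot_term_sqr_le E l : term x j l E ^+ 2 <= block_sum E (even_block l) * block_sum E (pair_block l)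
   /\ term x j l E ^+ 2 <= 1.
Proof.
have [h1 h2] := evenpart_sqr_le E l; have [h3 h4] := pairdev_sqr_le E l.
rewrite /slot_term [_ ^+ 2]exprMn; split; first by rewrite mulrC; apply: ler_pM => //; apply: sqr_ge0.
by apply: mulr_ile1 => //; apply: sqr_ge0.
Qed.

Lemma slot_term_inner E l : ~~ outer_vertex j l -> term x j l E = 0.
Proof. by rewrite /slot_term /pairdev => /negbTE ->; rewrite mul0r. Qed.

Let size_even l : (size (even_block l) <= 2)%N.
Proof. by rewrite /even_block; case: ifP. Qed.

Let from_x (b : seq (nat * nat)) := all (fun e => (e.1 == x) && (q <= e.2)%N) b.
Let off_left (b : seq (nat * nat)) := all (fun e => (q <= e.1)%N && (q <= e.2)%N) b.

(** Edges at [x] and edges that avoid the first class cannot coincide. *)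
Lemma separate_from_x b b' : from_x b -> off_left b' -> separate b b' && separate b' b.
Proof.
move=> /allP hb /allP hb'; apply/andP; split; apply/allP => -[u v] h; apply/allP => -[u' v'] h'.
  move: (hb _ h) (hb' _ h'); clear -xq; rewrite /same_edge /=; lia.
move: (hb' _ h) (hb _ h'); clear -xq; rewrite /same_edge /=; lia.
Qed.

Lemma from_x_slot : from_x (slot_block x j).
Proof. by clear -jq; rewrite /from_x /= /fst_end /snd_end !eqxx !leq_addr /= andbT; lia. Qed.

Lemma from_x_even l : (q <= l)%N -> from_x (even_block l).
Proof.
clear -xq; move=> ql; rewrite /from_x /even_block; case: ifP => lY /=; rewrite !eqxx ql //= andbT.
by move: lY; rewrite /in_right /twin; case: ifP; lia.
Qed.

Lemma off_left_pair l : (q <= l)%N -> off_left (pair_block l).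
Proof. by clear -jq; move=> ql; rewrite /off_left /= ql /fst_end /snd_end; lia. Qed.

Lemma separate_slot_even l : (q <= l)%N -> outer_vertex j l -> separate (slot_block x j) (even_block l).
Proof.
clear -q4 xq jq; move=> ql; rewrite /even_block /separate /slot_pairs /outer_vertex_of /same_edge /fst_end /snd_end /in_right /twin.
by case: (ltnP l (2 * q)) => l2; case: ifP => lY /=; rewrite ?andbT => fl; repeat (apply/andP; split => //); lia.
Qed.

Lemma separate_even_even l l' : (q <= l)%N -> (q <= l')%N -> l != l' -> ~~ (isY l && (l' == partner l)) ->
  separate (even_block l) (even_block l').
Proof.
clear -xq; move=> ql ql' /eqP ll lp.
have sepv v v' : (q <= v)%N -> v <> v' -> ~~ same_edge x v x v'.
  by clear -xq; rewrite /same_edge => qv vv; lia.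
have tw v : isY v -> [/\ (q <= partner v)%N, isY (partner v) & partner (partner v) = v].
  clear -xq; rewrite /in_right /twin => h.
  by case: (ltnP v (2 * q)) => h2; case: ifP => h3; split; lia.
rewrite /even_block; case: ifP => lY; case: ifP => lY' /=; rewrite ?andbT.
- have [t1 t2 t3] := tw _ lY; have [t1' t2' t3'] := tw _ lY'.
  have d1 : l <> partner l'.
    by move=> e; move: lp; rewrite lY e t3' eqxx.
  have d2 : partner l <> l' by move=> e; move: lp; rewrite lY e eqxx.
  have d3 : partner l <> partner l' by move=> e; apply: ll; rewrite -t3 e t3'.
  by rewrite !sepv.
- have [t1 t2 t3] := tw _ lY.
  by rewrite !sepv // => e; rewrite -e t2 in lY'.
- have [t1 t2 t3] := tw _ lY'.
  by rewrite !sepv // => e; rewrite e t2 in lY.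
by rewrite sepv.
Qed.

Lemma separate_pair_pair l l' : l != l' -> outer_vertex j l -> outer_vertex j l' ->
  separate (pair_block l) (pair_block l').
Proof.
clear; move=> /eqP ll; rewrite /outer_vertex_of /separate /pair_block /same_edge /=.
move: (first j) (second j) => f g /and3P[_ /eqP h1 /eqP h2] /and3P[_ /eqP h3 /eqP h4].
by rewrite !andbT; repeat (apply/andP; split); lia.
Qed.

Lemma valid_slot : all (valid_edge k) (slot_block x j).
Proof. by clear -q4 xq jq; rewrite /= /valid_edge /fst_end /snd_end /= !andbT; lia. Qed.

Lemma valid_blocks l : (l < n)%N -> outer_vertex j l ->
  all (valid_edge k) (even_block l) && all (valid_edge k) (pair_block l).
Proof.
clear -q4 xq jq; move=> ln; rewrite /even_block /pair_block /valid_edge /outer_vertex_of /fst_end /snd_end /in_right /twin.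
by case: (ltnP l (2 * q)) => l2; case: ifP => lY /=; rewrite ?andbT => fl; repeat (apply/andP; split => //); lia.
Qed.

Lemma slot_term_moment l : (l < n)%N ->
  EX (fun E => slotdiff E x j ^+ 2 * term x j l E ^+ 2) <= 8 * t ^+ 3.
Proof.
move=> ln; case: (boolP (outer_vertex j l)) => fl; last first.
  rewrite (@eq_ue _ _ S _ (fun=> 0)) ?ue_cst ?card_draws_gt0 //.
    by rewrite mulr_ge0 ?exprn_ge0.
  by move=> E _; rewrite slot_term_inner // expr0n mulr0.
apply: (@le_trans _ _ (EX (fun E => \prod_(b <- [:: slot_block x j; even_block l; pair_block l]) block_sum E b))).
  apply: ue_le => E _; rewrite !big_cons big_nil mulr1.
  apply: ler_pM; rewrite ?sqr_ge0 //; first exact: slotdiff_le.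
  by case: (slot_term_sqr_le E l).
apply: le_trans (ue_vertex_blocks tE mM _ _) _.
- have /andP[] := valid_blocks ln fl; move: valid_slot.
  by move: (slot_block x j) (even_block l) (pair_block l) => b0 b1 b2 /= -> -> ->.
- have ql : (q <= l)%N by case/and3P: fl.
  have [/andP[s1 _] /andP[s2 _]] := (separate_from_x from_x_slot (off_left_pair ql), separate_from_x (from_x_even ql) (off_left_pair ql)).
  move: (separate_slot_even ql fl) s1 s2.
  by move: (slot_block x j) (even_block l) (pair_block l) => b0 b1 b2 /= -> -> ->.
rewrite !big_cons big_nil /= mulr1.
have : (size (even_block l))%:R <= 2%:R :> R by rewrite ler_nat size_even.
move=> h; have -> : 8 * t ^+ 3 = 2 * t * (2 * t * (2 * t)) by ring.
have h' : (size (even_block l))%:R * t <= 2 * t by apply: ler_wpM2r.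
by apply: ler_wpM2l; [rewrite mulr_ge0|apply: ler_wpM2r => //; rewrite mulr_ge0].
Qed.

(** If [l'] is the twin of [l], the even parts at [l] and [l'] coincide and the
    five edges are not all distinct. *)
Lemma slot_term_moment_mixed l l' : (l < n)%N -> (l' < n)%N -> l != l' -> ~~ (isY l && (l' == partner l)) ->
  EX (fun E => slotdiff E x j ^+ 2 * term x j l E ^+ 2 * term x j l' E ^+ 2) <= 32 * t ^+ 5.
Proof.
move=> ln ln' ll lp.
have z : 0 <= 32 * t ^+ 5 by rewrite mulr_ge0 ?exprn_ge0.
case: (boolP (outer_vertex j l)) => fl; last first.
  rewrite (@eq_ue _ _ S _ (fun=> 0)) ?ue_cst ?card_draws_gt0 //.
  by move=> E _; rewrite (slot_term_inner _ fl) expr0n mulr0 mul0r.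
case: (boolP (outer_vertex j l')) => fl'; last first.
  rewrite (@eq_ue _ _ S _ (fun=> 0)) ?ue_cst ?card_draws_gt0 //.
  by move=> E _; rewrite (slot_term_inner _ fl') expr0n mulr0.
apply: (@le_trans _ _ (EX (fun E => \prod_(b <- [:: slot_block x j; even_block l; pair_block l; even_block l'; pair_block l']) block_sum E b))).
  apply: ue_le => E _; rewrite !big_cons big_nil mulr1 -mulrA.
  apply: ler_pM; [exact: sqr_ge0|by rewrite -exprMn sqr_ge0|exact: slotdiff_le|].
  have [h _] := slot_term_sqr_le E l; have [h' _] := slot_term_sqr_le E l'.
  by rewrite [leRHS]mulrA; apply: ler_pM; rewrite ?sqr_ge0.
apply: le_trans (ue_vertex_blocks tE mM _ _) _.
- have [f0 f1] := (@valid_blocks l ln fl, @valid_blocks l' ln' fl').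
  move: valid_slot f0 f1.
  move: (slot_block x j) (even_block l) (pair_block l) (even_block l') (pair_block l') => b0 b1 b2 b3 b4.
  by move=> v0 /andP[v1 v2] /andP[v3 v4]; rewrite /= v0 v1 v2 v3 v4.
- have ql : (q <= l)%N by case/and3P: fl.
  have ql' : (q <= l')%N by case/and3P: fl'.
  have /andP[s1 _] := separate_from_x from_x_slot (off_left_pair ql).
  have /andP[s2 _] := separate_from_x from_x_slot (off_left_pair ql').
  have /andP[s3 _] := separate_from_x (from_x_even ql) (off_left_pair ql).
  have /andP[s4 _] := separate_from_x (from_x_even ql) (off_left_pair ql').
  have /andP[_ s5] := separate_from_x (from_x_even ql') (off_left_pair ql).
  have /andP[s6 _] := separate_from_x (from_x_even ql') (off_left_pair ql').
  move: (separate_slot_even ql fl) (separate_slot_even ql' fl') (separate_even_even ql ql' ll lp)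
    (separate_pair_pair ll fl fl') s1 s2 s3 s4 s5 s6.
  move: (slot_block x j) (even_block l) (pair_block l) (even_block l') (pair_block l') => b0 b1 b2 b3 b4.
  by move=> h1 h2 h3 h4 s1 s2 s3 s4 s5 s6; rewrite /= h1 h2 h3 h4 s1 s2 s3 s4 s5 s6.
rewrite !big_cons big_nil /= mulr1.
have hs i : (size (even_block i))%:R * t <= 2 * t.
  by apply: ler_wpM2r => //; rewrite -[2]/(2%:R) ler_nat size_even.
have t2 : 0 <= 2 * t by rewrite mulr_ge0.
have hp i : 0 <= (size (even_block i))%:R * t by rewrite mulr_ge0.
have -> : 32 * t ^+ 5 = 2 * t * (2 * t * (2 * t * (2 * t * (2 * t)))) by ring.
apply: ler_wpM2l => //; apply: ler_pM => //; first by rewrite !mulr_ge0.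
by apply: ler_wpM2l => //; apply: ler_wpM2r.
Qed.

End OneSlot.
End MomentBounds.

Section SlotcoefMoments.
Variables (R : realType) (k q m : nat) (t : R).
Notation n := k.+1.
Notation N := (n%:R : R).
Hypothesis q4 : (4 * q <= n)%N.
Hypothesis tE : t = m%:R / #|pairs k|%:R.
Hypothesis mM : (m <= #|pairs k|)%N.
Implicit Types (E : {set {set 'I_n}}) (u v w : nat).
Notation A := (@adjR R k).
Notation first := (fst_end q).
Notation second := (snd_end q).
Notation partner := (twin q).
Notation evenpart := (@evenpart R k q).
Notation slotdiff := (@slotdiff R k q).
Notation slotcoef := (@slotcoef R k q).
Notation S := (draws (pairs k) m).
Notation EX := (unif_expect (R := R) S).
Notation term := (@slot_term R k q).
Notation outer_vertex := (outer_vertex_of q).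

Let t0 : 0 <= t. Proof. by rewrite tE divr_ge0. Qed.

Section OneSlot.
Variables (x j : nat).
Hypotheses (xq : (x < q)%N) (jq : (j < q)%N).

Lemma sum_slot_term_moments :
  \sum_(l < n) \sum_(l' < n) EX (fun E => slotdiff E x j ^+ 2 * term x j l E ^+ 2 * term x j l' E ^+ 2)
  <= 32 * t ^+ 5 * N ^+ 2 + 16 * t ^+ 3 * N.
Proof.
have t5 : 0 <= 32 * t ^+ 5 by rewrite mulr_ge0 ?exprn_ge0.
have t3 : 0 <= 8 * t ^+ 3 by rewrite mulr_ge0 ?exprn_ge0.
have h (l l' : 'I_n) : EX (fun E => slotdiff E x j ^+ 2 * term x j l E ^+ 2 * term x j l' E ^+ 2)
   <= 32 * t ^+ 5 + ((if (l' : nat) == l then 8 * t ^+ 3 else 0) + (if (l' : nat) == partner l then 8 * t ^+ 3 else 0)).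
  have triv : EX (fun E => slotdiff E x j ^+ 2 * term x j l E ^+ 2 * term x j l' E ^+ 2) <= 8 * t ^+ 3.
    apply: le_trans (slot_term_moment q4 tE mM xq jq (ltn_ord l)); apply: ue_le => E _.
    by apply: ler_piMr; [rewrite -exprMn sqr_ge0|case: (slot_term_sqr_le q4 tE mM xq jq E l')].
  case: eqP => [_|ll]; first by apply: (le_trans triv); case: ifP => _; lra.
  case: eqP => [_|lp]; first by apply: (le_trans triv); lra.
  rewrite !addr0; apply: (slot_term_moment_mixed q4 tE mM xq jq) => //; first by apply/eqP => e; apply: ll.
  by rewrite negb_and; apply/orP; right; apply/eqP.
have one (c : nat) : \sum_(l' < n) (if (l' : nat) == c then 8 * t ^+ 3 else 0) <= 8 * t ^+ 3.
  have [cn|cn] := ltnP c n.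
    rewrite (bigD1 (Ordinal cn)) //= eqxx big1 ?addr0 // => i ic.
    by rewrite (_ : (i : nat) == c = false) //; apply: contraNF ic => /eqP h'; apply/eqP/val_inj.
  by rewrite big1 // => i _; rewrite (_ : (i : nat) == c = false) //; have := ltn_ord i; lia.
apply: (@le_trans _ _ (\sum_(l < n) (32 * t ^+ 5 * N + 16 * t ^+ 3))).
  apply: ler_sum => l _; apply: (le_trans (ler_sum _ (fun l' _ => h l l'))).
  rewrite !big_split /= sumr_const card_ord -[_ *+ n]mulr_natr lerD2l.
  by have := one l; have := one (partner l); lra.
by rewrite sumr_const card_ord -[leLHS]mulr_natr mulrDl -mulrA -expr2.
Qed.

Hypothesis tN : 1 <= t ^+ 2 * N.

Lemma slotcoef_fourth : EX (fun E => slotdiff E x j ^+ 2 * slotcoef E x j ^+ 4)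
  <= 39 * 10 ^+ 3 * (t ^+ 5 * N ^+ 2).
Proof.
rewrite (@eq_ue _ _ S _ (fun E => 81 * (slotdiff E x j ^+ 2 * (\sum_(l < n) term x j l E) ^+ 4))); last first.
  move=> E; rewrite inE => /andP[sE _]; rewrite (slotcoefE q4 tE mM xq jq sE) exprMn; ring.
rewrite ueZ; have h := fourth_moment q4 tE mM xq jq; have h' := sum_slot_term_moments.
have : t ^+ 3 * N * 1 <= t ^+ 3 * N * (t ^+ 2 * N) by rewrite ler_wpM2l // mulr_ge0 ?exprn_ge0.
have -> : t ^+ 3 * N * (t ^+ 2 * N) = t ^+ 5 * N ^+ 2 by ring.
have {}h' : \sum_(l < n) \sum_(l' < n) EX (fun E => slotdiff E x j ^+ 2 * term x j l E ^+ 2 * term x j l' E ^+ 2)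
    <= 32 * (t ^+ 5 * N ^+ 2) + 16 * (t ^+ 3 * N).
  by apply: (le_trans h'); rewrite !mulrA.
rewrite mulr1.
set a := t ^+ 5 * N ^+ 2 in h' *; set b := t ^+ 3 * N in h' *; move=> ab.
have a0 : 0 <= a by rewrite mulr_ge0 ?exprn_ge0.
move: h h'; set B := \sum_(l < n) _; set C := EX _ => h h'.
lra.
Qed.

Lemma slotcoef_second_le : EX (fun E => slotdiff E x j ^+ 2 * slotcoef E x j ^+ 2) <= 72 * (t ^+ 3 * N).
Proof.
rewrite (@eq_ue _ _ S _ (fun E => 9 * (slotdiff E x j ^+ 2 * (\sum_(l < n) term x j l E) ^+ 2))); last first.
  move=> E; rewrite inE => /andP[sE _]; rewrite (slotcoefE q4 tE mM xq jq sE) exprMn; ring.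
rewrite ueZ (second_moment q4 tE mM xq jq).
have : \sum_(l < n) EX (fun E => slotdiff E x j ^+ 2 * term x j l E ^+ 2) <= \sum_(l < n) 8 * t ^+ 3.
  by apply: ler_sum => l _; apply: (slot_term_moment q4 tE mM xq jq).
rewrite sumr_const card_ord -[X in _ <= X]mulr_natr; lra.
Qed.

Hypotheses (m4 : (4 <= m)%N) (m2 : (2 * m <= #|pairs k|)%N).

(** It is enough that [x] and [l] are adjacent, and that both are adjacent to
    the same end of the slot and not to the other: three present and two absent
    edges. *)
Lemma slot_term_moment_ge l : (3 * q <= l)%N -> (l < n)%N ->
  t ^+ 3 / 32 <= EX (fun E => slotdiff E x j ^+ 2 * term x j l E ^+ 2).
Proof.
move=> ql ln.
have fn : (first j < n)%N by rewrite /fst_end; lia.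
have sn : (second j < n)%N by rewrite /snd_end; lia.
have xn : (x < n)%N by lia.
pose J := [set edge k x (first j); edge k x l; edge k (first j) l].
pose L := [set edge k x (second j); edge k (second j) l].
have JP : J \subset pairs k.
  rewrite /J !finset.subUset !finset.sub1set !edge_pairs // /fst_end; lia.
have LP : L \subset pairs k.
  rewrite /L !finset.subUset !finset.sub1set !edge_pairs // /snd_end; lia.
have e12 : edge k x (first j) != edge k x l by clear -q4 xq jq ql ln fn sn xn; apply: edge_neq => //; rewrite /same_edge /fst_end; lia.
have e13 : edge k x (first j) != edge k (first j) l by clear -q4 xq jq ql ln fn sn xn; apply: edge_neq => //; rewrite /same_edge /fst_end; lia.
have e23 : edge k x l != edge k (first j) l by clear -q4 xq jq ql ln fn sn xn; apply: edge_neq => //; rewrite /same_edge /fst_end; lia.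
have f12 : edge k x (second j) != edge k (second j) l by clear -q4 xq jq ql ln fn sn xn; apply: edge_neq => //; rewrite /same_edge /snd_end; lia.
have g1 : edge k x (first j) != edge k x (second j).
  by clear -q4 xq jq ql ln fn sn xn; apply: edge_neq => //; rewrite /same_edge /fst_end /snd_end; lia.
have g2 : edge k x (first j) != edge k (second j) l.
  by clear -q4 xq jq ql ln fn sn xn; apply: edge_neq => //; rewrite /same_edge /fst_end /snd_end; lia.
have g3 : edge k x l != edge k x (second j).
  by clear -q4 xq jq ql ln fn sn xn; apply: edge_neq => //; rewrite /same_edge /fst_end /snd_end; lia.
have g4 : edge k x l != edge k (second j) l.
  by clear -q4 xq jq ql ln fn sn xn; apply: edge_neq => //; rewrite /same_edge /fst_end /snd_end; lia.
have g5 : edge k (first j) l != edge k x (second j).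
  by clear -q4 xq jq ql ln fn sn xn; apply: edge_neq => //; rewrite /same_edge /fst_end /snd_end; lia.
have g6 : edge k (first j) l != edge k (second j) l.
  by clear -q4 xq jq ql ln fn sn xn; apply: edge_neq => //; rewrite /same_edge /fst_end /snd_end; lia.
have cJ : #|J| = 3%N.
  rewrite /J finset.setUC cardsU1 cards2 !inE negb_or e12.
  by rewrite (eq_sym _ (edge k x (first j))) e13 (eq_sym _ (edge k x l)) e23.
have cL : #|L| = 2%N by rewrite /L cards2 f12.
have JL : [disjoint J & L].
  rewrite disjoint_subset; apply/subsetP => e; rewrite !inE => /orP[/orP[]|] /eqP ->.
  - by rewrite negb_or g1 g2.
  - by rewrite negb_or g3 g4.
  - by rewrite negb_or g5 g6.
rewrite {1}tE; apply: le_trans (ue_pattern_ge R mM m4 m2 JP LP JL cJ cL) _.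
apply: ue_le => E _; rewrite /pattern; case: (boolP (_ && _)) => [/andP[/subsetP JE LE]|_]; last first.
  by rewrite -exprMn sqr_ge0.
have A1 u v : edge k u v \in J -> A E u v = 1 by move=> /JE; rewrite /adjR /bit => ->.
have A0 u v : edge k u v \in L -> A E u v = 0.
  by move=> h; rewrite /adjR /bit (disjointFl LE h).
have h1 : A E x (first j) = 1 by apply: A1; rewrite !inE eqxx.
have h2 : A E x l = 1 by apply: A1; rewrite !inE eqxx orbT.
have h3 : A E (first j) l = 1 by apply: A1; rewrite !inE eqxx !orbT.
have h4 : A E x (second j) = 0 by apply: A0; rewrite !inE eqxx.
have h5 : A E (second j) l = 0 by apply: A0; rewrite !inE eqxx orbT.
have fl : outer_vertex j l by clear -q4 xq jq ql ln; rewrite /outer_vertex_of /fst_end /snd_end; lia.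
have kE : evenpart E x l = 1.
  by rewrite evenpart_nonslot ?h2 //; clear -q4 xq jq ql ln; rewrite /in_left /in_right; lia.
by rewrite /slotdiff /slot_term /pairdev fl h1 h4 h3 h5 kE !subr0 !mulr1 !expr1n mulr1.
Qed.

Lemma slotcoef_second_ge : 9 / 128 * (t ^+ 3 * N) <= EX (fun E => slotdiff E x j ^+ 2 * slotcoef E x j ^+ 2).
Proof.
rewrite (@eq_ue _ _ S _ (fun E => 9 * (slotdiff E x j ^+ 2 * (\sum_(l < n) term x j l E) ^+ 2))); last first.
  move=> E; rewrite inE => /andP[sE _]; rewrite (slotcoefE q4 tE mM xq jq sE) exprMn; ring.
rewrite ueZ (second_moment q4 tE mM xq jq).
have p0 l : 0 <= EX (fun E => slotdiff E x j ^+ 2 * term x j l E ^+ 2).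
  by apply: ue_ge0 => E _; rewrite -exprMn sqr_ge0.
have t3 : 0 <= t ^+ 3 by rewrite exprn_ge0.
have : \sum_(l < n | (3 * q <= l)%N) t ^+ 3 / 32 <= \sum_(l < n) EX (fun E => slotdiff E x j ^+ 2 * term x j l E ^+ 2).
  rewrite [leLHS]big_mkcond; apply: ler_sum => l _; case: ifP => // ql.
  exact: slot_term_moment_ge.
have -> : \sum_(l < n | (3 * q <= l)%N) t ^+ 3 / 32 = (n - 3 * q)%:R * (t ^+ 3 / 32).
  rewrite big_mkcond (sum_classes q4 (fun l => if (3 * q <= l)%N then t ^+ 3 / 32 else 0)).
  rewrite [X in X + _ + _]big1 => [|i _]; last first.
    by have -> : (3 * q <= i)%N = false by have := ltn_ord i; lia.
  rewrite [X in _ + X + _]big1 => [|i _]; last first.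
    have h1 : (3 * q <= first i)%N = false by rewrite /fst_end; have := ltn_ord i; lia.
    have h2 : (3 * q <= second i)%N = false by rewrite /snd_end; have := ltn_ord i; lia.
    by rewrite h1 h2 addr0.
  rewrite !add0r (eq_bigr (fun=> t ^+ 3 / 32)) => [|i _]; last by rewrite leq_addr.
  by rewrite sumr_const card_ord mulr_natl.
set B := \sum_(l < n) _.
have hn : N / 4 <= (n - 3 * q)%:R.
  by rewrite ler_pdivrMr // -natrM ler_nat; lia.
have := ler_wpM2r t3 hn; lra.
Qed.

End OneSlot.
End SlotcoefMoments.

(** From moments to the mean absolute value, through
    [|y| >= y^2 / K - y^4 / K^3]. *)
Lemma abs_moment_lower (R : realType) (T : finType) (S : {set T}) (z y : T -> R) (K : R) : 0 < K ->
  K^-1 * unif_expect S (fun x => z x ^+ 2 * y x ^+ 2) - K^-1 ^+ 3 * unif_expect S (fun x => z x ^+ 2 * y x ^+ 4)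
  <= unif_expect S (fun x => z x ^+ 2 * `|y x|).
Proof.
move=> K0; have K0' : K != 0 by rewrite gt_eqF.
rewrite -!ueZ -ueB; apply: ue_le => x _.
pose u := `|y x| / K.
have u0 : 0 <= u by rewrite divr_ge0 // ltW.
have yE : `|y x| = K * u by rewrite /u mulrCA mulfV // mulr1.
have y2 : y x ^+ 2 = (K * u) ^+ 2 by rewrite -yE real_normK ?num_real.
have y4 : y x ^+ 4 = (K * u) ^+ 4 by rewrite -[4%N]/(2 * 2)%N !exprM y2.
rewrite y4 y2 yE.
have -> : K^-1 * (z x ^+ 2 * (K * u) ^+ 2) - K^-1 ^+ 3 * (z x ^+ 2 * (K * u) ^+ 4)
   = z x ^+ 2 * K * (u ^+ 2 - u ^+ 4) by field.
rewrite mulrA; apply: ler_wpM2l; first by apply: mulr_ge0; [apply: sqr_ge0|apply: ltW].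
have [u1|u1] := lerP u 1.
  have : u ^+ 2 <= u by rewrite expr2 ler_piMr.
  have : 0 <= u ^+ 4 by rewrite exprn_ge0.
  lra.
have : u ^+ 2 * 1 <= u ^+ 2 * u ^+ 2.
  by apply: ler_wpM2l; [apply: sqr_ge0|rewrite exprn_ege1 // ltW].
have -> : u ^+ 4 = u ^+ 2 * u ^+ 2 by ring.
lra.
Qed.

(** The truncation level [K] is the square root of the ratio between fourth
    and second moment, up to a constant that makes the difference positive. *)
Lemma abs_constants (R : realType) (t r K : R) : 0 < t -> 0 < r -> K = 2 * 10 ^+ 3 * (t * r) ->
  K^-1 * (9 / 128 * (t ^+ 3 * r ^+ 2)) - K^-1 ^+ 3 * (39 * 10 ^+ 3 * (t ^+ 5 * r ^+ 2 ^+ 2))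
   >= 3 / 10 ^+ 5 * (t ^+ 2 * r).
Proof.
move=> t0 r0; set c : R := 10 ^+ 3; move=> KE.
have c0 : c != 0 by rewrite expf_neq0.
have -> : K^-1 * (9 / 128 * (t ^+ 3 * r ^+ 2)) = 9 / 256 / c * (t ^+ 2 * r).
  by rewrite KE; clearbody c; field; rewrite c0 !gt_eqF.
have -> : K^-1 ^+ 3 * (39 * c * (t ^+ 5 * r ^+ 2 ^+ 2)) = 39 / 8 / c ^+ 2 * (t ^+ 2 * r).
  by rewrite KE; clearbody c; field; rewrite c0 !gt_eqF.
have p0 : 0 <= t ^+ 2 * r by rewrite mulr_ge0 ?exprn_ge0 // ltW.
have -> : 10 ^+ 5 = c * 100 :> R by rewrite /c; ring.
rewrite -mulrBl ler_wpM2r //.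
have cp : 0 < c by rewrite exprn_gt0.
have c1 : 900 <= c by rewrite /c; lra.
have ci : c * c^-1 = 1 by rewrite mulfV.
have i0 : 0 < c^-1 by rewrite invr_gt0.
have -> : 3 / (c * 100) = 3 / 100 * c^-1 by clearbody c; field.
have -> : 9 / 256 / c - 39 / 8 / c ^+ 2 = (9 / 256 - 39 / 8 * c^-1) * c^-1.
  by clearbody c; field.
rewrite ler_wpM2r ?(ltW i0) //.
have : c^-1 * 999 <= 1.
  by rewrite -ci mulrC ler_wpM2r ?(ltW i0) // /c; lra.
lra.
Qed.

Section SlotcoefAbs.
Variables (R : realType) (k q m : nat) (t : R).
Notation n := k.+1.
Notation N := (n%:R : R).
Hypothesis q4 : (4 * q <= n)%N.
Hypothesis tE : t = m%:R / #|pairs k|%:R.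
Hypothesis mM : (m <= #|pairs k|)%N.
Implicit Types (E : {set {set 'I_n}}) (u v w : nat).
Notation slotdiff := (@slotdiff R k q).
Notation slotcoef := (@slotcoef R k q).
Notation S := (draws (pairs k) m).
Notation EX := (unif_expect (R := R) S).

Let t0 : 0 <= t. Proof. by rewrite tE divr_ge0. Qed.

Section OneSlot.
Variables (x j : nat).
Hypotheses (xq : (x < q)%N) (jq : (j < q)%N).

Hypothesis tN : 1 <= t ^+ 2 * N.
Hypotheses (m4 : (4 <= m)%N) (m2 : (2 * m <= #|pairs k|)%N).

Lemma slotcoef_abs_ge : 3 / 10 ^+ 5 * (t ^+ 2 * Num.sqrt N)
   <= EX (fun E => slotdiff E x j ^+ 2 * `|slotcoef E x j|).
Proof.
have tp : 0 < t.
  rewrite lt_neqAle t0 andbT eq_sym; apply: contraTneq tN => ->.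
  by rewrite expr0n mul0r -ltNge.
set r := Num.sqrt N.
have r2 : r ^+ 2 = N by rewrite sqr_sqrtr.
have rp : 0 < r by rewrite sqrtr_gt0.
have K0 : 0 < 2 * 10 ^+ 3 * (t * r) by rewrite !mulr_gt0 ?exprn_gt0.
apply: le_trans (abs_moment_lower S (fun E => slotdiff E x j) (fun E => slotcoef E x j) K0).
apply: (le_trans (abs_constants tp rp erefl)); rewrite r2.
apply: lerB; apply: ler_wpM2l.
- by rewrite invr_ge0 ltW.
- exact: (slotcoef_second_ge q4 tE mM xq jq).
- by rewrite exprn_ge0 // invr_ge0 ltW.
- exact: (slotcoef_fourth q4 tE mM xq jq).
Qed.

End OneSlot.
End SlotcoefAbs.

(** * Moments of the quadratic coefficients *)

Section VarianceBounds.
Variables (R : realType) (k q m : nat) (t : R).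
Notation n := k.+1.
Notation N := (n%:R : R).
Hypothesis q4 : (4 * q <= n)%N.
Hypothesis tE : t = m%:R / #|pairs k|%:R.
Hypothesis mM : (m <= #|pairs k|)%N.
Implicit Types (E : {set {set 'I_n}}) (u v w : nat).
Notation A := (@adjR R k).
Notation first := (fst_end q).
Notation second := (snd_end q).
Notation S := (draws (pairs k) m).
Notation EX := (unif_expect (R := R) S).
Notation slot_block := (slot_pairs q).
Notation block_sum := (@block_sum R k).
Notation I := ('I_q * 'I_q)%type.
Notation zI := (@slot_sign R k q).
Notation cI := (@slot_quadratic R k q).

Let t0 : 0 <= t. Proof. by rewrite tE divr_ge0. Qed.

(** The slots that meet in the quadratic part: those with the same vertex in
    the first class, or with the same pair in the second. *)
Definition related (x j x' j' : nat) := ((x == x') && (j != j')) || ((x != x') && (j == j')).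
Definition coef_block (x j x' j' : nat) :=
  if x == x' then [:: (first j, first j'); (first j, second j'); (second j, first j'); (second j, second j')]
  else [:: (x, x')].

Lemma slot_quadratic_unrelated (i i' : I) E : ~~ related i.1 i.2 i'.1 i'.2 -> cI i i' E = 0.
Proof.
rewrite /related /slot_quadratic -!(inj_eq val_inj) /=; case: eqP => h1 /=; case: eqP => h2 //=.
Qed.

Lemma slot_quadratic_le (i i' : I) E : `|cI i i' E| <= 3 / 2 * block_sum E (coef_block i.1 i.2 i'.1 i'.2).
Proof.
rewrite /slot_quadratic -!(inj_eq val_inj) /= /coef_block /block_sum.
have c32 : 0 <= (3 / 2 : R) by lra.
case: (_ == _); last first.
  rewrite big_cons big_nil addr0 /=; case: (_ == _); last by rewrite normr0 mulr_ge0 // adjR_ge0.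
  by rewrite ger0_norm // mulr_ge0 // adjR_ge0.
rewrite !big_cons big_nil addr0 /=; set a1 := A E _ _; set a2 := A E _ _; set a3 := A E _ _; set a4 := A E _ _.
have h1 : 0 <= a1 by apply: adjR_ge0. have h2 : 0 <= a2 by apply: adjR_ge0.
have h3 : 0 <= a3 by apply: adjR_ge0. have h4 : 0 <= a4 by apply: adjR_ge0.
case: (_ == _); first by rewrite normr0; lra.
by rewrite /pairdiff -/a1 -/a2 -/a3 -/a4 ler_norml; apply/andP; split; lra.
Qed.

Lemma slot_quadratic_le6 (i i' : I) E : `|cI i i' E| <= 6.
Proof.
apply: (le_trans (slot_quadratic_le i i' E)); rewrite /coef_block /block_sum; case: (_ == _).
  rewrite !big_cons big_nil /=; set a1 := A E _ _; set a2 := A E _ _; set a3 := A E _ _; set a4 := A E _ _.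
  have h1 : a1 <= 1 by apply: adjR_le1. have h2 : a2 <= 1 by apply: adjR_le1.
  have h3 : a3 <= 1 by apply: adjR_le1. have h4 : a4 <= 1 by apply: adjR_le1.
  lra.
rewrite big_cons big_nil /=; set a1 := A E _ _; have h1 : a1 <= 1 by apply: adjR_le1.
lra.
Qed.

Let size_coef x j x' j' : (size (coef_block x j x' j'))%:R * t <= 4 * t.
Proof. by rewrite /coef_block; case: (_ == _); apply: ler_wpM2r => //; rewrite ler_nat. Qed.

Lemma slot_sign_le (i : I) E : zI i E ^+ 2 <= block_sum E (slot_block i.1 i.2).
Proof. exact: slotdiff_le. Qed.

(** Three edges have to be present: one in each of the two slots, and one in
    the coefficient. *)
Lemma pair_moment (i i' : I) : related i.1 i.2 i'.1 i'.2 ->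
  EX (fun E => `|cI i i' E| * zI i E ^+ 2 * zI i' E ^+ 2) <= 24 * t ^+ 3.
Proof.
case: i i' => x j [x' j'] /= rel.
apply: (@le_trans _ _ (3 / 2 * EX (fun E => \prod_(b <- [:: coef_block x j x' j'; slot_block x j; slot_block x' j']) block_sum E b))).
  rewrite -ueZ; apply: ue_le => E _; rewrite !big_cons big_nil mulr1 mulrA -[leLHS]mulrA.
  apply: ler_pM => //; [by rewrite -exprMn sqr_ge0|exact: (slot_quadratic_le (x, j) (x', j'))|].
  apply: ler_pM; rewrite ?sqr_ge0 //; [exact: (slot_sign_le (x, j))|exact: (slot_sign_le (x', j'))].
have -> : 24 * t ^+ 3 = 3 / 2 * (4 * t * (2 * t * (2 * t))) by field.
rewrite ler_pM2l; last by lra.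
apply: le_trans (ue_vertex_blocks tE mM _ _) _.
- have xq := ltn_ord x; have jq := ltn_ord j; have xq' := ltn_ord x'; have jq' := ltn_ord j'.
  move: rel; rewrite /related /coef_block /slot_pairs /valid_edge /fst_end /snd_end.
  move: (x : nat) (j : nat) (x' : nat) (j' : nat) xq jq xq' jq' => {}x {}j {}x' {}j' xq jq xq' jq'.
  clear -q4 xq jq xq' jq'.
  by case: (eqVneq x x') => h rel /=; rewrite ?andbT; repeat (apply/andP; split => //); lia.
- have xq := ltn_ord x; have jq := ltn_ord j; have xq' := ltn_ord x'; have jq' := ltn_ord j'.
  move: rel; rewrite /related /coef_block /slot_pairs /separate /same_edge /fst_end /snd_end.
  move: (x : nat) (j : nat) (x' : nat) (j' : nat) xq jq xq' jq' => {}x {}j {}x' {}j' xq jq xq' jq'.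
  clear -q4 xq jq xq' jq'.
  by case: (eqVneq x x') => h rel /=; rewrite ?andbT; repeat (apply/andP; split => //); lia.
rewrite !big_cons big_nil /= mulr1; apply: ler_wpM2r; first by rewrite !mulr_ge0.
exact: size_coef.
Qed.

(** Two different slots related to the same third one: five distinct edges. *)
Lemma triple_moment (i i' i'' : I) : related i.1 i.2 i'.1 i'.2 -> related i.1 i.2 i''.1 i''.2 -> i' != i'' ->
  EX (fun E => zI i E ^+ 2 * (`|cI i i' E| * zI i' E ^+ 2) * (`|cI i i'' E| * zI i'' E ^+ 2)) <= 288 * t ^+ 5.
Proof.
case: i i' i'' => x j [x' j'] [x'' j''] /= rel rel' ne.
have {}ne : (x' != x'' :> nat) || (j' != j'' :> nat).
  by rewrite -negb_and; apply: contra ne => /andP[/eqP/val_inj -> /eqP/val_inj ->].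
apply: (@le_trans _ _ (9 / 4 * EX (fun E => \prod_(b <- [:: slot_block x j; coef_block x j x' j'; slot_block x' j';
    coef_block x j x'' j''; slot_block x'' j'']) block_sum E b))).
  rewrite -ueZ; apply: ue_le => E _; rewrite !big_cons big_nil mulr1.
  set b0 := block_sum E (slot_block x j); set b1 := block_sum E (coef_block x j x' j').
  set b2 := block_sum E (slot_block x' j'); set b3 := block_sum E (coef_block x j x'' j'').
  set b4 := block_sum E (slot_block x'' j'').
  have -> : 9 / 4 * (b0 * (b1 * (b2 * (b3 * b4)))) = b0 * (3 / 2 * b1 * b2) * (3 / 2 * b3 * b4) by field.
  have c0 z c : 0 <= `|c| * z ^+ 2 :> R by rewrite mulr_ge0 ?sqr_ge0.
  have m1 : `|cI (x, j) (x', j') E| * zI (x', j') E ^+ 2 <= 3 / 2 * b1 * b2.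
    by apply: ler_pM; rewrite ?sqr_ge0 //; [exact: (slot_quadratic_le (x, j) (x', j'))|exact: (slot_sign_le (x', j'))].
  have m2 : `|cI (x, j) (x'', j'') E| * zI (x'', j'') E ^+ 2 <= 3 / 2 * b3 * b4.
    by apply: ler_pM; rewrite ?sqr_ge0 //; [exact: (slot_quadratic_le (x, j) (x'', j''))|exact: (slot_sign_le (x'', j''))].
  apply: ler_pM => //; first by apply: mulr_ge0 => //; apply: sqr_ge0.
  by apply: ler_pM => //; [apply: sqr_ge0|exact: (slot_sign_le (x, j))].
have -> : 288 * t ^+ 5 = 9 / 4 * (2 * t * (4 * t * (2 * t * (4 * t * (2 * t))))) by field.
rewrite ler_pM2l; last by lra.
apply: le_trans (ue_vertex_blocks tE mM _ _) _.
- have xq := ltn_ord x; have jq := ltn_ord j; have xq' := ltn_ord x'; have jq' := ltn_ord j'.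
  have xq'' := ltn_ord x''; have jq'' := ltn_ord j''.
  move: rel rel' ne; rewrite /related /coef_block /slot_pairs /valid_edge /fst_end /snd_end.
  move: (x : nat) (j : nat) (x' : nat) (j' : nat) (x'' : nat) (j'' : nat) xq jq xq' jq' xq'' jq''
    => {}x {}j {}x' {}j' {}x'' {}j'' xq jq xq' jq' xq'' jq''.
  clear -q4 xq jq xq' jq' xq'' jq''.
  by case: (eqVneq x x') => h; case: (eqVneq x x'') => h' rel rel' ne /=; rewrite ?andbT;
    repeat (apply/andP; split => //); lia.
- have xq := ltn_ord x; have jq := ltn_ord j; have xq' := ltn_ord x'; have jq' := ltn_ord j'.
  have xq'' := ltn_ord x''; have jq'' := ltn_ord j''.
  move: rel rel' ne; rewrite /related /coef_block /slot_pairs /separate /same_edge /fst_end /snd_end.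
  move: (x : nat) (j : nat) (x' : nat) (j' : nat) (x'' : nat) (j'' : nat) xq jq xq' jq' xq'' jq''
    => {}x {}j {}x' {}j' {}x'' {}j'' xq jq xq' jq' xq'' jq''.
  clear -q4 xq jq xq' jq' xq'' jq''.
  by case: (eqVneq x x') => h; case: (eqVneq x x'') => h' rel rel' ne /=; rewrite ?andbT;
    repeat (apply/andP; split => //); lia.
rewrite !big_cons big_nil /= mulr1.
have p b : 0 <= (size b)%:R * t by move=> *; rewrite mulr_ge0.
have t2 : 0 <= 2 * t by rewrite mulr_ge0.
apply: ler_wpM2l => //; apply: ler_pM => //; first by rewrite !mulr_ge0.
apply: ler_wpM2l => //; apply: ler_wpM2r => //.
Qed.

End VarianceBounds.

(** * Size of the drift and of the error terms *)

Section DriftBounds.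
Variables (R : realType) (k q m : nat) (t : R).
Notation n := k.+1.
Notation N := (n%:R : R).
Notation Q := (q%:R : R).
Hypothesis q4 : (4 * q <= n)%N.
Hypothesis tE : t = m%:R / #|pairs k|%:R.
Hypothesis mM : (m <= #|pairs k|)%N.
Implicit Types (E : {set {set 'I_n}}).
Notation S := (draws (pairs k) m).
Notation EX := (unif_expect (R := R) S).
Notation I := ('I_q * 'I_q)%type.
Notation zI := (@slot_sign R k q).
Notation aI := (@slot_linear R k q).
Notation cI := (@slot_quadratic R k q).

Let t0 : 0 <= t. Proof. by rewrite tE divr_ge0. Qed.

(** Distinct slots use distinct pairs of vertices, so the nonzero coordinates
    can be charged to distinct edges of the graph. *)
Lemma sum_slot_sign_sqr_le E : E \in S -> \sum_i zI i E ^+ 2 <= m%:R.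
Proof.
rewrite inE => /andP[_ /eqP <-].
pose e (p : I * bool) := edge k p.1.1 (if p.2 then fst_end q p.1.2 else snd_end q p.1.2).
have einj : injective e.
  move=> [[x j] b] [[x' j'] b']; rewrite /e /= => h.
  have xq := ltn_ord x; have jq := ltn_ord j; have xq' := ltn_ord x'; have jq' := ltn_ord j'.
  have hh : [/\ x = x' :> nat, j = j' :> nat & b = b'].
    have := @edge_eq k _ _ _ _ _ _ _ _ h; rewrite /fst_end /snd_end.
    move: xq jq xq' jq'; clear -q4; move: (x : nat) (j : nat) (x' : nat) (j' : nat) => {}x {}j {}x' {}j'.
    by case: b; case: b' => xq jq xq' jq' hh; (have [||||[]|[]] := hh; try lia);
      move=> *; split; solve [reflexivity | lia | exfalso; lia].
  by case: hh => /val_inj -> /val_inj -> ->.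
apply: (@le_trans _ _ (\sum_(p : I * bool) (e p \in E)%:R)).
  rewrite -(pair_bigA _ (fun i b => (e (i, b) \in E)%:R : R)) /=; apply: ler_sum => i _.
  by apply: (le_trans (slot_sign_le R i E)); rewrite big_bool /block_sum /slot_pairs !big_cons big_nil addr0 /adjR /bit /e.
rewrite -natr_sum ler_nat -big_mkcond /= sum1dep_card -(card_imset _ einj).
by apply/subset_leq_card/subsetP => f /imsetP[p]; rewrite inE => pE ->.
Qed.

Lemma lin_moment_le : lin_moment S zI aI <= Q ^+ 2 * (72 * (t ^+ 3 * N)).
Proof.
rewrite /lin_moment ue_sum; apply: (@le_trans _ _ (\sum_(i : I) 72 * (t ^+ 3 * N))).
  by apply: ler_sum => i _; apply: (slotcoef_second_le q4 tE mM).
by rewrite sumr_const card_prod card_ord -[leLHS]mulr_natl natrM expr2.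
Qed.

Notation rel i i' := (related i.1 i.2 i'.1 i'.2).

Lemma sum_related (i : I) : \sum_(i' : I) (rel i i')%:R <= 2 * Q.
Proof.
apply: (@le_trans _ _ (\sum_(i' : I) ((i'.1 == i.1)%:R + (i'.2 == i.2)%:R))).
  apply: ler_sum => i' _; rewrite /related !val_eqE !(eq_sym i.1) !(eq_sym i.2).
  by case: (_ == _); case: (_ == _); rewrite /= ?addr0 ?add0r ?lexx ?ler01 // ler_wpDl.
have one (x : 'I_q) : \sum_(y < q) (y == x)%:R = 1 :> R.
  by rewrite (bigD1 x) //= eqxx big1 ?addr0 // => y /negPf ->.
rewrite big_split /= -(pair_bigA _ (fun x j => (x == i.1)%:R : R)) -(pair_bigA _ (fun x j => (j == i.2)%:R : R)) /=.
have -> : \sum_(x < q) \sum_(j < q) (j == i.2)%:R = Q by under eq_bigr => x _ do rewrite one; rewrite sumr_const card_ord.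
rewrite exchange_big /=.
have -> : \sum_(j < q) \sum_(x < q) (x == i.1)%:R = Q by under eq_bigr => x _ do rewrite one; rewrite sumr_const card_ord.
by rewrite mulr_natl.
Qed.

Lemma pair_moment_all (i i' : I) :
  EX (fun E => `|cI i i' E| * zI i E ^+ 2 * zI i' E ^+ 2) <= (rel i i')%:R * (24 * t ^+ 3).
Proof.
case: (boolP (rel i i')) => r; first by rewrite mul1r (pair_moment q4 tE mM).
rewrite mul0r (@eq_ue _ _ S _ (fun=> 0)) ?ue_cst ?card_draws_gt0 // => E _.
by rewrite slot_quadratic_unrelated // normr0 !mul0r.
Qed.

Lemma shift_moment_le : shift_moment S zI cI <= 48 * Q ^+ 3 * t ^+ 3.
Proof.
rewrite /shift_moment ue_sum; apply: (@le_trans _ _ (\sum_(i : I) 2 * Q * (24 * t ^+ 3))); last first.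
  by rewrite sumr_const card_prod card_ord -[leLHS]mulr_natl natrM; lra.
apply: ler_sum => i _; rewrite ue_sum; apply: (le_trans (ler_sum _ (fun i' _ => pair_moment_all i i'))).
by rewrite -mulr_suml ler_wpM2r ?sum_related // mulr_ge0 // exprn_ge0.
Qed.

Lemma quad_moment_le : quad_moment S zI cI <= 288 * Q ^+ 3 * t ^+ 3.
Proof.
apply: (@le_trans _ _ (6 * shift_moment S zI cI)); last by have := shift_moment_le; lra.
rewrite /quad_moment /shift_moment -ueZ; apply: ue_le => E _; rewrite mulr_sumr; apply: ler_sum => i _.
rewrite mulr_sumr; apply: ler_sum => i' _.
rewrite -mulrA [leRHS](_ : _ = 6 * `|cI i i' E| * (zI i E ^+ 2 * zI i' E ^+ 2)); last by ring.
apply: ler_wpM2r; first by rewrite -exprMn sqr_ge0.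
rewrite -real_normK ?num_real // expr2; apply: ler_wpM2r => //; exact: slot_quadratic_le6.
Qed.

(** The first summand comes from pairs of different slots related to the same
    one, the second from the diagonal, where only three edges are involved. *)
Lemma cross_moment_le : cross_moment S zI cI <= 1152 * Q ^+ 4 * t ^+ 5 + 288 * Q ^+ 3 * t ^+ 3.
Proof.
pose w (i i' : I) E := `|cI i i' E| * zI i' E ^+ 2.
have w_unrel (i i' : I) E : ~~ rel i i' -> w i i' E = 0.
  by move=> r; rewrite /w slot_quadratic_unrelated // normr0 mul0r.
have t3 : 0 <= t ^+ 3 by rewrite exprn_ge0. have t5 : 0 <= t ^+ 5 by rewrite exprn_ge0.
have ez0 (i : I) (f : {set {set 'I_n}} -> R) : (forall E, f E = 0) -> EX f = 0.
  by move=> f0; rewrite (@eq_ue _ _ S _ (fun=> 0)) ?ue_cst ?card_draws_gt0.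
have off (i i' i'' : I) : EX (fun E => zI i E ^+ 2 * (w i i' E * w i i'' E))
    <= (rel i i')%:R * (rel i i'')%:R * (288 * t ^+ 5) + (i' == i'')%:R * ((rel i i')%:R * (144 * t ^+ 3)).
  case: (boolP (rel i i')) => r; last first.
    by rewrite ez0 ?mul0r ?mulr0 ?addr0 // => E; rewrite w_unrel // mul0r mulr0.
  have [<-|ne] := eqVneq i' i''.
    rewrite r !mul1r; apply: (@le_trans _ _ (144 * t ^+ 3)); last by lra.
    apply: (@le_trans _ _ (6 * EX (fun E => `|cI i i' E| * zI i E ^+ 2 * zI i' E ^+ 2))); last first.
      have := pair_moment q4 tE mM r; lra.
    rewrite -ueZ; apply: ue_le => E _; rewrite /w.
    have -> : zI i E ^+ 2 * (`|cI i i' E| * zI i' E ^+ 2 * (`|cI i i' E| * zI i' E ^+ 2))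
       = `|cI i i' E| * (`|cI i i' E| * zI i E ^+ 2 * (zI i' E ^+ 3 * zI i' E)) by ring.
    rewrite slot_sign_cube -expr2; apply: ler_wpM2r; last exact: slot_quadratic_le6.
    by apply: mulr_ge0; [apply: mulr_ge0; [exact: normr_ge0|]|]; exact: sqr_ge0.
  case: (boolP (rel i i'')) => r'; last first.
    by rewrite ez0 ?mulr0 ?mul0r ?addr0 // => E; rewrite (w_unrel i i'') // !mulr0.
  rewrite !mul1r mul0r addr0; apply: le_trans (triple_moment q4 tE mM r r' ne).
  by apply: ue_le => E _; rewrite /w !mulrA.
have diag (i' : I) (a : R) : \sum_i'' (i' == i'')%:R * a = a.
  by rewrite (bigD1 i') //= eqxx mul1r big1 ?addr0 // => j; rewrite eq_sym => /negPf ->; rewrite mul0r.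
have inner (i : I) : EX (fun E => zI i E ^+ 2 * (\sum_i' w i i' E) ^+ 2)
    <= (2 * Q) ^+ 2 * (288 * t ^+ 5) + 2 * Q * (144 * t ^+ 3).
  rewrite (@eq_ue _ _ S _ (fun E => \sum_i' \sum_i'' zI i E ^+ 2 * (w i i' E * w i i'' E))); last first.
    move=> E _; rewrite [(\sum_i' _) ^+ 2]expr2 big_distrlr /= mulr_sumr; apply: eq_bigr => i' _; exact: mulr_sumr.
  rewrite ue_sum; under eq_bigr => i' _ do rewrite ue_sum.
  apply: (le_trans (ler_sum _ (fun i' _ => ler_sum _ (fun i'' _ => off i i' i'')))).
  under eq_bigr => i' _.
    rewrite big_split /= -mulr_suml -mulr_sumr diag.
    over.
  rewrite big_split /= -!mulr_suml; apply: lerD; last by apply: ler_wpM2r; [apply: mulr_ge0; [lra|exact: t3]|exact: sum_related].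
  apply: ler_wpM2r; first by apply: mulr_ge0; [lra|exact: t5].
  rewrite expr2; apply: ler_pM; rewrite ?sumr_ge0 ?sum_related //.
rewrite /cross_moment ue_sum; apply: (le_trans (ler_sum _ (fun i _ => inner i))).
rewrite sumr_const card_prod card_ord -[leLHS]mulr_natl natrM; lra.
Qed.

Hypotheses (tN : 1 <= t ^+ 2 * N) (m4 : (4 <= m)%N) (m2 : (2 * m <= #|pairs k|)%N).
Notation drift := (tilt_drift zI aI).

Lemma drift_mean_ge : Q ^+ 2 * (3 / 10 ^+ 5 * (t ^+ 2 * Num.sqrt N)) <= EX drift.
Proof.
rewrite /drift ue_sum; apply: (@le_trans _ _ (\sum_(i : I) 3 / 10 ^+ 5 * (t ^+ 2 * Num.sqrt N))).
  by rewrite sumr_const card_prod card_ord -[leRHS]mulr_natl natrM expr2.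
by apply: ler_sum => i _; apply: (slotcoef_abs_ge q4 tE mM).
Qed.

(** Cauchy-Schwarz, as at most [m] of the signs are nonzero. *)
Lemma drift_second_le : EX (fun E => drift E ^+ 2) <= m%:R * (Q ^+ 2 * (72 * (t ^+ 3 * N))).
Proof.
apply: (@le_trans _ _ (m%:R * lin_moment S zI aI)); last by rewrite ler_wpM2l ?lin_moment_le.
rewrite /lin_moment -ueZ; apply: ue_le => E ES; rewrite /tilt_drift.
have -> : \sum_i zI i E ^+ 2 * `|aI i E| = \sum_i zI i E * (zI i E * `|aI i E|).
  by apply: eq_bigr => i _; rewrite mulrA -expr2.
apply: (le_trans (sum_cauchy_schwarz _ _ _)).
apply: ler_pM; [by apply: sumr_ge0 => i _; exact: sqr_ge0|by apply: sumr_ge0 => i _; exact: sqr_ge0|exact: sum_slot_sign_sqr_le|].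
by apply: ler_sum => i _; rewrite exprMn real_normK ?num_real.
Qed.
End DriftBounds.

(** * The mean fluctuation of the triangle count *)

Section SymmetrizedPart.
Variables (R : realType) (T : finType) (S : {set T}) (I : finType) (s : I -> T -> T).
Notation EX := (unif_expect (R := R) S).
Hypotheses (sS : forall i x, x \in S -> s i x \in S) (sK : forall i, involutive (s i)).
Notation inv_all := (invariant_all S s).
Variables (z : I -> T -> R) (F0 : T -> R) (a : I -> T -> R) (c : I -> I -> T -> R).
Hypothesis S0 : (0 < #|S|)%N.
Hypothesis z_odd : forall i x, x \in S -> z i (s i x) = - z i x.
Hypothesis z_inv : forall i j, i != j -> invariant_under S s i (z j).
Hypotheses (F0_inv : inv_all F0) (a_inv : forall i, inv_all (a i)).
Hypothesis c_inv : forall i j, inv_all (c i j).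
Hypothesis c_diag : forall i x, c i i x = 0.

(** The invariant part is the average of [F] over the orbits of the
    involutions, so by convexity its upper deviations are on average no larger
    than those of [F], which balance the lower deviations of [F]. *)
Lemma invariant_part_excess (F : T -> R) :
  (forall x, x \in S -> F x = F0 x + \sum_i z i x * a i x + \sum_i \sum_j c i j x * z i x * z j x) ->
  EX (fun x => Num.max (F0 x - EX F) 0) <= EX (fun x => Num.max (EX F - F x) 0).
Proof.
move=> FE; set f0 := EX F; pose P x : R := (f0 < F0 x)%R%:R.
have P_inv i x : x \in S -> P (s i x) = P x by move=> xS; rewrite /P F0_inv.
have odd0 : EX (fun x => P x * (F x - F0 x)) = 0.
  rewrite (@eq_ue _ _ S _ (fun x => \sum_i P x * (z i x * a i x) + \sum_i \sum_j P x * (c i j x * z i x * z j x))); last first.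
    move=> x xS; rewrite FE // -(addrA (F0 x)) [F0 x + _]addrC addrK mulrDr !mulr_sumr.
    by congr (_ + _); apply: eq_bigr => i _; rewrite mulr_sumr.
  rewrite ueD !ue_sum !big1 ?addr0 // => i _.
    rewrite ue_sum big1 // => j _; have [<-|ij] := eqVneq i j.
      by rewrite (@eq_ue _ _ S _ (fun=> 0)) ?ue_cst // => x _; rewrite c_diag !mul0r mulr0.
    apply: (@ue_odd _ _ _ (s i)) => [x xS|//|x xS]; first exact: sS.
    by rewrite P_inv // c_inv // z_odd // (z_inv ij) //; ring.
  apply: (@ue_odd _ _ _ (s i)) => [x xS|//|x xS]; first exact: sS.
  by rewrite P_inv // a_inv // z_odd //; ring.
have -> : EX (fun x => Num.max (F0 x - f0) 0) = EX (fun x => P x * (F x - f0)).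
  rewrite -[LHS]addr0 -[X in _ + X]odd0 -ueD; apply: eq_ue => x _; rewrite /P -subr_gt0.
  by case: ltP => h /=; ring.
have -> : EX (fun x => Num.max (f0 - F x) 0) = EX (fun x => Num.max (F x - f0) 0).
  apply: subr0_eq; rewrite -ueB (@eq_ue _ _ S _ (fun x => f0 - F x)) ?ueB ?ue_cst ?subrr // => x _.
  rewrite -[F x - f0]opprB; move: (f0 - F x) => y; case: (lerP y 0) => h.
    by rewrite (max_idPl _) ?oppr_ge0 // sub0r opprK.
  by rewrite (max_idPr _) ?subr0 // oppr_le0 ltW.
apply: ue_le => x _; rewrite /P; case: (_ < _); rewrite ?mul1r ?mul0r ?le_max ?lexx ?orbT //.
Qed.
End SymmetrizedPart.

Section Regime.
Variables (R : realType) (k m : nat) (t : R).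
Notation n := k.+1.
Notation N := (n%:R : R).
Notation L := (ln N).
Hypothesis n2 : (2 <= n)%N.
Hypothesis tE : t = m%:R / 'C(n, 2)%:R.
Hypothesis t2 : t <= 1 / 2.
Variable g : R.
Hypothesis g3 : 10 ^+ 3 <= g.
Hypothesis gN : g ^+ 10 * L <= t ^+ 2 * N.
Notation S := (draws (pairs k) m).
Notation EX := (unif_expect (R := R) S).

Let t0 : 0 <= t. Proof. by rewrite tE divr_ge0. Qed.
Let t1 : t <= 1. Proof. have := t2; lra. Qed.
Lemma scale_gt1 : 1 < g. Proof. by apply: lt_le_trans g3; rewrite exprn_egt1 //; lra. Qed.
Let g1 : 1 < g. Proof. exact: scale_gt1. Qed.
Let g0 : 0 < g. Proof. have := g1; lra. Qed.
Let tp : t ^+ 2 <= 1. Proof. by rewrite exprn_ile1. Qed.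

Lemma ln_ge_half : 1 / 2 <= L.
Proof.
have N0 : 0 < N by [].
have : N^-1 <= 2^-1 by rewrite lef_pV2 ?posrE // ler_nat.
have := @le_ln1Dx R (N^-1 - 1); rewrite addrCA subrr addr0 lnV ?posrE //.
have : 0 < N^-1 by rewrite invr_gt0.
move: (N^-1) (ln N) => y l h1 h2 h3; suff : - l <= y - 1 by lra.
by apply: h2; lra.
Qed.
Let L12 : 1 / 2 <= L. Proof. exact: ln_ge_half. Qed.

Lemma expR_ln_pow j : expR (- (j%:R * L)) = (N ^+ j)^-1.
Proof. by rewrite expRN expRM_natl lnK // posrE. Qed.

Lemma density_ge : g ^+ 10 / 2 <= t ^+ 2 * N.
Proof. by apply: le_trans gN; rewrite ler_pM2l ?exprn_gt0 //; have := L12; lra. Qed.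

Lemma size_ge : g ^+ 10 * L <= N.
Proof. by apply: (le_trans gN); rewrite ler_piMl. Qed.

Lemma scale_ge512 : 512 <= g.
Proof.
apply: le_trans g3.
have -> : (10 : R) ^+ 3 = 10 * (10 * 10) by rewrite !exprS expr0 mulr1.
lra.
Qed.

Let g10 j : (j <= 10)%N -> g ^+ j <= g ^+ 10.
Proof. by move=> h; rewrite ler_weXn2l // ltW. Qed.

Lemma density_ge256 : 256 <= t ^+ 2 * N.
Proof.
apply: le_trans density_ge; have := @g10 1 isT; rewrite expr1; have := scale_ge512; lra.
Qed.

Let t_gt0 : 0 < t.
Proof.
rewrite lt_neqAle t0 andbT eq_sym; apply: contraTneq density_ge256 => ->.
by rewrite expr0n mul0r; lra.
Qed.

(** The typical size of the fluctuations, up to a logarithmic factor. *)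
Definition typical_dev := Num.sqrt (g * (t ^+ 3 * N ^+ 3) * L).

Hypothesis g_tail : 6 * (864 * 10 ^+ 3) <= g.

Let w := t ^+ 3 * N ^+ 3.
Let w_gt0 : 0 < w. Proof. by rewrite mulr_gt0 // exprn_gt0. Qed.
Let gL1 : 1 <= g * L.
Proof. have := scale_ge512; have h' := L12; move=> h; apply: (@le_trans _ _ (512 * (1 / 2))); [lra|apply: ler_pM; lra]. Qed.

Lemma typical_dev_gt0 : 0 < typical_dev.
Proof. by rewrite sqrtr_gt0 !mulr_gt0 //; have := L12; lra. Qed.

Lemma typical_dev_sqr : typical_dev ^+ 2 = g * w * L.
Proof. by rewrite sqr_sqrtr // !mulr_ge0 ?ltW //; have := L12; lra. Qed.

Let N1 : 1 <= N. Proof. by rewrite ler1n. Qed.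

Lemma N_ge7 : 7 * L <= N.
Proof.
apply: le_trans size_ge; apply: ler_wpM2r; first by have := L12; lra.
apply: (@le_trans _ _ g); [have := scale_ge512; lra | exact: (@g10 1)].
Qed.

Lemma typical_tail : unif_prob R S (fun E => triangle_deviation R m E < - typical_dev) <= (N ^+ 3)^-1.
Proof.
have hgL := gL1; have hL := L12; have hN1 := N1; have ht1 := t1; have N0 : 0 < N by lra.
have dev_le : typical_dev <= 18 * 10 ^+ 3 * t * N ^+ 2.
  have h10 : 0 <= 10 ^+ 3 :> R by rewrite exprn_ge0.
  have h10' : 1 <= 10 ^+ 3 :> R by rewrite exprn_ege1 //; lra.
  apply: (@le_trans _ _ (t * N ^+ 2)).
    rewrite -(@ler_pXn2r _ 2) ?nnegrE ?mulr_ge0 ?exprn_ge0 // ?(ltW typical_dev_gt0) //.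
    rewrite typical_dev_sqr /w.
    have -> : (t * N ^+ 2) ^+ 2 = t ^+ 2 * N ^+ 3 * N by ring.
    have -> : g * (t ^+ 3 * N ^+ 3) * L = t ^+ 2 * N ^+ 3 * (t * (g * L)) by ring.
    apply: ler_wpM2l; first by rewrite mulr_ge0 ?exprn_ge0.
    apply: (@le_trans _ _ (g * L)); first by rewrite ler_piMl //; lra.
    by apply: le_trans size_ge; apply: ler_wpM2r; [lra|exact: (@g10 1)].
  have : 0 <= t * N ^+ 2 by rewrite mulr_ge0 ?exprn_ge0.
  move=> h; rewrite -mulrA ler_peMl //; lra.
have := lower_tail_upper n2 tE t1 density_ge256 typical_dev_gt0 dev_le.
rewrite graphs_nm_draws => h; apply: (le_trans h) => {h}.
have e1 : expR (- (typical_dev ^+ 2 / (864 * 10 ^+ 3 * t ^+ 3 * N ^+ 3))) <= (N ^+ 6)^-1.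
  rewrite -expR_ln_pow ler_expR lerN2 typical_dev_sqr /w.
  have [c [c0 hc ->]] : exists c : R, [/\ 0 < c, 6 * c <= g & 864 * 10 ^+ 3 = c].
    exists (864 * 10 ^+ 3); split; [|exact g_tail|reflexivity].
    by apply: mulr_gt0; [lra|apply: exprn_gt0; lra].
  have -> : g * (t ^+ 3 * N ^+ 3) * L / (c * t ^+ 3 * N ^+ 3) = g / c * L.
    by field; rewrite !gt_eqF.
  by apply: ler_wpM2r; [lra|rewrite ler_pdivlMr].
have e2 : expR (- N) <= (N ^+ 7)^-1.
  by rewrite -expR_ln_pow ler_expR lerN2 N_ge7.
have N512 : 4 <= N.
  have := size_ge; have : g ^+ 10 * (1 / 2) <= g ^+ 10 * L by apply: ler_wpM2l; [rewrite exprn_ge0 // ltW|lra].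
  have := @g10 1 isT; rewrite expr1; have := scale_ge512; lra.
have M2 : ('C(n, 2).+1)%:R <= N ^+ 2.
  have := C2_le R k; rewrite -natr1; have : 4 * 4 <= N ^+ 2 by rewrite expr2; apply: ler_pM; lra.
  lra.
apply: (@le_trans _ _ (N ^+ 2 * ((N ^+ 6)^-1 + 2 * N * (N ^+ 7)^-1))).
  apply: ler_pM; [exact: ler0n| |exact: M2|].
    by apply: addr_ge0; [exact: expR_ge0|apply: mulr_ge0; [lra|exact: expR_ge0]].
  by apply: lerD; [exact: e1|apply: ler_pM; [lra|exact: expR_ge0|lra|exact: e2]].
have -> : N ^+ 2 * ((N ^+ 6)^-1 + 2 * N * (N ^+ 7)^-1) = 3 / N * (N ^+ 3)^-1.
  by field; rewrite gt_eqF.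
apply: ler_piMl; first by rewrite invr_ge0 exprn_ge0.
rewrite ler_pdivrMr //; lra.
Qed.

(** Both halves of the mean absolute deviation are at most of the typical
    order: the deviation never falls below minus the mean, and it falls below
    the typical order only with a negligible probability. *)
Lemma mean_shortfall_le :
  EX (fun E => Num.max (EX (fun E' => (triangle_count E')%:R) - (triangle_count E)%:R) 0) <= 2 * typical_dev.
Proof.
set f0 := EX (fun E' => (triangle_count E')%:R); have dp := typical_dev_gt0.
have hgL := gL1; have hL := L12; have hN1 := N1; have ht1 := t1; have N0 : 0 < N by lra.
have S0 : (0 < #|S|)%N by rewrite card_draws_gt0 // (m_le_pairs n2 tE t1).
have f0_ge0 : 0 <= f0 by apply: ue_ge0 => E _; exact: ler0n.
have f0_le : f0 <= w.
  have := expected_triangles_le n2 tE t1; rewrite graphs_nm_draws -/f0 => h; apply: (le_trans h).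
  rewrite /w mulrCA; apply: ler_wpM2l; first by rewrite exprn_ge0.
  have : ('C(n, 3) * 3`! <= n ^ 3)%N.
    rewrite bin_ffact !ffactnSr ffactn0 mul1n subn0 !expnSr expn0 mul1n.
    by apply: leq_mul; [apply: leq_mul|]; rewrite ?leq_subr ?leqnn.
  by rewrite -(ler_nat R) natrM natrX mulrC.
apply: (@le_trans _ _ (EX (fun E => typical_dev + f0 * (triangle_deviation R m E < - typical_dev)%R%:R))).
  apply: ue_le => E _; rewrite /triangle_deviation graphs_nm_draws -/f0.
  have T0 : 0 <= (triangle_count E)%:R :> R by [].
  by case: ltP => h; rewrite ge_max; apply/andP; split => /=; lra.
rewrite ueD ue_cst // ueZ -ue_prob.
suff : f0 * unif_prob R S (fun E => triangle_deviation R m E < - typical_dev) <= typical_dev by lra.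
apply: (@le_trans _ _ (w * (N ^+ 3)^-1)).
  by apply: ler_pM => //; [rewrite /unif_prob divr_ge0|exact: typical_tail].
rewrite -(@ler_pXn2r _ 2) ?nnegrE ?mulr_ge0 ?invr_ge0 ?exprn_ge0 ?(ltW w_gt0) ?(ltW dp) //.
rewrite typical_dev_sqr.
have u1 : w * (N ^+ 3)^-1 <= 1 by rewrite /w mulfK ?gt_eqF ?exprn_gt0 // exprn_ile1.
have u0 : 0 <= w * (N ^+ 3)^-1 by rewrite mulr_ge0 ?invr_ge0 ?exprn_ge0 // ltW.
apply: (@le_trans _ _ (w * (N ^+ 3)^-1)); first by rewrite expr2 ler_piMl.
apply: (@le_trans _ _ w).
  by apply: ler_piMr; [exact: ltW|rewrite invf_le1 ?exprn_ege1 // exprn_gt0].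
rewrite mulrAC ler_peMl //; exact: ltW.
Qed.
End Regime.

(** * The lower bound *)

Section LowerBound.
Variables (R : realType) (k m : nat) (t a g : R).
Notation n := k.+1.
Notation N := (n%:R : R).
Notation L := (ln N).
Hypothesis n2 : (2 <= n)%N.
Hypothesis tE : t = m%:R / 'C(n, 2)%:R.
Hypothesis t2 : t <= 1 / 2.
Hypothesis g3 : 10 ^+ 3 <= g.
Hypothesis gN : g ^+ 10 * L <= t ^+ 2 * N.
Hypothesis g_tail : 6 * (864 * 10 ^+ 3) <= g.
Hypothesis g_drift : 4 / g <= 3 / 10 ^+ 5 / 64.
Hypothesis a0 : 0 < a.
Hypothesis a_ge : g ^+ 10 * (t ^+ 3 * N ^+ 3) * L <= a ^+ 2.
Hypothesis a_le : g ^+ 10 * a ^+ 2 <= t ^+ 3 * N ^+ 4.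
Notation S := (draws (pairs k) m).
Notation EX := (unif_expect (R := R) S).
Notation q := (n %/ 4)%N.
Notation Q := (q%:R : R).
Notation zI := (@slot_sign R k q).
Notation aI := (@slot_linear R k q).
Notation cI := (@slot_quadratic R k q).
Notation F0 := (@even_count R k q).
Notation r := (Num.sqrt N).

Let t1 : t <= 1. Proof. have := t2; lra. Qed.
Let g512 : 512 <= g. Proof. exact: (@scale_ge512 _ g). Qed.
Let g0 : 0 < g. Proof. have := g512; lra. Qed.
Let L12 : 1 / 2 <= L. Proof. exact: ln_ge_half. Qed.
Let N0 : 0 < N. Proof. by []. Qed.
Let g10 j : (j <= 10)%N -> g ^+ j <= g ^+ 10.
Proof. by move=> h; rewrite ler_weXn2l //; have := g512; lra. Qed.
Let N_ge : g ^+ 10 / 2 <= N.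
Proof.
apply: le_trans (size_ge tE t2 gN); apply: ler_wpM2l; first by rewrite exprn_ge0 // ltW.
have := L12; lra.
Qed.
Let tN : g ^+ 10 / 2 <= t ^+ 2 * N.
Proof. exact: (density_ge n2 g3 gN). Qed.
Let tN256 : 256 <= t ^+ 2 * N.
Proof. exact: (density_ge256 n2 g3 gN). Qed.
Let t_gt0 : 0 < t.
Proof.
rewrite lt_neqAle eq_sym tE divr_ge0 // andbT -tE; apply: contraTneq tN256 => ->.
by rewrite expr0n mul0r; lra.
Qed.
Let t0 : 0 <= t. Proof. exact: ltW. Qed.
Let tN1 : 256 <= t * N.
Proof.
apply: (le_trans tN256); rewrite expr2 -mulrA ler_piMl // ?mulr_ge0 //; exact: ltW.
Qed.
Let tE' : t = m%:R / #|pairs k|%:R. Proof. by rewrite card_pairs. Qed.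
Let mM : (m <= #|pairs k|)%N. Proof. exact: (m_le_pairs n2 tE t1). Qed.
Let mR : m%:R = t * 'C(n, 2)%:R :> R. Proof. exact: (mE n2 tE). Qed.
Let m2 : (2 * m <= #|pairs k|)%N.
Proof.
rewrite card_pairs -(ler_nat R) natrM mR mulrA ler_piMl //; have := t2; lra.
Qed.
Let N_le_C2 : N / 2 <= 'C(n, 2)%:R.
Proof.
have : (n * 1 <= 'C(n, 2) * 2)%N.
  by rewrite [('C(n, 2) * 2)%N]mulnC -mul_bin_diag bin1 leq_mul.
rewrite -(ler_nat R) !natrM; lra.
Qed.
Let m4 : (4 <= m)%N.
Proof.
rewrite -(ler_nat R) mR; apply: (@le_trans _ _ (t * (N / 2))); first by have := tN1; lra.
by rewrite ler_pM2l.
Qed.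
Let m_le : m%:R <= t * N ^+ 2 / 2.
Proof. by rewrite mR -mulrA ler_pM2l // C2_le. Qed.
Let q4 : (4 * q <= n)%N. Proof. by rewrite mulnC leq_trunc_div. Qed.
Let Q_le : Q <= N / 4.
Proof. by have := q4; rewrite -(ler_nat R) natrM; lra. Qed.
Let Q_ge : N / 8 <= Q.
Proof.
have n8 : (8 <= n)%N.
  rewrite -(ler_nat R); have := tN1; have : t * N <= N by rewrite ler_piMl.
  lra.
have : (n <= 8 * q)%N by move: n8; clear; lia.
rewrite -(ler_nat R) natrM; lra.
Qed.
Let r2 : r ^+ 2 = N. Proof. by rewrite sqr_sqrtr. Qed.
Let r0 : 0 < r. Proof. by rewrite sqrtr_gt0. Qed.
Let S0 : (0 < #|S|)%N. Proof. exact: card_draws_gt0. Qed.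

(* Half a lower bound for the mean drift, and the tilt that makes the typical
   drift equal to four times the deviation. *)
Let l := 2 / g * (t ^+ 2 * N ^+ 2 * r).
Let dl := 2 * g * a / (t ^+ 2 * N ^+ 2 * r).
Let w := t ^+ 3 * N ^+ 3.
Let w0 : 0 < w. Proof. by rewrite mulr_gt0 // exprn_gt0. Qed.
Let dl2 : dl ^+ 2 = 4 * g ^+ 2 * a ^+ 2 / (t ^+ 4 * N ^+ 5).
Proof.
have -> : t ^+ 4 * N ^+ 5 = (t ^+ 2 * N ^+ 2 * r) ^+ 2.
  by rewrite !exprMn r2; ring.
by rewrite /dl; field; rewrite !gt_eqF.
Qed.

(** By Paley-Zygmund, since the second moment of the drift is of the order of
    the square of its mean. *)
Lemma drift_large : (g ^+ 2)^-1 <= EX (fun E => (l <= tilt_drift zI aI E)%R%:R).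
Proof.
have l0 : 0 <= l by apply: mulr_ge0; [apply: divr_ge0 => //; exact: ltW|apply: mulr_ge0; [exact: mulr_ge0 (sqr_ge0 _) (sqr_ge0 _)|exact: ltW]].
have h1 : 2 * l <= EX (tilt_drift zI aI).
  apply: le_trans (drift_mean_ge q4 tE' mM _ m4 m2); last by have := tN256; lra.
  have -> : 2 * l = 4 / g * (N ^+ 2 * (t ^+ 2 * r)) by rewrite /l; ring.
  have -> : Q ^+ 2 * (3 / 10 ^+ 5 * (t ^+ 2 * r)) = 3 / 10 ^+ 5 / 64 * ((8 * Q) ^+ 2 * (t ^+ 2 * r)).
    by move: (3 / 10 ^+ 5 : R) => c; field.
  have c0 : 0 <= 4 / g by rewrite divr_ge0 // ltW.
  have p0 : 0 <= t ^+ 2 * r by rewrite mulr_ge0 ?exprn_ge0 ?(ltW r0).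
  apply: ler_pM => //; first by rewrite mulr_ge0 // exprn_ge0.
  by apply: ler_wpM2r => //; rewrite ler_pXn2r ?nnegrE ?mulr_ge0 //; have := Q_ge; lra.
have h2 : EX (fun E => tilt_drift zI aI E ^+ 2) <= 9 / 4 * (t ^+ 4 * N ^+ 5).
  apply: (le_trans (drift_second_le q4 tE' mM)).
  have -> : 9 / 4 * (t ^+ 4 * N ^+ 5) = t * N ^+ 2 / 2 * ((N / 4) ^+ 2 * (72 * (t ^+ 3 * N))) by field.
  have p0 : 0 <= 72 * (t ^+ 3 * N) by rewrite !mulr_ge0 ?exprn_ge0.
  apply: ler_pM => //; first by rewrite mulr_ge0 // exprn_ge0.
  apply: ler_wpM2r => //; rewrite ler_pXn2r ?nnegrE ?divr_ge0 //.
have h3 := paley_zygmund S0 l0 h1 h2; move: h3; set p := EX _.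
have -> : l ^+ 2 = 4 * (g ^+ 2)^-1 * (t ^+ 4 * N ^+ 5).
  have -> : t ^+ 4 * N ^+ 5 = (t ^+ 2 * N ^+ 2 * r) ^+ 2 by rewrite !exprMn r2; ring.
  by rewrite /l; field; rewrite gt_eqF.
have p0 : 0 < t ^+ 4 * N ^+ 5 by rewrite mulr_gt0 ?exprn_gt0.
rewrite [9 / 4 * _ * p]mulrAC ler_pM2r // => h3.
have : 0 <= (g ^+ 2)^-1 by rewrite invr_ge0 exprn_ge0 // ltW.
lra.
Qed.

Let g2 : 512 * 512 <= g ^+ 2.
Proof. by rewrite expr2; have := g512; move=> h; apply: ler_pM; lra. Qed.
Let g_mono i j : (i <= j)%N -> g ^+ i <= g ^+ j.
Proof. by move=> h; rewrite ler_weXn2l //; have := g512; lra. Qed.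
Let h0 : 0 < (g ^+ 2)^-1. Proof. by rewrite invr_gt0 exprn_gt0. Qed.
Let gL1 : 1 <= g * L.
Proof.
have := g512; have := L12; move=> h1 h2.
by apply: (@le_trans _ _ (512 * (1 / 2))); [lra|apply: ler_pM; lra].
Qed.
Let aw : g ^+ 9 * w <= a ^+ 2.
Proof.
apply: le_trans a_ge; rewrite -/w [leRHS](_ : _ = g ^+ 9 * w * (g * L)); last by ring.
by apply: ler_peMr => //; rewrite mulr_ge0 ?exprn_ge0 ?(ltW g0) ?(ltW w0).
Qed.
Let wa c : 0 <= c -> c * 16 <= g ^+ 2 -> c * w / a ^+ 2 <= (g ^+ 2)^-1 / 16.
Proof.
move=> c0 cg; rewrite ler_pdivrMr ?exprn_gt0 //.
apply: (@le_trans _ _ ((g ^+ 2)^-1 / 16 * (g ^+ 9 * w))); last first.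
  by apply: ler_wpM2l => //; rewrite divr_ge0 // ltW.
have -> : (g ^+ 2)^-1 / 16 * (g ^+ 9 * w) = g ^+ 7 / 16 * w by field; rewrite gt_eqF.
apply: ler_wpM2r; first exact: ltW.
rewrite ler_pdivlMr //; apply: (le_trans cg); exact: g_mono.
Qed.

(** The only place where the lower bound relies on the upper bound for the
    tail. *)
Lemma excess_small : EX (fun E => Num.max (F0 E - EX (fun E' => (triangle_count E')%:R)) 0) / a <= (g ^+ 2)^-1 / 8.
Proof.
have h1 : EX (fun E => Num.max (F0 E - EX (fun E' => (triangle_count E')%:R)) 0) <= 2 * typical_dev k t g.
  apply: le_trans (mean_shortfall_le n2 tE t2 g3 gN g_tail).
  apply: (@invariant_part_excess _ _ _ _ (@slot_involution k q) _ _ zI F0 aI cI) => //.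
  - by move=> i E; apply: slot_involution_draws.
  - exact: slot_involutionK.
  - by move=> i E; apply: slot_sign_odd.
  - by move=> i j; apply: slot_sign_inv.
  - exact: even_count_inv.
  - by move=> i; apply: slot_linear_inv.
  - by move=> i j; apply: slot_quadratic_inv.
  - exact: slot_quadratic_diag.
  - by move=> E; rewrite inE => /andP[sE _]; apply: slot_decomposition.
rewrite ler_pdivrMr //; apply: (le_trans h1).
have dp : 0 < typical_dev k t g := typical_dev_gt0 n2 tE g3 gN.
have d2 := typical_dev_sqr n2 tE g3 gN.
suff h2 : 16 * g ^+ 2 * typical_dev k t g <= a.
  have : (g ^+ 2)^-1 * (16 * g ^+ 2 * typical_dev k t g) <= (g ^+ 2)^-1 * a by apply: ler_wpM2l => //; exact: ltW.
  have -> : (g ^+ 2)^-1 * (16 * g ^+ 2 * typical_dev k t g) = 16 * typical_dev k t g by field; rewrite gt_eqF.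
  lra.
have p0 : 0 <= 16 * g ^+ 2 * typical_dev k t g by rewrite !mulr_ge0 ?exprn_ge0 ?(ltW g0) ?(ltW dp).
rewrite -(@ler_pXn2r _ 2) ?nnegrE ?(ltW a0) // exprMn d2.
apply: le_trans a_ge.
have -> : (16 * g ^+ 2) ^+ 2 * (g * (t ^+ 3 * N ^+ 3) * L) = (16 * 16 * g ^+ 5) * (w * L) by rewrite /w; ring.
rewrite -/w -[leRHS]mulrA; apply: ler_wpM2r; first by rewrite mulr_ge0 ?(ltW w0) //; have := L12; lra.
have -> : g ^+ 10 = g ^+ 5 * g ^+ 5 by rewrite -exprD.
apply: ler_wpM2r; first by rewrite exprn_ge0 // ltW.
apply: le_trans (g_mono (isT : 2 <= 5)%N); have := g2; lra.
Qed.

Let Q_pow j : Q ^+ j <= (N / 4) ^+ j.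
Proof. by apply: lerXn2r; rewrite ?nnegrE ?divr_ge0. Qed.

Let cube_le : Q ^+ 3 * t ^+ 3 <= w / 64.
Proof.
have -> : w / 64 = (N / 4) ^+ 3 * t ^+ 3 by rewrite /w; field.
by apply: ler_wpM2r; [rewrite exprn_ge0|exact: Q_pow].
Qed.

Lemma quadratic_drift_small : 2 * dl ^+ 2 * shift_moment S zI cI / a <= (g ^+ 2)^-1 / 8.
Proof.
rewrite ler_pdivrMr //.
have h4 : shift_moment S zI cI <= 3 / 4 * w by have := shift_moment_le q4 tE' mM; have := cube_le; lra.
apply: (@le_trans _ _ (2 * dl ^+ 2 * (3 / 4 * w))); first by apply: ler_wpM2l => //; rewrite mulr_ge0 // sqr_ge0.
have -> : 2 * dl ^+ 2 * (3 / 4 * w) = 6 * g ^+ 2 / (t * N ^+ 2) * a * a.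
  by rewrite dl2 /w; field; rewrite !gt_eqF.
apply: ler_wpM2r; first exact: ltW.
suff h : 48 * g ^+ 4 * a <= t * N ^+ 2.
  have p0 : 0 < t * N ^+ 2 by rewrite mulr_gt0 ?exprn_gt0.
  have -> : 6 * g ^+ 2 / (t * N ^+ 2) * a = (48 * g ^+ 4 * a) / (t * N ^+ 2) * ((g ^+ 2)^-1 / 8).
    by field; rewrite !gt_eqF.
  apply: ler_piMl; first by rewrite divr_ge0 // ltW.
  by rewrite ler_pdivrMr // mul1r.
rewrite -(@ler_pXn2r _ 2) ?nnegrE ?mulr_ge0 ?exprn_ge0 ?(ltW a0) ?(ltW g0) //.
have -> : (48 * g ^+ 4 * a) ^+ 2 = 48 * 48 * (g ^+ 8 * a ^+ 2) by ring.
apply: (@le_trans _ _ (g ^+ 10 * a ^+ 2)).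
  have -> : g ^+ 10 * a ^+ 2 = g ^+ 2 * (g ^+ 8 * a ^+ 2) by ring.
  apply: ler_wpM2r; first by rewrite mulr_ge0 ?exprn_ge0 ?(ltW g0) ?(ltW a0).
  have := g2; lra.
apply: (le_trans a_le); have -> : (t * N ^+ 2) ^+ 2 = t ^+ 2 * N ^+ 4 by ring.
by apply: ler_wpM2r; [rewrite exprn_ge0|rewrite exprS ler_piMl ?exprn_ge0].
Qed.

Lemma linear_variance_small : 4 * (8 * lin_moment S zI aI + 32 * dl ^+ 2 * cross_moment S zI cI) / a ^+ 2 <= (g ^+ 2)^-1 / 8.
Proof.
have h1 : lin_moment S zI aI <= 9 / 2 * w.
  apply: (le_trans (lin_moment_le q4 tE' mM)).
  have -> : 9 / 2 * w = (N / 4) ^+ 2 * (72 * (t ^+ 3 * N)) by rewrite /w; field.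
  by apply: ler_wpM2r; [rewrite !mulr_ge0 ?exprn_ge0|exact: Q_pow].
have h2 : cross_moment S zI cI <= 9 / 2 * (t ^+ 5 * N ^+ 4 + w).
  apply: (le_trans (cross_moment_le q4 tE' mM)).
  have c4 : Q ^+ 4 * t ^+ 5 <= (N / 4) ^+ 4 * t ^+ 5 by apply: ler_wpM2r; [rewrite exprn_ge0|exact: Q_pow].
  have e4 : (N / 4) ^+ 4 * t ^+ 5 = t ^+ 5 * N ^+ 4 / 256 by field.
  have := cube_le; rewrite e4 in c4; lra.
have d0 : 0 <= dl ^+ 2 := sqr_ge0 _.
have a2 : 0 < a ^+ 2 by rewrite exprn_gt0.
have e1 : 144 * w / a ^+ 2 <= (g ^+ 2)^-1 / 16.
  by apply: wa; have := g2; lra.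
have e2 : 576 * (dl ^+ 2 * (t ^+ 5 * N ^+ 4 + w)) / a ^+ 2 <= (g ^+ 2)^-1 / 16.
  have -> : 576 * (dl ^+ 2 * (t ^+ 5 * N ^+ 4 + w)) / a ^+ 2 = 2304 * g ^+ 2 * (t + (t * N)^-1) / N.
    by rewrite dl2 /w; field; rewrite !gt_eqF.
  have s2 : t + (t * N)^-1 <= 2.
    have : (t * N)^-1 <= 1 by rewrite invf_le1 ?mulr_gt0 //; have := tN1; lra.
    by move: (_^-1) t1 => y; lra.
  rewrite ler_pdivrMr //; apply: (@le_trans _ _ (2304 * g ^+ 2 * 2)).
    by apply: ler_wpM2l; [apply: mulr_ge0; [lra|rewrite exprn_ge0 // ltW]|exact: s2].
  apply: (@le_trans _ _ ((g ^+ 2)^-1 / 16 * (g ^+ 10 / 2))); last first.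
    by apply: ler_wpM2l; [rewrite divr_ge0 // ltW|exact: N_ge].
  have -> : (g ^+ 2)^-1 / 16 * (g ^+ 10 / 2) = g ^+ 6 / 32 * g ^+ 2 by field; rewrite gt_eqF.
  rewrite mulrAC; apply: ler_wpM2r; first by rewrite exprn_ge0 // ltW.
  have : g ^+ 3 <= g ^+ 6 by apply: g_mono.
  have : 512 * 512 * 512 <= g ^+ 3 by rewrite exprSr; have := g2; have := g512; move=> h h'; apply: ler_pM; lra.
  lra.
apply: (@le_trans _ _ (144 * w / a ^+ 2 + 576 * (dl ^+ 2 * (t ^+ 5 * N ^+ 4 + w)) / a ^+ 2)); last lra.
rewrite -mulrDl; apply: ler_wpM2r; first by rewrite invr_ge0 ltW.
have h3 : dl ^+ 2 * cross_moment S zI cI <= dl ^+ 2 * (9 / 2 * (t ^+ 5 * N ^+ 4 + w)) by apply: ler_wpM2l.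
lra.
Qed.

Lemma quadratic_variance_small : 4 * (64 * quad_moment S zI cI) / a ^+ 2 <= (g ^+ 2)^-1 / 8.
Proof.
have h3 : quad_moment S zI cI <= 9 / 2 * w by have := quad_moment_le q4 tE' mM; have := cube_le; lra.
apply: (@le_trans _ _ (1152 * w / a ^+ 2)).
  by apply: ler_wpM2r; [rewrite invr_ge0 exprn_ge0 // ltW|lra].
apply: (@le_trans _ _ ((g ^+ 2)^-1 / 16)); last by have := h0; lra.
by apply: wa; have := g2; lra.
Qed.

Let dl01 : 0 <= dl <= 1.
Proof.
have d0 : 0 <= dl.
  apply: divr_ge0; first by rewrite !mulr_ge0 ?(ltW g0) ?(ltW a0).
  by rewrite !mulr_ge0 ?exprn_ge0 ?(ltW r0).
rewrite d0 /= -(@ler_pXn2r _ 2) ?nnegrE // dl2 expr1n.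
have p0 : 0 < t ^+ 4 * N ^+ 5 by rewrite mulr_gt0 ?exprn_gt0.
rewrite ler_pdivrMr // mul1r.
apply: (@le_trans _ _ (g ^+ 10 * a ^+ 2)).
  apply: ler_wpM2r; first exact: sqr_ge0.
  have -> : g ^+ 10 = g ^+ 8 * g ^+ 2 by rewrite -exprD.
  apply: ler_wpM2r; first by rewrite exprn_ge0 // ltW.
  apply: le_trans (g_mono (isT : 2 <= 8)%N); have := g2; lra.
apply: (le_trans a_le).
have -> : t ^+ 4 * N ^+ 5 = t ^+ 3 * N ^+ 4 * (t * N) by ring.
by apply: ler_peMr; [rewrite mulr_ge0 ?exprn_ge0|have := tN1; lra].
Qed.

(** The tilted probability of the event is at least [1/(2 g^2)], and it is at
    most the square root of the probability times the second moment of the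
    tilting density. *)
Theorem lower_tail_lower :
  expR (- ((2 * g ^+ 2 + 1) * (a ^+ 2 / (t ^+ 3 * N ^+ 3))))
  <= unif_prob R S (fun E => triangle_deviation R m E < - a).
Proof.
pose f0 := EX (fun E => (triangle_count E)%:R).
pose B (E : {set {set 'I_n}}) : R := ((triangle_count E)%:R - f0 < - a)%R%:R.
have -> : unif_prob R S (fun E => triangle_deviation R m E < - a) = EX B by rewrite ue_prob.
pose T := tilt zI aI dl.
have sS : forall (i : 'I_q * 'I_q) E, E \in S -> slot_involution i E \in S by move=> i E; apply: slot_involution_draws.
have zo : forall (i : 'I_q * 'I_q) E, E \in S -> zI i (slot_involution i E) = - zI i E by move=> i E; apply: slot_sign_odd.
have zi : forall i j : 'I_q * 'I_q, i != j -> invariant_under S (@slot_involution k q) i (zI j) by move=> i j; apply: slot_sign_inv.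
have ai : forall i, invariant_all S (@slot_involution k q) (aI i) by move=> i; apply: slot_linear_inv.
have ci : forall i j, invariant_all S (@slot_involution k q) (cI i j) by move=> i j; apply: slot_quadratic_inv.
have fi : invariant_all S (@slot_involution k q) F0 by apply: even_count_inv.
have zK : forall E, E \in S -> \sum_i zI i E ^+ 2 <= m%:R by move=> E; apply: sum_slot_sign_sqr_le.
have FE : forall E, E \in S -> (triangle_count E)%:R
    = F0 E + \sum_i zI i E * aI i E + \sum_i \sum_j cI i j E * zI i E * zI j E.
  by move=> E; rewrite inE => /andP[sE _]; apply: slot_decomposition.
have dll : 4 * a <= dl * l.
  have -> : dl * l = 4 * a by rewrite /dl /l; field; rewrite !gt_eqF.
  exact: lexx.
have low := tilted_lower_tail S0 sS (@slot_involutionK k q) (@slot_sign_cube R k q) zo zi fi ai ci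
  (@slot_quadratic_sym R k q) (@slot_quadratic_diag R k q) dl01 f0 FE zK a0 dll.
have mu_ge : (g ^+ 2)^-1 / 2 <= EX (fun E => T E * B E).
  have := drift_large; have := excess_small; have := quadratic_drift_small.
  have := linear_variance_small; have := quadratic_variance_small; move: low; rewrite -/f0 -/T.
  rewrite -/(EX (fun E => T E * B E)); lra.
have sq := ue_tilt_sqr S0 sS (@slot_involutionK k q) zo zi ai dl01 zK.
have cs := ue_cauchy_schwarz S T B.
have BB : EX (fun E => B E ^+ 2) = EX B.
  by apply: eq_ue => E _; rewrite /B; case: (_ < _); rewrite ?expr1n ?expr0n.
rewrite BB in cs.
set U := a ^+ 2 / (t ^+ 3 * N ^+ 3).
have U0 : 0 <= U by rewrite divr_ge0 ?sqr_ge0 // ltW.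
have dm : dl ^+ 2 * m%:R <= 2 * g ^+ 2 * U.
  apply: (@le_trans _ _ (dl ^+ 2 * (t * N ^+ 2 / 2))); first by apply: ler_wpM2l; [exact: sqr_ge0|exact: m_le].
  have -> : dl ^+ 2 * (t * N ^+ 2 / 2) = 2 * g ^+ 2 * U by rewrite dl2 /U; field; rewrite !gt_eqF.
  exact: lexx.
have PB0 : 0 <= EX B by apply: ue_ge0 => E _; rewrite /B ler0n.
have main : ((g ^+ 2)^-1 / 2) ^+ 2 <= expR (2 * g ^+ 2 * U) * EX B.
  apply: (@le_trans _ _ (EX (fun E => T E * B E) ^+ 2)).
    rewrite ler_pXn2r ?nnegrE //; first by rewrite divr_ge0 // ltW.
    by apply: le_trans mu_ge; rewrite divr_ge0 // ltW.
  apply: (le_trans cs); apply: ler_wpM2r => //.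
  by apply: (le_trans sq); rewrite ler_expR.
have gU : 4 * g ^+ 4 <= expR U.
  apply: (@le_trans _ _ U); last by apply: le_trans (expR_ge1Dx U); rewrite ler_wpDl.
  apply: (@le_trans _ _ (g ^+ 9)); last by rewrite /U ler_pdivlMr.
  have -> : g ^+ 9 = g ^+ 5 * g ^+ 4 by rewrite -exprD.
  apply: ler_wpM2r; first by rewrite exprn_ge0 // ltW.
  apply: le_trans (g_mono (isT : 2 <= 5)%N); have := g2; lra.
have -> : - ((2 * g ^+ 2 + 1) * U) = - U - 2 * g ^+ 2 * U by ring.
rewrite expRD [X in _ * X <= _]expRN ler_pdivrMr ?expR_gt0 // mulrC.
have c0 : 0 < ((g ^+ 2)^-1 / 2) ^+ 2 by apply: exprn_gt0; apply: divr_gt0.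
apply: le_trans main; rewrite expRN -lef_pV2 ?posrE ?invr_gt0 ?expR_gt0 //.
rewrite invrK; apply: le_trans gU.
have -> : (((g ^+ 2)^-1 / 2) ^+ 2)^-1 = 4 * g ^+ 4 by field; rewrite gt_eqF.
by [].
Qed.
End LowerBound.

(** * Two-sided estimate *)

Section UpperBoundClean.
Variables (R : realType) (k m : nat) (t a g : R).
Notation n := k.+1.
Notation N := (n%:R : R).
Notation L := (ln N).
Hypothesis n2 : (2 <= n)%N.
Hypothesis tE : t = m%:R / 'C(n, 2)%:R.
Hypothesis t2 : t <= 1 / 2.
Hypothesis g3 : 10 ^+ 3 <= g.
Hypothesis gN : g ^+ 10 * L <= t ^+ 2 * N.
Hypothesis g_tail : 6 * (864 * 10 ^+ 3) <= g.
Hypothesis a0 : 0 < a.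
Hypothesis a_ge : g ^+ 10 * (t ^+ 3 * N ^+ 3) * L <= a ^+ 2.
Hypothesis a_le : g ^+ 10 * a ^+ 2 <= t ^+ 3 * N ^+ 4.
Notation S := (draws (pairs k) m).

(** The exponent is at least [g^10 ln n] and at most [N / g^10], so that it
    absorbs the polynomial factors and the exceptional events of
    [lower_tail_upper]. *)
Theorem lower_tail_upper_gaussian :
  unif_prob R S (fun E => triangle_deviation R m E < - a) <= expR (- ((g ^+ 2)^-1 * (a ^+ 2 / (t ^+ 3 * N ^+ 3)))).
Proof.
have t1 : t <= 1 by have := t2; lra.
have g512 : 512 <= g by exact: scale_ge512.
have g0 : 0 < g by lra.
have L12 : 1 / 2 <= L by exact: ln_ge_half.
have tN256 := density_ge256 n2 g3 gN.
have N0 : 0 < N by [].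
have t_gt0 : 0 < t.
  rewrite lt_neqAle eq_sym tE divr_ge0 // andbT -tE; apply: contraTneq tN256 => ->.
  by rewrite expr0n mul0r; lra.
set w := t ^+ 3 * N ^+ 3; have w0 : 0 < w by rewrite mulr_gt0 // exprn_gt0.
set U := a ^+ 2 / w.
have U0 : 0 <= U by rewrite divr_ge0 ?sqr_ge0 // ltW.
have g_mono i j : (i <= j)%N -> g ^+ i <= g ^+ j by move=> h; rewrite ler_weXn2l //; lra.
have gp j : 0 < g ^+ j by rewrite exprn_gt0.
have LU : g ^+ 10 * L <= U by rewrite /U ler_pdivlMr // mulrAC.
have UN : g ^+ 10 * U <= N.
  rewrite /U mulrA ler_pdivrMr //; apply: (le_trans a_le); rewrite /w.
  have -> : t ^+ 3 * N ^+ 4 = N * (t ^+ 3 * N ^+ 3) by ring.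
  exact: lexx.
have dev_le : a <= 18 * 10 ^+ 3 * t * N ^+ 2.
  have h10' : 1 <= 10 ^+ 3 :> R by rewrite exprn_ege1 //; lra.
  apply: (@le_trans _ _ (t * N ^+ 2)).
    rewrite -(@ler_pXn2r _ 2) ?nnegrE ?mulr_ge0 ?exprn_ge0 ?(ltW a0) ?(ltW t_gt0) //.
    have -> : (t * N ^+ 2) ^+ 2 = t ^+ 2 * N ^+ 4 by ring.
    apply: (@le_trans _ _ (g ^+ 10 * a ^+ 2)).
      by apply: ler_peMl; [exact: sqr_ge0|rewrite exprn_ege1 //; lra].
    apply: (le_trans a_le); apply: ler_wpM2r; first by rewrite exprn_ge0.
    by rewrite exprS ler_piMl ?exprn_ge0 // ltW.
  have : 0 <= t * N ^+ 2 by rewrite mulr_ge0 ?exprn_ge0 // ltW.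
  move=> h; rewrite -mulrA ler_peMl //; lra.
have N2 : 2 <= N by rewrite ler_nat.
have := lower_tail_upper n2 tE t1 tN256 a0 dev_le.
rewrite graphs_nm_draws => h; apply: (le_trans h) => {h}.
have M2 : ('C(n, 2).+1)%:R <= N ^+ 2.
  have := C2_le R k; rewrite -natr1; have : 2 * 2 <= N ^+ 2 by rewrite expr2; apply: ler_pM; lra.
  lra.
have eN : expR L = N by rewrite lnK // posrE.
have gi : (g ^+ 10)^-1 <= g^-1 by rewrite lef_pV2 ?posrE //; exact: (g_mono 1%N).
have gi2 : (g ^+ 2)^-1 <= g^-1 by rewrite lef_pV2 ?posrE //; exact: (g_mono 1%N).
have L_le : L <= g^-1 * U.
  apply: (@le_trans _ _ ((g ^+ 10)^-1 * U)); last by apply: ler_wpM2r.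
  by rewrite mulrC ler_pdivlMr // mulrC.
have U2_le : (g ^+ 2)^-1 * U <= g^-1 * U by apply: ler_wpM2r.
have gU_le : g^-1 * U <= U by apply: ler_piMl => //; rewrite invf_le1 //; lra.
have UN' : 5 * U <= N.
  apply: le_trans UN; apply: ler_wpM2r => //; have := g_mono 1%N 10%N isT; rewrite expr1; lra.
set V := (g ^+ 2)^-1 * U in U2_le *.
have e1 : expR (- (a ^+ 2 / (864 * 10 ^+ 3 * t ^+ 3 * N ^+ 3))) <= expR (- (3 * L) - V).
  rewrite ler_expR.
  have [c [c0 hc ->]] : exists c : R, [/\ 0 < c, 6 * c <= g & 864 * 10 ^+ 3 = c].
    exists (864 * 10 ^+ 3); split; [|exact g_tail|reflexivity].
    by apply: mulr_gt0; [lra|apply: exprn_gt0; lra].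
  have -> : a ^+ 2 / (c * t ^+ 3 * N ^+ 3) = c^-1 * U by rewrite /U /w; field; rewrite !gt_eqF.
  have : 6 * (g^-1 * U) <= c^-1 * U.
    rewrite mulrA; apply: ler_wpM2r => //.
    by rewrite ler_pdivrMr // mulrC ler_pdivlMr.
  move: (g^-1 * U) (c^-1 * U) L_le U2_le => y y'; lra.
have e2 : (N + 2) * expR (- N) <= expR (- (3 * L) - V).
  apply: (@le_trans _ _ (expR (L + L) * expR (- N))).
    apply: ler_wpM2r; first exact: expR_ge0.
    rewrite expRD eN; apply: (@le_trans _ _ (N * 2)); first by lra.
    by apply: ler_wpM2l; [exact: ltW|exact: N2].
  rewrite -expRD ler_expR.
  have : 5 * L <= 5 * (g^-1 * U) by lra.
  have : 5 * (g^-1 * U) <= 5 * (1 / 512 * U).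
    rewrite ler_pM2l; last by lra.
    apply: ler_wpM2r => //; rewrite -[leLHS]div1r ler_pdivrMr //; lra.
  move: (g^-1 * U) L_le U2_le gU_le => y; lra.
apply: (@le_trans _ _ (N ^+ 2 * (expR (- (3 * L) - V) + expR (- (3 * L) - V)))).
  apply: ler_pM; [exact: ler0n| |exact: M2|exact: lerD].
  by apply: addr_ge0; [exact: expR_ge0|apply: mulr_ge0; [lra|exact: expR_ge0]].
have -> : expR (- (3 * L) - V) = (N ^+ 3)^-1 * expR (- V) by rewrite expRD expR_ln_pow.
have -> : N ^+ 2 * ((N ^+ 3)^-1 * expR (- V) + (N ^+ 3)^-1 * expR (- V)) = 2 / N * expR (- V).
  by field; rewrite gt_eqF.
by apply: ler_piMl; [exact: expR_ge0|rewrite ler_pdivrMr // mul1r].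
Qed.
End UpperBoundClean.

Lemma sqr_powR_half (R : realType) (x : R) j : 0 <= x -> (x `^ (j%:R / 2)) ^+ 2 = x ^+ j.
Proof.
move=> x0; rewrite -powR_mulrn ?powR_ge0 // -powRrM divfK // ?powR_mulrn //.
Qed.

Theorem theorem1p4 (R : realType) :
  exists c C : R, 0 < c /\ 0 < C /\
    forall (n m : nat) (t a : R),
      (2 <= n)%N ->
      t = m%:R / 'C(n, 2)%:R ->
      C * (n%:R `^ (- (1 / 2))) * (ln n%:R `^ (1 / 2)) <= t ->
      t <= 1 / 2 ->
      C * (t `^ (3 / 2)) * (n%:R `^ (3 / 2)) * Num.sqrt (ln n%:R) <= a ->
      a <= c * (t `^ (3 / 2)) * n%:R ^+ 2 ->
      let P := unif_prob R (graphs_nm n m)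
                 (fun E => triangle_deviation R m E < - a) in
      expR (- C * a ^+ 2 / (t ^+ 3 * n%:R ^+ 3)) <= P /\
      P <= expR (- c * a ^+ 2 / (t ^+ 3 * n%:R ^+ 3)).
Proof.
(* [g] is a large absolute constant; the three bounds are those required by the
   numerical constants of the bound on the lower tail and of the mean drift. *)
have [g [g3 g_tail g_drift]] : exists g : R,
    [/\ 10 ^+ 3 <= g, 6 * (864 * 10 ^+ 3) <= g & 4 / g <= 3 / 10 ^+ 5 / 64].
  exists (10 * (10 * (10 * (10 * 10 ^+ 3)))).
  have : 0 < 10 ^+ 3 :> R by apply: exprn_gt0; lra.
  have -> : (10 : R) ^+ 5 = 10 * (10 * 10 ^+ 3) by rewrite -!exprS.
  move: (10 ^+ 3 : R) => d d0; split; [lra|lra|].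
  have -> : 4 / (10 * (10 * (10 * (10 * d)))) = 4 / (10 * (10 * (10 * 10))) / d by field; rewrite gt_eqF.
  have -> : 3 / (10 * (10 * d)) / 64 = 3 / (10 * 10 * 64) / d by field; rewrite gt_eqF.
  apply: ler_wpM2r; [by rewrite invr_ge0 ltW|lra].
have g1 : 1 < g := scale_gt1 g3.
have g0 : 0 < g by lra.
(* The squares of both constants are powers [g^10], the slack used for the
   deviation and for the density; [g^5] also exceeds [2 g^2 + 1]. *)
exists (g ^+ 5)^-1, (g ^+ 5).
split; first by rewrite invr_gt0 exprn_gt0.
split; first exact: exprn_gt0.
move=> [//|k] m t a n2 tE t_ge t2 a_ge a_le.
set N := (k.+1%:R : R) in t_ge a_ge a_le *; set L := ln N in t_ge a_ge *.
have L12 : 1 / 2 <= L by apply: ln_ge_half.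
have L0 : 0 <= L by lra.
have N0 : 0 < N by rewrite /N.
have g5 : 0 < g ^+ 5 by rewrite exprn_gt0.
have t0 : 0 < t.
  by apply: lt_le_trans t_ge; rewrite !mulr_gt0 ?powR_gt0 //; lra.
have t3 : (t `^ (3 / 2)) ^+ 2 = t ^+ 3 by rewrite (sqr_powR_half 3) // ltW.
have a0 : 0 < a.
  by apply: lt_le_trans a_ge; rewrite !mulr_gt0 ?powR_gt0 ?sqrtr_gt0 //; lra.
have gN : g ^+ 10 * L <= t ^+ 2 * N.
  have : (g ^+ 5 * N `^ (- (1 / 2)) * L `^ (1 / 2)) ^+ 2 <= t ^+ 2.
    have p0 : 0 <= g ^+ 5 * N `^ (- (1 / 2)) * L `^ (1 / 2).
      by apply: mulr_ge0; [apply: mulr_ge0; [exact: ltW|exact: powR_ge0]|exact: powR_ge0].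
    by apply: lerXn2r; rewrite ?nnegrE ?(ltW t0).
  have -> : (g ^+ 5 * N `^ (- (1 / 2)) * L `^ (1 / 2)) ^+ 2 = g ^+ 10 * (L `^ (1 / 2)) ^+ 2 / (N `^ (1 / 2)) ^+ 2.
    by rewrite powRN; field; rewrite gt_eqF // powR_gt0.
  rewrite (sqr_powR_half 1) // (sqr_powR_half 1 (ltW N0)) !expr1.
  by rewrite ler_pdivrMr.
have a_ge' : g ^+ 10 * (t ^+ 3 * N ^+ 3) * L <= a ^+ 2.
  have -> : g ^+ 10 * (t ^+ 3 * N ^+ 3) * L = (g ^+ 5 * t `^ (3 / 2) * N `^ (3 / 2) * Num.sqrt L) ^+ 2.
    rewrite -t3 -(sqr_powR_half 3 (ltW N0)) -[in LHS](sqr_sqrtr L0); ring.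
  have p0 : 0 <= g ^+ 5 * t `^ (3 / 2) * N `^ (3 / 2) * Num.sqrt L.
    apply: mulr_ge0; [apply: mulr_ge0; [apply: mulr_ge0|]|exact: sqrtr_ge0]; rewrite ?powR_ge0 //.
    exact: ltW.
  by apply: lerXn2r; rewrite ?nnegrE ?(ltW a0).
have a_le' : g ^+ 10 * a ^+ 2 <= t ^+ 3 * N ^+ 4.
  have : a ^+ 2 <= ((g ^+ 5)^-1 * t `^ (3 / 2) * N ^+ 2) ^+ 2.
    apply: lerXn2r; rewrite ?nnegrE ?(ltW a0) //.
    exact: le_trans (ltW a0) a_le.
  have -> : ((g ^+ 5)^-1 * t `^ (3 / 2) * N ^+ 2) ^+ 2 = (t `^ (3 / 2)) ^+ 2 * N ^+ 4 / g ^+ 10.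
    by field; rewrite gt_eqF.
  by rewrite t3 ler_pdivlMr ?exprn_gt0 // mulrC.
have U0 : 0 <= a ^+ 2 / (t ^+ 3 * N ^+ 3).
  by apply: divr_ge0; [exact: sqr_ge0|rewrite mulr_ge0 ?exprn_ge0 ?(ltW t0) ?(ltW N0)].
rewrite /= graphs_nm_draws; split.
  apply: le_trans (lower_tail_lower n2 tE t2 g3 gN g_tail g_drift a0 a_ge' a_le').
  rewrite ler_expR -mulrA mulNr lerN2; apply: ler_wpM2r => //.
  have g2 : 4 <= g ^+ 2.
    have := scale_ge512 g3 => h; apply: (@le_trans _ _ g); first by lra.
    by rewrite expr2; apply: ler_peMl; lra.
  have : 4 * g ^+ 2 <= g ^+ 3 * g ^+ 2.
    apply: ler_wpM2r; first exact: sqr_ge0.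
    apply: (@le_trans _ _ (g ^+ 2)); [lra|by rewrite ler_weXn2l // ltW].
  rewrite -exprD; lra.
apply: le_trans (lower_tail_upper_gaussian n2 tE t2 g3 gN g_tail a0 a_ge' a_le') _.
rewrite ler_expR -mulrA mulNr lerN2; apply: ler_wpM2r => //.
by rewrite lef_pV2 ?posrE ?exprn_gt0 // ler_weXn2l // ltW.
Qed.
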